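(* Let $n$ be a natural number. There is a bijective correspondence between the set $bG_n$ of Reidemeister equivalence classes of braid Gauss diagrams on $n$ strands and the set $VB_n$ of virtual braids on $n$ strands; namely, the map $\beta\mapsto G(\beta)$ induces a bijection $VB_n\to bG_n$.
   Context: Let $I=[0,1]$, $\mathbf D=I\times I$, and let $\pi_1,\pi_2:\mathbf D\to I$ be the coordinate projections. A strand diagram on $n$ strands is an $n$-tuple of curves $\beta=(\beta_1,\dots,\beta_n)$, $\beta_k:I\to\mathbf D$, such that: there is $\sigma\in S_n$ with $\beta_k(0)=a_k:=(0,\frac{k}{n+1})$ and $\beta_k(1)=b_{\sigma(k)}$, where $b_k:=(1,\frac{k}{n+1})$; $\pi_1(\beta_k(t))=t$ for all $t$; and the curves are in general position (all multiple points are transversal double points, called crossings). A virtual braid diagram is a strand diagram with a function assigning to each crossing a value in $\{+1,-1,v\}$ (positive, negative, virtual). Positive and negative crossings are called regular; $VBD_n$ is the set of virtual braid diagrams on $n$ strands. At a positive (resp. negative) crossing the over-passing strand is the one going from upper left to lower right (resp. from lower left to upper right), so the sign is the local writhe. An isotopy of virtual braid diagrams is a continuous deformation through virtual braid diagrams, fixing endpoints and carrying along the crossings and their values. Moves replace the part of a diagram inside a disc $V\subset\mathbf D$ (the diagrams agreeing outside $V$ up to isotopy). Let $\sigma_i,\sigma_i^{-1},\tau_i$ denote a single positive, negative, virtual crossing between the strands in adjacent positions $i,i+1$ (positions counted inside $V$), products being concatenated from left to right. Reidemeister moves: $R2a$, $R2b$: $\sigma_i\sigma_i^{-1}\leftrightarrow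 1$, $\sigma_i^{-1}\sigma_i\leftrightarrow 1$; $R3$: $\sigma_i\sigma_{i+1}\sigma_i\leftrightarrow\sigma_{i+1}\sigma_i\sigma_{i+1}$. Virtual moves: $V2$: $\tau_i\tau_i\leftrightarrow 1$; $V3$: $\tau_i\tau_{i+1}\tau_i\leftrightarrow\tau_{i+1}\tau_i\tau_{i+1}$. Mixed moves: $M$: $\sigma_i\tau_{i+1}\tau_i\leftrightarrow\tau_{i+1}\tau_i\sigma_{i+1}$; $M'$: the same with $\sigma^{-1}$ in place of $\sigma$. Two virtual braid diagrams are virtually Reidemeister equivalent, $\beta\sim\beta'$, if they are related by isotopy and finitely many Reidemeister, virtual or mixed moves; $VB_n=VBD_n/\sim$ is the set of virtual braids on $n$ strands. A Gauss diagram on $n$ strands is an ordered collection of $n$ oriented intervals, with finitely many arrows, each joining two points in the interiors of the intervals and labelled with a sign $\pm1$, and with a permutation $\sigma\in S_n$, the endpoint of the $i$-th interval being labelled $\sigma(i)$. Gauss diagrams are considered up to orientation preserving homeomorphism of the underlying intervals. A braid Gauss diagram is a Gauss diagram whose arrows are pairwise disjoint, each connecting two different intervals, and for which the intervals can be parametrized by $I=[0,1]$ so that the two endpoints of each arrow correspond to the same $t\in I$ and different arrows correspond to different $t$'s. Listing the arrows in order of increasing $t$, a braid Gauss diagram can be written $(W,\sigma)$ with $W$ a word in letters $X_{i,j}^{\epsilon}$ ($i\ne j$, $\epsilon=\pm1$), where $X_{i,j}^{\epsilon}$ is an arrow from interval $i$ to interval $j$ with sign $\epsilon$; $W$ is well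 defined up to exchanging consecutive letters with disjoint index sets. The Gauss diagram $G(\beta)$ of a virtual braid diagram $\beta$ has one interval for each strand of $\beta$ (in order), one arrow for each regular crossing with endpoints at the preimages of the crossing, pointing from the over-passing strand to the under-passing strand and carrying the sign of the crossing, and has the permutation associated to $\beta$. It is always a braid Gauss diagram. An $\Omega2$ move on a braid Gauss diagram replaces a subword $X_{i,j}^{\epsilon}X_{i,j}^{-\epsilon}$ of a representing word by the empty word, or conversely ($i\neq j$). An $\Omega3$ move replaces a subword $X_{i,j}^{\epsilon}X_{i,k}^{\epsilon}X_{j,k}^{\epsilon}$ by $X_{j,k}^{\epsilon}X_{i,k}^{\epsilon}X_{i,j}^{\epsilon}$, or conversely ($i,j,k$ distinct, $\epsilon=\pm1$). Reidemeister equivalence of braid Gauss diagrams is the equivalence relation generated by $\Omega2$ and $\Omega3$ moves, and $bG_n$ is the set of equivalence classes. *)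

(* Defs.v *)
From mathcomp Require Import all_boot all_order all_algebra all_fingroup.
From mathcomp Require Import all_classical all_reals all_analysis.
From Stdlib Require Import Relation_Operators.

Set Implicit Arguments.
Unset Strict Implicit.
Unset Printing Implicit Defensive.

Import Order.TTheory GRing.Theory Num.Theory.
Import numFieldNormedType.Exports.

Local Open Scope classical_set_scope.
Local Open Scope ring_scope.

(* Curves I -> D are total functions R -> R * R of which only the restriction
   to I = [0,1] matters; D = I x I has its first coordinate running from left
   to right and its second one running upwards. *)

Definition unitI (R : realType) : set R := `[0, 1].
Arguments unitI R : clear implicits.

(* The indices of 'I_n are 0-based, hence the successor. *)
Definition height (R : realType) (n : nat) (k : 'I_n) : R :=
  k.+1%:R / n.+1%:R.
Arguments height R {n} k.

Definition passes (R : realType) (n : nat) (c : 'I_n -> R -> R * R)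
    (k : 'I_n) (p : R * R) : Prop :=
  (c k @` unitI R) p.

Definition multiple_points (R : realType) (n : nat)
    (c : 'I_n -> R -> R * R) : set (R * R) :=
  [set p | exists i j, [/\ i != j, passes c i p & passes c j p]].

(* At p, strand i goes from upper left to lower right with respect to
   strand j. *)
Definition descends (R : realType) (n : nat) (c : 'I_n -> R -> R * R)
    (i j : 'I_n) (p : R * R) : Prop :=
  [/\ passes c i p, passes c j p,
      \forall t \near p.1^'-, (c j t).2 < (c i t).2 &
      \forall t \near p.1^'+, (c i t).2 < (c j t).2].

(* Curves are continuous, so transversality is topological: the two strands
   exchange sides at their common point. Such points are isolated, so the
   finiteness clause is in fact a consequence of the other one and of the
   compactness of I. *)
Definition general_position (R : realType) (n : nat)
    (c : 'I_n -> R -> R * R) : Prop :=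
  finite_set (multiple_points c) /\
  forall p i j, i != j -> passes c i p -> passes c j p ->
    (forall k, passes c k p -> k = i \/ k = j) /\
    (descends c i j p \/ descends c j i p).

Record strand_diagram (R : realType) (n : nat) := StrandDiagram {
  curve : 'I_n -> R -> R * R;
  strand_perm : 'S_n;
  curve_continuous : forall k, {within unitI R, continuous (curve k)};
  curve_square : forall k t, unitI R t -> (unitI R `*` unitI R) (curve k t);
  curve_monotone : forall k t, unitI R t -> (curve k t).1 = t;
  curve_left : forall k, curve k 0 = (0, height R k);
  curve_right : forall k, curve k 1 = (1, height R (strand_perm k));
  curve_general : general_position curve
}.

Definition crossings (R : realType) (n : nat) (b : strand_diagram R n) :
    set (R * R) :=
  multiple_points (curve b).

Inductive crossing_value := Positive | Negative | Virtual.

(* [cvalue] is total on the plane; only its values at the crossings are ever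
   used, and isotopy identifies diagrams which differ only elsewhere. *)
Record virtual_braid_diagram (R : realType) (n : nat) := VirtualBraidDiagram {
  vbd_strands :> strand_diagram R n;
  cvalue : R * R -> crossing_value
}.

(* The functions [x a] follow the crossings during the deformation. They are
   part of the notion: a merely uniformly continuous deformation of continuous
   curves could let a cluster of crossings shrink to a single one. *)
Definition isotopic (R : realType) (n : nat)
    (b0 b1 : virtual_braid_diagram R n) : Prop :=
  exists H : R -> virtual_braid_diagram R n,
    [/\ H 0 = b0, H 1 = b1,
        forall k, {within unitI R `*` unitI R,
          continuous (fun st : R * R => curve (H st.1) k st.2)} &
        exists (m : nat) (x : 'I_m -> R -> R * R),
          [/\ forall a, {within unitI R, continuous (x a)},
              forall s, unitI R s ->
                set_bij [set: 'I_m] (crossings (H s)) (x ^~ s) &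
              forall a s, unitI R s ->
                cvalue (H s) (x a s) = cvalue (H 0) (x a 0)]].

(* The discs supporting the moves: a disc is delimited by two vertical
   segments and by the graphs of two functions. *)
Record disc (R : realType) := Disc {
  dleft : R;
  dright : R;
  dlow : R -> R;
  dhigh : R -> R;
  disc_sides : [/\ 0 <= dleft, dleft < dright & dright <= 1];
  dlow_continuous : {within `[dleft, dright], continuous dlow};
  dhigh_continuous : {within `[dleft, dright], continuous dhigh};
  disc_heights : forall t, dleft <= t <= dright ->
    [/\ 0 <= dlow t, dlow t < dhigh t & dhigh t <= 1]
}.

Definition disc_set (R : realType) (V : disc R) : set (R * R) :=
  [set p | dleft V <= p.1 <= dright V /\ dlow V p.1 <= p.2 <= dhigh V p.1].

(* The part of b inside V is itself a diagram: each strand either crosses V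
   from its left side to its right side, or avoids V. *)
Definition cuts_out (R : realType) (n : nat) (b : strand_diagram R n)
    (V : disc R) : Prop :=
  forall k,
    (forall t, dleft V <= t <= dright V ->
       dlow V t < (curve b k t).2 < dhigh V t) \/
    (forall t, unitI R t -> ~ disc_set V (curve b k t)).

(* (v, i) stands for a single crossing with value v between the strands in
   positions i and i.+1, positions being counted from the bottom, from 0. *)
Definition letter := (crossing_value * nat)%type.

Definition position (R : realType) (n : nat) (b : strand_diagram R n)
    (V : disc R) (p : R * R) : nat :=
  #|[set k : 'I_n | `[< disc_set V (curve b k p.1) /\
                        (curve b k p.1).2 < p.2 >]]%SET|.

Definition spells (R : realType) (n : nat) (b : virtual_braid_diagram R n)
    (V : disc R) (w : seq letter) : Prop :=
  exists ps : seq (R * R),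
    [/\ crossings b `&` disc_set V = [set` ps],
        forall p, p \in ps -> dleft V < p.1 < dright V,
        sorted (fun p q : R * R => p.1 < q.1) ps &
        [seq (cvalue b p, position b V p) | p <- ps] = w].

Definition sigma (i : nat) : letter := (Positive, i).
Definition sigmaV (i : nat) : letter := (Negative, i).
Definition tau (i : nat) : letter := (Virtual, i).

Inductive local_move : seq letter -> seq letter -> Prop :=
| R2a i : local_move [:: sigma i; sigmaV i] [::]
| R2b i : local_move [:: sigmaV i; sigma i] [::]
| R3 i : local_move [:: sigma i; sigma i.+1; sigma i]
                    [:: sigma i.+1; sigma i; sigma i.+1]
| V2 i : local_move [:: tau i; tau i] [::]
| V3 i : local_move [:: tau i; tau i.+1; tau i]
                    [:: tau i.+1; tau i; tau i.+1]
| M i : local_move [:: sigma i; tau i.+1; tau i]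
                   [:: tau i.+1; tau i; sigma i.+1]
| M' i : local_move [:: sigmaV i; tau i.+1; tau i]
                    [:: tau i.+1; tau i; sigmaV i.+1].

Definition agree_outside (R : realType) (n : nat)
    (b b' : virtual_braid_diagram R n) (V : disc R) : Prop :=
  (forall k t, unitI R t ->
     ~ disc_set V (curve b k t) \/ ~ disc_set V (curve b' k t) ->
     curve b k t = curve b' k t) /\
  (forall p, crossings b p -> ~ disc_set V p -> cvalue b p = cvalue b' p).

Definition diagram_move (R : realType) (n : nat)
    (b b' : virtual_braid_diagram R n) : Prop :=
  exists (V : disc R) (w w' : seq letter),
    [/\ local_move w w', agree_outside b b' V,
        cuts_out b V /\ cuts_out b' V, spells b V w & spells b' V w'].

Definition virtually_equivalent (R : realType) (n : nat)
    (b b' : virtual_braid_diagram R n) : Prop :=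
  clos_refl_sym_trans _ (fun c c' => isotopic c c' \/ diagram_move c c') b b'.

Definition virtual_braid_of (R : realType) (n : nat)
    (b : virtual_braid_diagram R n) : set (virtual_braid_diagram R n) :=
  [set b' | virtually_equivalent b b'].

Definition VB (R : realType) (n : nat) :
    set (set (virtual_braid_diagram R n)) :=
  range (@virtual_braid_of R n).
Arguments VB R n : clear implicits.

(* An arrow (x, y, e) points from x to y; a point of the union of the
   intervals is given by the index of its interval and its parameter in I.
   The sign e is true for +1 and false for -1. *)
Definition arrow (R : realType) (n : nat) :=
  (('I_n * R) * ('I_n * R) * bool)%type.
Definition tail (R : realType) (n : nat) (a : arrow R n) : 'I_n * R := a.1.1.
Definition head (R : realType) (n : nat) (a : arrow R n) : 'I_n * R := a.1.2.
Definition asign (R : realType) (n : nat) (a : arrow R n) : bool := a.2.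

Record gauss_diagram (R : realType) (n : nat) := GaussDiagram {
  arrows : set (arrow R n);
  gauss_perm : 'S_n;
  arrows_finite : finite_set arrows;
  arrows_interior : forall a, arrows a ->
    0 < (tail a).2 < 1 /\ 0 < (head a).2 < 1
}.

(* Orientation preserving homeomorphisms of I. *)
Definition increasing_homeo (R : realType) (h : R -> R) : Prop :=
  [/\ set_bij (unitI R) (unitI R) h,
      {within unitI R, continuous h} &
      forall s t, unitI R s -> unitI R t -> s < t -> h s < h t].

Definition move_arrow (R : realType) (n : nat) (h : 'I_n -> R -> R)
    (a : arrow R n) : arrow R n :=
  (((tail a).1, h (tail a).1 (tail a).2),
   ((head a).1, h (head a).1 (head a).2), asign a).

Definition gauss_homeo (R : realType) (n : nat) (g g' : gauss_diagram R n) :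
    Prop :=
  exists h : 'I_n -> R -> R,
    [/\ forall k, increasing_homeo (h k),
        arrows g' = move_arrow h @` arrows g &
        gauss_perm g' = gauss_perm g].

Definition arrow_time (R : realType) (n : nat) (h : 'I_n -> R -> R)
    (a : arrow R n) : R :=
  h (tail a).1 (tail a).2.

(* [h k] is the inverse of the parametrization of the k-th interval. *)
Definition braid_parametrization (R : realType) (n : nat)
    (g : gauss_diagram R n) (h : 'I_n -> R -> R) : Prop :=
  [/\ forall k, increasing_homeo (h k),
      forall a, arrows g a ->
        h (tail a).1 (tail a).2 = h (head a).1 (head a).2 &
      forall a b, arrows g a -> arrows g b ->
        arrow_time h a = arrow_time h b -> a = b].

Definition braid_gauss (R : realType) (n : nat) (g : gauss_diagram R n) :
    Prop :=
  [/\ forall a b, arrows g a -> arrows g b -> a <> b ->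
        [set tail a; head a] `&` [set tail b; head b] = set0,
      forall a, arrows g a -> (tail a).1 != (head a).1 &
      exists h, braid_parametrization g h].

(* (i, j, e) is the letter X_{i,j}^e. *)
Definition gauss_letter (n : nat) := ('I_n * 'I_n * bool)%type.

Definition letter_of (R : realType) (n : nat) (a : arrow R n) :
    gauss_letter n :=
  ((tail a).1, (head a).1, asign a).

Definition represents (R : realType) (n : nat) (g : gauss_diagram R n)
    (W : seq (gauss_letter n)) : Prop :=
  braid_gauss g /\
  exists (h : 'I_n -> R -> R) (s : seq (arrow R n)),
    [/\ braid_parametrization g h, arrows g = [set` s],
        sorted (fun a b => arrow_time h a < arrow_time h b) s &
        W = [seq letter_of a | a <- s]].

Inductive word_move (n : nat) :
    seq (gauss_letter n) -> seq (gauss_letter n) -> Prop :=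
| Omega2 i j e : i != j ->
    word_move [:: (i, j, e); (i, j, ~~ e)] [::]
| Omega3 i j k e : i != j -> j != k -> i != k ->
    word_move [:: (i, j, e); (i, k, e); (j, k, e)]
              [:: (j, k, e); (i, k, e); (i, j, e)].

Definition gauss_move (R : realType) (n : nat) (g g' : gauss_diagram R n) :
    Prop :=
  exists W1 W W' W2,
    [/\ word_move W W', represents g (W1 ++ W ++ W2),
        represents g' (W1 ++ W' ++ W2) & gauss_perm g = gauss_perm g'].

Definition reidemeister_equivalent (R : realType) (n : nat)
    (g g' : gauss_diagram R n) : Prop :=
  clos_refl_sym_trans _ (fun f f' => gauss_homeo f f' \/ gauss_move f f') g g'.

Definition gauss_class (R : realType) (n : nat) (g : gauss_diagram R n) :
    set (gauss_diagram R n) :=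
  [set g' | reidemeister_equivalent g g'].

Definition bG (R : realType) (n : nat) : set (set (gauss_diagram R n)) :=
  @gauss_class R n @` [set g | braid_gauss g].
Arguments bG R n : clear implicits.

(* Strand k of a diagram is parametrized by I, so the preimage of a crossing p
   on it is p.1. The descending strand passes over at a positive crossing and
   under at a negative one. *)
Definition diagram_arrows (R : realType) (n : nat)
    (b : virtual_braid_diagram R n) : set (arrow R n) :=
  [set a | exists p i j, [/\ i != j, descends (curve b) i j p &
    (cvalue b p = Positive /\ a = ((i, p.1), (j, p.1), true)) \/
    (cvalue b p = Negative /\ a = ((j, p.1), (i, p.1), false))]].

Lemma diagram_arrows_finite (R : realType) (n : nat)
  (b : virtual_braid_diagram R n) : finite_set (diagram_arrows b).
Proof.
pose f (z : (R * R) * ('I_n * 'I_n * bool)) : arrow R n :=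
  ((z.2.1.1, z.1.1), (z.2.1.2, z.1.1), z.2.2).
apply: (@sub_finite_set _ _ (f @` (crossings b `*` [set: 'I_n * 'I_n * bool]))).
  move=> a [p [i [j [ij [pi pj _ _] H]]]].
  have cp : crossings b p by exists i, j.
  by case: H => -[_ ->];
    [exists (p, (i, j, true)) | exists (p, (j, i, false))].
apply: finite_image; apply: finite_setX; last exact: finite_finset.
exact: (curve_general b).1.
Qed.

Lemma height_inj (R : realType) (n : nat) : injective (@height R n).
Proof.
move=> i j /mulIf H; apply/val_inj => /=.
have /eqP : i.+1%:R = j.+1%:R :> R by apply: H; rewrite invr_eq0 pnatr_eq0.
by rewrite eqr_nat => /eqP [].
Qed.

Lemma crossing_interior (R : realType) (n : nat) (b : strand_diagram R n)
  (p : R * R) : crossings b p -> 0 < p.1 < 1.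
Proof.
move=> [i [j [ij [t tI ti] [u uI uj]]]].
have t1 : t = p.1 by rewrite -ti curve_monotone.
have u1 : u = p.1 by rewrite -uj curve_monotone.
move: tI ti uj; rewrite {}u1 {}t1 /unitI /= in_itv /= => /andP[p0 p1] pi pj.
rewrite !lt_neqAle p0 p1 !andbT; apply/andP; split; apply/negP => /eqP E.
  move: pi pj; rewrite -E !curve_left => <- [/height_inj ji].
  by rewrite ji eqxx in ij.
move: pi pj; rewrite E !curve_right => <- [/height_inj/perm_inj ji].
by rewrite ji eqxx in ij.
Qed.

Lemma diagram_arrows_interior (R : realType) (n : nat)
  (b : virtual_braid_diagram R n) (a : arrow R n) :
  diagram_arrows b a -> 0 < (tail a).2 < 1 /\ 0 < (head a).2 < 1.
Proof.
move=> [p [i [j [ij [pi pj _ _] H]]]].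
have cp : crossings b p by exists i, j.
by have := crossing_interior cp; case: H => -[_ ->].
Qed.

Definition gauss_of (R : realType) (n : nat) (b : virtual_braid_diagram R n) :
    gauss_diagram R n :=
  GaussDiagram (strand_perm b) (@diagram_arrows_finite R n b)
    (@diagram_arrows_interior R n b).

(* Main.v *)
(* Cutting a diagram between its crossings, after an isotopy separating their
   times, turns virtual braid diagrams into words in the letters sigma_i,
   sigma_i^-1, tau_i, and virtual equivalence into the congruence generated by
   the local moves and by the commutations of far letters; its Gauss diagram
   retains the pure part of the word.  Conversely, an arrow X_(i,j) is drawn by
   bringing the strands i and j to the first two positions with virtual
   crossings, letting them cross and undoing the virtual crossings.  The virtual
   and mixed moves make this independent of the choices and make disjoint arrows
   commute, while R2 and R3 then become Omega2 and Omega3, so that a word is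
   determined up to the moves by its Gauss diagram and its permutation.

   The map is well defined because an isotopy preserves the pair of strands
   meeting at each crossing and the order of the crossings along each strand, so
   that both Gauss diagrams have a common linear extension.  A move inside a disc
   changes such an extension by a factor. *)

Require Import Defs.
From mathcomp Require Import all_boot all_order all_algebra all_fingroup.
From mathcomp Require Import all_classical all_reals all_analysis.
From HB Require Import structures.
From Stdlib Require Import Relation_Operators.
From mathcomp Require Import zify ring lra.
Import Defs.

Set Implicit Arguments.
Unset Strict Implicit.
Unset Printing Implicit Defensive.

Import Order.TTheory GRing.Theory Num.Theory.
Import numFieldNormedType.Exports.

Local Open Scope classical_set_scope.
Local Open Scope ring_scope.

(** * Words and local moves *)

(** An isotopy must be exhibited with continuous tracks of all its crossings, so only two kinds are
    built: a change of time on some strands in a window where they keep away from the others, and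
    the linear homotopy between diagrams whose strands are in the same order at each time. The first
    separates simultaneous crossings, exchanges far letters and aligns crossing times; the second
    shows that the list of timed and labelled crossings determines the diagram up to isotopy. Discs
    are then constructed only as full-height strips in polygonal diagrams. For words the obstacle is
    that a Gauss word forgets the virtual letters. These satisfy the Coxeter relations, so their
    permutation determines them, and multiplying a signed letter by the virtual one of the same
    index makes it pure. A given disc, on the contrary, is arbitrary, and other crossings may lie
    above or below it at the same times. They share no strand with the crossings inside, so a linear
    extension can list them first. For a given isotopy, the finiteness and continuity of the tracks
    prevent the pair of strands at a crossing from changing. *)

Definition adj (n i : nat) : 'S_n :=
  match insub i, insub i.+1 with
  | Some a, Some b => tperm a b
  | _, _ => 1%g
  end.
Arguments adj n i : clear implicits.

Lemma adjE n i (a : 'I_n) : (i.+1 < n)%N ->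
  adj n i a = (if a == i :> nat then i.+1 else if a == i.+1 :> nat then i else a)
  :> nat.
Proof.
move=> lti; rewrite /adj; have lti' : (i < n)%N by exact: ltnW.
case: insubP => [b _ vb|]; last by rewrite lti'.
case: insubP => [c _ vc|]; last by rewrite lti.
case: tpermP => [->|->|/eqP + /eqP +]; rewrite -?val_eqE /= ?vb ?vc ?eqxx //.
  by rewrite gtn_eqF.
by move=> /negbTE -> /negbTE ->.
Qed.

(** A disjunction of equations in [nat], so that [adj_lia] can hand every case analysis on adjacent
    transpositions to [lia]. *)
Definition adj_fact n i (a : 'I_n) :=
  (a = i :> nat /\ adj n i a = i.+1 :> nat) \/
  (a = i.+1 :> nat /\ adj n i a = i :> nat) \/
  (a <> i :> nat /\ a <> i.+1 :> nat /\ adj n i a = a :> nat).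

Lemma adjP n i (a : 'I_n) : (i.+1 < n)%N -> adj_fact i a.
Proof.
rewrite /adj_fact => /adjE ->.
by case: eqP => [|?]; [left | case: eqP; [right; left | right; right]].
Qed.

Ltac adj_lia :=
  repeat match goal with |- context [@fun_of_perm _ (adj ?n ?i) ?a] =>
    lazymatch goal with
    | H : @adj_fact n i a |- _ => fail
    | _ => let H := fresh in
        assert (H : @adj_fact n i a) by (apply: adjP => //; lia)
    end
  end;
  unfold adj_fact in *; lia.

Lemma adj_out n i : (n <= i.+1)%N -> adj n i = 1%g.
Proof.
move=> le; rewrite /adj; case: insubP => // a _ _; case: insubP => // b lb _.
by move: lb; rewrite ltnNge le.
Qed.

Lemma adjV n i : (adj n i)^-1%g = adj n i.
Proof.
rewrite /adj; case: insubP => [a _ _|_]; last by rewrite invg1.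
by case: insubP => [b _ _|_]; rewrite ?invg1 ?tpermV.
Qed.

Lemma adjK n i : involutive (adj n i).
Proof. by move=> a; rewrite -{1}adjV permK. Qed.

(** Permutations compose from left to right, so [state n w a] is the final position of the strand
    that starts in position [a]. *)
Definition state n (w : seq letter) : 'S_n := (\prod_(x <- w) adj n x.2)%g.
Arguments state n w : clear implicits.

Lemma state_nil n : state n [::] = 1%g. Proof. by rewrite /state big_nil. Qed.

Lemma state_cons n x w : state n (x :: w) = (adj n x.2 * state n w)%g.
Proof. by rewrite /state big_cons. Qed.

Lemma state_cat n w w' : state n (w ++ w') = (state n w * state n w')%g.
Proof. by rewrite /state big_cat. Qed.

Lemma state1 n x : state n [:: x] = adj n x.2.
Proof. by rewrite state_cons state_nil mulg1. Qed.

(** Letters out of range are permitted elsewhere: they act as the identity and serve as padding in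
    the drawn words. *)
Definition valid n (w : seq letter) := all (fun x => x.2.+1 < n)%N w.
Arguments valid n w : clear implicits.

Definition far (x y : letter) := (x.2.+1 < y.2)%N || (y.2.+1 < x.2)%N.

(* Equality in the monoid presented by the local moves and the far
   commutation relations. *)
Inductive weq n : seq letter -> seq letter -> Prop :=
| weq_refl w : weq n w w
| weq_sym w w' : weq n w w' -> weq n w' w
| weq_trans w w' w'' : weq n w w' -> weq n w' w'' -> weq n w w''
| weq_cat u u' w w' : weq n u u' -> weq n w w' -> weq n (u ++ w) (u' ++ w')
| weq_move w w' : local_move w w' -> valid n w -> valid n w' -> weq n w w'
| weq_far x y : far x y -> valid n [:: x; y] -> weq n [:: x; y] [:: y; x].

#[local] Hint Resolve weq_refl : core.

Lemma weq_ctx n a b u u' : weq n u u' -> weq n (a ++ u ++ b) (a ++ u' ++ b).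
Proof. by move=> H; apply: weq_cat => //; apply: weq_cat. Qed.

Lemma weq_catl n a u u' : weq n u u' -> weq n (a ++ u) (a ++ u').
Proof. exact: weq_cat. Qed.

Lemma weq_catr n b u u' : weq n u u' -> weq n (u ++ b) (u' ++ b).
Proof. by move=> H; apply: weq_cat. Qed.

Definition inv_letter (x : letter) : letter :=
  (match x.1 with
   | Positive => Negative | Negative => Positive | Virtual => Virtual
   end, x.2).

Definition inv_word (w : seq letter) := rev (map inv_letter w).

Lemma inv_letterK : involutive inv_letter.
Proof. by case=> -[]. Qed.

Lemma inv_wordK : involutive inv_word.
Proof.
move=> w; rewrite /inv_word map_rev revK -map_comp.
by rewrite (eq_map inv_letterK) map_id.
Qed.

Lemma inv_word_cat w w' : inv_word (w ++ w') = inv_word w' ++ inv_word w.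
Proof. by rewrite /inv_word map_cat rev_cat. Qed.

Lemma valid_inv n w : valid n (inv_word w) = valid n w.
Proof. by rewrite /valid /inv_word all_rev all_map. Qed.

Lemma state_inv n w : state n (inv_word w) = (state n w)^-1%g.
Proof.
elim: w => [|x w IH]; first by rewrite /inv_word /= state_nil invg1.
rewrite -cat1s inv_word_cat !state_cat IH invMg; congr (_ * _)%g.
by rewrite !state1 adjV.
Qed.

Lemma weq_invr n w : valid n w -> weq n (w ++ inv_word w) [::].
Proof.
elim: w => [|x w IH] //= /andP[vx /IH {}IH].
rewrite -(cat1s x w) inv_word_cat -(cat1s x (_ ++ _)).
apply: (weq_trans (w' := [:: x] ++ [::] ++ inv_word [:: x])).
  by rewrite (catA w); apply: weq_ctx.
case: x vx => -[] i /= vi.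
- by apply: weq_move; rewrite /valid /= ?vi //; exact: R2a.
- by apply: weq_move; rewrite /valid /= ?vi //; exact: R2b.
- by apply: weq_move; rewrite /valid /= ?vi //; exact: V2.
Qed.

Lemma weq_invl n w : valid n w -> weq n (inv_word w ++ w) [::].
Proof.
by move=> v; rewrite -{2}(inv_wordK w); apply: weq_invr; rewrite valid_inv.
Qed.

Lemma weq_inv n w w' : valid n w -> valid n w' -> weq n w w' ->
  weq n (inv_word w) (inv_word w').
Proof.
move=> v v' H.
apply: (weq_trans (w' := inv_word w ++ (w' ++ inv_word w'))).
  rewrite -{1}(cats0 (inv_word w)); apply: weq_catl; apply: weq_sym.
  exact: weq_invr.
apply: (weq_trans (w' := (inv_word w ++ w) ++ inv_word w')).
  by rewrite -catA; apply: weq_ctx; apply: weq_sym.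
by rewrite -{2}(cat0s (inv_word w')); apply: weq_catr; apply: weq_invl.
Qed.

Lemma weq_far_word n x w : all (far x) w -> valid n (x :: w) ->
  weq n (x :: w) (rcons w x).
Proof.
elim: w => [|y w IH] //= /andP[fxy fw] /and3P[vx vy vw].
apply: (weq_trans (w' := [:: y] ++ [:: x] ++ w)).
  apply: (@weq_catr n w [:: x; y] [:: y; x]); apply: weq_far => //.
  by rewrite /valid /= vx vy.
by apply: (@weq_catl n [:: y] (x :: w) (rcons w x)); apply: IH => //=; rewrite vx.
Qed.

Definition signed (e : bool) (i : nat) : letter :=
  if e then sigma i else sigmaV i.

Lemma signed_pos e i : (signed e i).2 = i. Proof. by case: e. Qed.

Lemma weq_mixed n e i : (i.+2 < n)%N ->
  weq n [:: signed e i; tau i.+1; tau i] [:: tau i.+1; tau i; signed e i.+1].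
Proof.
move=> lti; have lti' : (i.+1 < n)%N by exact: ltnW.
by case: e; apply: weq_move; rewrite /valid /= ?lti ?lti' //;
  [exact: M | exact: M'].
Qed.

(** The move exists only for positive crossings. Inverting both of its sides, whose indices read the
    same backwards, gives the negative case. *)
Lemma weq_R3 n e i : (i.+2 < n)%N ->
  weq n [:: signed e i; signed e i.+1; signed e i]
        [:: signed e i.+1; signed e i; signed e i.+1].
Proof.
move=> lti; have lti' : (i.+1 < n)%N by exact: ltnW.
have H : weq n [:: sigma i; sigma i.+1; sigma i]
               [:: sigma i.+1; sigma i; sigma i.+1].
  by apply: weq_move; rewrite /valid /= ?lti ?lti' //; exact: R3.
case: e => //.
by apply: (weq_inv _ _ H); rewrite /valid /= ?lti ?lti'.
Qed.

(** Conjugation by [tau i; tau i.+1] moves the pure word formed by a signed letter and its virtual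
    companion one position down. This is what allows every arrow to be drawn in the first two
    positions. *)
Lemma weq_shift n e i : (i.+2 < n)%N ->
  weq n [:: signed e i.+1; tau i.+1]
    [:: tau i; tau i.+1; signed e i; tau i; tau i.+1; tau i].
Proof.
move=> lti; have lti' : (i.+1 < n)%N by exact: ltnW.
apply: (weq_trans (w' := [:: tau i; tau i.+1; tau i.+1; tau i; signed e i.+1;
                          tau i.+1])).
  apply: weq_sym; apply: (@weq_catr n [:: signed e i.+1; tau i.+1] [:: tau i; tau i.+1; tau i.+1; tau i] [::]).
  apply: (@weq_invr n [:: tau i; tau i.+1]).
  by rewrite /valid /= lti lti'.
apply: (weq_trans (w' := [:: tau i; tau i.+1; signed e i; tau i.+1; tau i;
                          tau i.+1])).
  apply: (@weq_ctx n [:: tau i; tau i.+1] [:: tau i.+1] [:: tau i.+1; tau i; signed e i.+1]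
    [:: signed e i; tau i.+1; tau i]).
  by apply: weq_sym; apply: weq_mixed.
apply: (@weq_catl n [:: tau i; tau i.+1; signed e i] [:: tau i.+1; tau i; tau i.+1]
  [:: tau i; tau i.+1; tau i]).
apply: weq_sym; apply: weq_move; rewrite /valid /= ?lti ?lti' //; exact: V3.
Qed.

(** * Virtual words and the Coxeter presentation of the symmetric group *)

Definition tau_word (s : seq nat) : seq letter := map tau s.

Lemma valid_tau n s : valid n (tau_word s) = all (fun i => i.+1 < n)%N s.
Proof. by rewrite /valid all_map. Qed.

Lemma inv_tau s : inv_word (tau_word s) = tau_word (rev s).
Proof. by rewrite /inv_word /tau_word map_rev -map_comp. Qed.

Lemma state_fix n k w (a : 'I_n) : valid n w -> all (fun x => k < x.2)%N w ->
  (a <= k)%N -> state n w a = a.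
Proof.
move=> + + ak; elim: w => [|x w IH] /=; first by rewrite state_nil perm1.
move=> /andP[vx vw] /andP[kx kw]; rewrite state_cons permM.
suff -> : adj n x.2 a = a by apply: IH.
by apply/val_inj => /=; adj_lia.
Qed.

Lemma state_chain n k r (a : 'I_n) : (k + r < n)%N -> a = k :> nat ->
  state n (tau_word (iota k r)) a = (k + r)%N :> nat.
Proof.
elim: r k a => [|r IH] k a kr ak; first by rewrite state_nil perm1 addn0.
rewrite /= state_cons permM addnS -addSn.
have lt : (k.+1 + r < n)%N by move: kr; rewrite addnS.
apply: IH => //; rewrite adjE /=; first by rewrite ak eqxx.
by lia.
Qed.

(** Chains of consecutive letters starting at [k] represent the right cosets of the subgroup
    generated by the letters above [k]. A further letter on the right yields a chain again: a letter
    beyond the chain commutes to the front, the next letter lengthens the chain, its last letter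
    cancels by V2, and an inner letter [i] reaches the front as [i.+1] by V3. *)
Lemma weq_chain n k r i : (k <= i)%N -> (i.+1 < n)%N -> (k + r < n)%N ->
  exists s r', [/\ all (fun j => k < j)%N s, all (fun j => j.+1 < n)%N s,
    (k + r' < n)%N &
    weq n (tau_word (iota k r ++ [:: i])) (tau_word (s ++ iota k r'))].
Proof.
move=> ki vi kr.
have vr : valid n (tau_word (iota k r)).
  by rewrite valid_tau; apply/allP => j; rewrite mem_iota; lia.
have [ltkr|] := ltnP (k + r) i.
  exists [:: i], r; split=> //=; rewrite ?andbT //; first by lia.
  rewrite /tau_word map_cat cats1; apply: weq_sym; apply: weq_far_word.
    by rewrite all_map; apply/allP => j; rewrite mem_iota /= /far /=; lia.
  by rewrite /valid /= vi.
rewrite leq_eqVlt => /predU1P[E|ltikr].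
  exists [::], r.+1; split=> //; first by lia.
  by rewrite -addn1 iotaD E.
have [e|ne] := eqVneq i (k + r).-1.
  exists [::], r.-1; split=> //; first by lia.
  have -> : r = (r.-1 + 1)%N by lia.
  rewrite iotaD /= -catA /tau_word !map_cat addn1 /=.
  rewrite -[X in weq n _ X]cats0; apply: weq_catl.
  have -> : (k + r.-1)%N = i by lia.
  by apply: weq_move; rewrite /valid /= ?vi //; exact: V2.
exists [:: i.+1], r; split=> //=; rewrite ?andbT; try lia.
have -> : r = ((i - k) + (2 + (r - (i - k) - 2)))%N by lia.
rewrite 2!iotaD.
set A := iota k _; have -> : (k + (i - k))%N = i by lia.
set B := iota (i + 2) _.
rewrite -!catA /tau_word !map_cat /=.
apply: (weq_trans (w' := map tau A ++ [:: tau i; tau i.+1] ++ [:: tau i] ++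
  map tau B)).
  apply: weq_catl; apply: (@weq_catl n [:: _; _]); apply: weq_sym.
  rewrite cats1; apply: weq_far_word.
    by rewrite all_map; apply/allP => j; rewrite mem_iota /= /far /=; lia.
  rewrite /valid /= vi /= all_map; apply/allP => j; rewrite mem_iota /=; lia.
apply: (weq_trans (w' := map tau A ++ [:: tau i.+1; tau i; tau i.+1] ++
  map tau B)).
  apply: (@weq_ctx n _ (map tau B) [:: _; _; _] [:: _; _; _]).
  by apply: weq_move; rewrite /valid /= ?vi; [exact: V3 | lia | lia].
change (weq n (map tau A ++ [:: tau i.+1] ++ [:: tau i, tau i.+1 & map tau B])
  ([:: tau i.+1] ++ map tau A ++ [:: tau i, tau i.+1 & map tau B])).
rewrite !catA; apply: weq_catr; apply: weq_sym; rewrite cats1.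
apply: weq_far_word.
  by rewrite all_map; apply/allP => j; rewrite mem_iota /= /far /=; lia.
rewrite /valid /= all_map; apply/andP; split; first by lia.
by apply/allP => j; rewrite mem_iota /=; lia.
Qed.

Lemma weq_chain_form n k s : all (fun i => k <= i)%N s ->
  all (fun i => i.+1 < n)%N s -> (k < n)%N ->
  exists s' r, [/\ all (fun j => k < j)%N s', all (fun j => j.+1 < n)%N s',
    (k + r < n)%N & weq n (tau_word s) (tau_word (s' ++ iota k r))].
Proof.
move=> + + kn; elim/last_ind: s => [|s i IH].
  by move=> _ _; exists [::], 0; split => //; rewrite addn0.
rewrite !all_rcons => /andP[ki ks] /andP[vi vs].
have [s1 [r [k1 v1 kr e1]]] := IH ks vs.
have [s2 [r' [k2 v2 kr' e2]]] := weq_chain ki vi kr.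
exists (s1 ++ s2), r'; split; rewrite ?all_cat ?k1 ?v1 //.
rewrite -cats1 /tau_word map_cat.
apply: weq_trans (weq_catr _ e1) _.
by rewrite -map_cat -!catA /tau_word !(map_cat _ s1); apply: weq_catl.
Qed.

(** The prefix fixes [k] and the chain carries it to [k + r], so the permutation of the word
    determines the length of the chain. *)
Lemma chain_form_pos n k s r (a : 'I_n) :
  all (fun j => k < j)%N s -> all (fun j => j.+1 < n)%N s ->
  (k + r < n)%N -> a = k :> nat ->
  state n (tau_word (s ++ iota k r)) a = (k + r)%N :> nat.
Proof.
move=> ks vs kr ak; rewrite /tau_word map_cat state_cat permM.
rewrite (@state_fix n k (map tau s)); first exact: state_chain.
- by rewrite -/(tau_word s) valid_tau.
- by rewrite all_map.
- by rewrite ak.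
Qed.

Lemma weq_state n w w' : weq n w w' -> state n w = state n w'.
Proof.
elim=> // {w w'} [||w w'|x y].
- by move=> w w' w'' _ -> _ ->.
- by move=> u u' w w' _ E1 _ E2; rewrite !state_cat E1 E2.
- case=> [i|i|i|i|i|i|i]; rewrite /valid /= ?andbT => /andP[] v1 v2 v;
  apply/permP => a; apply/val_inj; rewrite /= !state_cons !state_nil !permM !perm1 /=.
  + by rewrite adjK.
  + by rewrite adjK.
  + adj_lia.
  + by rewrite adjK.
  + adj_lia.
  + adj_lia.
  + adj_lia.
- rewrite /far /valid /= andbT => f /andP[v1 v2]; apply/permP => a; apply/val_inj.
  rewrite /= !state_cons !state_nil !permM !perm1 /=; adj_lia.
Qed.

(** The Coxeter presentation, by induction on the number of positions left: equal permutations force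
    equal chains, and once these are cancelled the prefixes only involve letters above [k]. *)
Lemma weq_tau_from n k s s' : all (fun i => k <= i)%N s ->
  all (fun i => k <= i)%N s' ->
  all (fun i => i.+1 < n)%N s -> all (fun i => i.+1 < n)%N s' ->
  state n (tau_word s) = state n (tau_word s') ->
  weq n (tau_word s) (tau_word s').
Proof.
have [d] := ubnP (n - k); elim: d => // d IH in k s s' * => nk ks ks' vs vs' E.
have [kn|nk'] := ltnP k n; last first.
  have nil z : all (fun i => k <= i)%N z -> all (fun i => i.+1 < n)%N z ->
      z = [::].
    by case: z => //= i z /andP[? _] /andP[? _]; lia.
  by rewrite (nil s) // (nil s').
have [s1 [r [k1 v1 kr e1]]] := weq_chain_form ks vs kn.
have [s2 [r' [k2 v2 kr' e2]]] := weq_chain_form ks' vs' kn.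
pose a := Ordinal kn.
have Err : r = r'.
  have := chain_form_pos k1 v1 kr (erefl : a = k :> nat).
  rewrite -(weq_state e1) E (weq_state e2) (chain_form_pos k2 v2 kr') //.
  by move=> /eqP; rewrite eqn_add2l => /eqP.
apply: (weq_trans e1); apply: weq_sym; apply: (weq_trans e2); apply: weq_sym.
rewrite -Err /tau_word !map_cat; apply: weq_catr; apply: (IH k.+1) => //.
  by lia.
move: E; rewrite (weq_state e1) (weq_state e2) Err /tau_word !map_cat !state_cat.
exact: mulIg.
Qed.

Lemma weq_tau n s s' :
  all (fun i => i.+1 < n)%N s -> all (fun i => i.+1 < n)%N s' ->
  state n (tau_word s) = state n (tau_word s') ->
  weq n (tau_word s) (tau_word s').
Proof. by apply: (@weq_tau_from n 0); apply/allP. Qed.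

Lemma tau_realize n (p : 'S_n) :
  exists2 s, all (fun i => i.+1 < n)%N s & state n (tau_word s) = p.
Proof.
(* Induction on the number [k] of upper positions that may move. The chain carrying [j] to its image
   is split off on the right, and what remains also fixes [j]. *)
suff H k : (k <= n)%N -> forall p : 'S_n,
    (forall a : 'I_n, (a < n - k)%N -> p a = a) ->
    exists2 s, all (fun i => i.+1 < n)%N s & state n (tau_word s) = p.
  by apply: (H n) => // a; rewrite subnn.
elim: k => [|k IH] kn {}p fp.
  by exists [::] => //; rewrite state_nil; apply/permP => a; rewrite perm1 fp // subn0.
have lt : (n - k.+1 < n)%N by lia.
pose a := Ordinal lt; have ea : a = (n - k.+1)%N :> nat by [].
set j := (n - k.+1)%N in ea.
have lepa : (j <= p a)%N.
  rewrite leqNgt; apply/negP => H.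
  by have := fp (p a) H; move=> /perm_inj E; move: H; rewrite E ea ltnn.
pose r := (p a - j)%N; have jr : (j + r < n)%N by rewrite subnKC.
pose c := tau_word (iota j r).
have vc : all (fun i => i.+1 < n)%N (iota j r).
  by apply/allP => i; rewrite mem_iota; lia.
have [|s vs Es] := IH (ltnW kn) (p * (state n c)^-1)%g.
  move=> b bk; rewrite permM.
  have [/eqP E|ne] := boolP (b == a).
    apply: (@perm_inj _ (state n c)); rewrite permKV E; apply/val_inj.
    by rewrite /= state_chain // subnKC.
  have bj : (b < j)%N.
    by move: ne bk; rewrite -val_eqE /= -/j /j; lia.
  rewrite fp //; apply: (@perm_inj _ (state n c)); rewrite permKV.
  (* [state_fix] asks for letters strictly above its bound, hence [j.-1]; for [j = 0] no such [b]
     exists. *)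
  case: (posnP j) bj => [->//|j0 bj].
  rewrite (@state_fix n j.-1) //; first by rewrite valid_tau.
    by rewrite all_map; apply/allP => i; rewrite mem_iota /=; lia.
  by lia.
exists (s ++ iota j r); first by rewrite all_cat vs.
by rewrite /tau_word map_cat state_cat Es mulgKV.
Qed.

(** * Gauss words *)

Definition value_code (v : crossing_value) : option bool :=
  match v with
  | Positive => Some true | Negative => Some false | Virtual => None
  end.

Definition value_decode (c : option bool) : crossing_value :=
  match c with
  | Some true => Positive | Some false => Negative | None => Virtual
  end.

Lemma value_codeK : cancel value_code value_decode.
Proof. by case. Qed.

HB.instance Definition _ := Choice.copy crossing_value (can_type value_codeK).

Definition crossing_label n := ('I_n * 'I_n * crossing_value)%type.

(* ((i, j), v) labels a crossing with value v at which strand i descends with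
   respect to strand j; p maps the strands to their positions. *)
Definition crossing_at n (p : 'S_n) (x : letter) : seq (crossing_label n) :=
  match insub x.2, insub x.2.+1 with
  | Some a, Some b => [:: ((p^-1 b, p^-1 a)%g, x.1)]
  | _, _ => [::]
  end.

Fixpoint strand_word n (p : 'S_n) (w : seq letter) :
    seq (crossing_label n) :=
  if w is x :: w' then crossing_at p x ++ strand_word (p * adj n x.2)%g w'
  else [::].

Definition gauss_of_crossing n (c : crossing_label n) :
    seq (gauss_letter n) :=
  match c.2 with
  | Positive => [:: (c.1.1, c.1.2, true)]
  | Negative => [:: (c.1.2, c.1.1, false)]
  | Virtual => [::]
  end.

Definition gauss_letters n (u : seq (crossing_label n)) :=
  flatten (map (@gauss_of_crossing n) u).

Definition gauss_word n (p : 'S_n) (w : seq letter) :=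
  gauss_letters (strand_word p w).

Lemma crossing_atE n (p : 'S_n) v i (x y : 'I_n) :
  p x = i.+1 :> nat -> p y = i :> nat ->
  crossing_at p (v, i) = [:: ((x, y), v)].
Proof.
move=> px py; rewrite /crossing_at /=; case: insubP => [a _ va|]; last first.
  by rewrite -py ltn_ord.
case: insubP => [b _ vb|]; last by rewrite -px ltn_ord.
congr [:: (_, _, _)]; apply: (@perm_inj _ p); rewrite permKV; apply/val_inj.
  by rewrite vb /= px.
by rewrite va /= py.
Qed.

Lemma crossing_at_valid n (p : 'S_n) v i : (i.+1 < n)%N ->
  exists x y : 'I_n, [/\ p x = i.+1 :> nat, p y = i :> nat &
    crossing_at p (v, i) = [:: ((x, y), v)]].
Proof.
move=> lt; have lt' := ltnW lt.
exists (p^-1 (Ordinal lt))%g, (p^-1 (Ordinal lt'))%g.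
by split; rewrite ?permKV //; apply: crossing_atE; rewrite permKV.
Qed.

Lemma crossing_at_out n (p : 'S_n) x : (n <= x.2.+1)%N -> crossing_at p x = [::].
Proof.
move=> le; rewrite /crossing_at; case: insubP => // a _ _.
by case: insubP => // b lt; move: lt; rewrite ltnNge le.
Qed.

Lemma strand_word_cat n (p : 'S_n) w w' :
  strand_word p (w ++ w') = strand_word p w ++ strand_word (p * state n w)%g w'.
Proof.
elim: w p => [|x w IH] p; first by rewrite state_nil mulg1.
by rewrite /= IH -catA state_cons mulgA.
Qed.

Lemma gauss_letters_cat n (u u' : seq (crossing_label n)) :
  gauss_letters (u ++ u') = gauss_letters u ++ gauss_letters u'.
Proof. by rewrite /gauss_letters map_cat flatten_cat. Qed.

Lemma gauss_word_cat n (p : 'S_n) w w' :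
  gauss_word p (w ++ w') = gauss_word p w ++ gauss_word (p * state n w)%g w'.
Proof. by rewrite /gauss_word strand_word_cat gauss_letters_cat. Qed.

Lemma gauss_word_tau n (p : 'S_n) s : gauss_word p (tau_word s) = [::].
Proof.
elim: s p => [//|i s IH] p; rewrite /= -cat1s gauss_word_cat.
rewrite IH cats0 /gauss_word /= cats0 /crossing_at /=.
by case: insubP => // a _ _; case: insubP.
Qed.

Lemma gauss_word_signed n (p : 'S_n) e i (x y : 'I_n) :
  p x = (if e then i.+1 else i) :> nat -> p y = (if e then i else i.+1) :> nat ->
  gauss_word p [:: signed e i] = [:: (x, y, e)].
Proof.
rewrite /gauss_word /=; case: e => px py.
  by rewrite (crossing_atE _ px py).
by rewrite (crossing_atE _ py px).
Qed.

(** * The monoid of Gauss words and its lift to pure words *)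

Definition gauss_valid n (X : gauss_letter n) := X.1.1 != X.1.2.

Definition gauss_disjoint n (X Y : gauss_letter n) :=
  [&& X.1.1 != Y.1.1, X.1.1 != Y.1.2, X.1.2 != Y.1.1 & X.1.2 != Y.1.2].

(** The commutations are part of the relation because a braid Gauss diagram determines its word only
    up to them. *)
Inductive gequiv n : seq (gauss_letter n) -> seq (gauss_letter n) -> Prop :=
| gequiv_refl W : gequiv W W
| gequiv_sym W W' : gequiv W W' -> gequiv W' W
| gequiv_trans W W' W'' : gequiv W W' -> gequiv W' W'' -> gequiv W W''
| gequiv_cat U U' W W' : gequiv U U' -> gequiv W W' -> gequiv (U ++ W) (U' ++ W')
| gequiv_move W W' : word_move W W' -> gequiv W W'
| gequiv_comm X Y : gauss_valid X -> gauss_valid Y -> gauss_disjoint X Y ->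
    gequiv [:: X; Y] [:: Y; X].

(** At a positive crossing the tail is the over-passing, hence descending, strand and has to stand
    in the upper position [p.+1]; at a negative one it stands in the lower position. *)
Definition places n (t : seq nat) (p : nat) (X : gauss_letter n) : Prop :=
  [/\ all (fun i => i.+1 < n)%N t, (p.+1 < n)%N,
      state n (tau_word t) X.1.1 = (if X.2 then p.+1 else p) :> nat &
      state n (tau_word t) X.1.2 = (if X.2 then p else p.+1) :> nat].

(** The letter [tau p] undoes the exchange made by the signed crossing, so the whole word is pure: a
    conjugate of a standard generator of the pure virtual braid group. *)
Definition conj_word (t : seq nat) (p : nat) (e : bool) : seq letter :=
  tau_word t ++ [:: signed e p; tau p] ++ inv_word (tau_word t).

Lemma state_tau_cat n t t' :
  state n (tau_word (t ++ t')) = (state n (tau_word t) * state n (tau_word t'))%g.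
Proof. by rewrite /tau_word map_cat state_cat. Qed.

Lemma conj_shift n t p (X : gauss_letter n) : places t p.+1 X ->
  exists2 t', places t' p X & weq n (conj_word t p.+1 X.2) (conj_word t' p X.2).
Proof.
move=> [vt lp p1 p2]; exists (t ++ [:: p; p.+1]).
  split; rewrite ?all_cat ?vt /= ?lp ?andbT; try lia.
    by rewrite state_tau_cat permM !state_cons state_nil mulg1 /= permM;
      case: X.2 p1 p2 => p1 p2; adj_lia.
  by rewrite state_tau_cat permM !state_cons state_nil mulg1 /= permM;
    case: X.2 p1 p2 => p1 p2; adj_lia.
rewrite /conj_word /tau_word map_cat inv_word_cat -!catA; apply: weq_catl.
apply: (@weq_catr n _ [:: signed X.2 p.+1; tau p.+1]
  [:: tau p; tau p.+1; signed X.2 p; tau p; tau p.+1; tau p]).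
exact: weq_shift.
Qed.

Lemma conj_base n t p (X : gauss_letter n) : places t p X ->
  exists2 t', places t' 0 X & weq n (conj_word t p X.2) (conj_word t' 0 X.2).
Proof.
elim: p t => [|p IH] t; first by exists t.
move=> /conj_shift[t1 /IH[t2 P2 E2] E1]; exists t2 => //; exact: weq_trans E2.
Qed.

(** In the coset form of such a word the chain must be empty, because its length is the displacement
    of [k]. *)
Lemma tau_fix n k s (a : 'I_n) : all (fun i => k <= i)%N s ->
  all (fun i => i.+1 < n)%N s -> a = k :> nat -> state n (tau_word s) a = a ->
  exists s', [/\ all (fun i => k < i)%N s', all (fun i => i.+1 < n)%N s' &
    state n (tau_word s') = state n (tau_word s)].
Proof.
move=> ks vs ak fa; have kn : (k < n)%N by rewrite -ak.
have [s' [r [ks' vs' kr e]]] := weq_chain_form ks vs kn.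
have := chain_form_pos ks' vs' kr ak; rewrite -(weq_state e) fa ak => r0.
have {}r0 : r = 0%N by lia.
by exists s'; split=> //; rewrite (weq_state e) r0 cats0.
Qed.

(** Two placements of the same arrow differ by a permutation fixing the positions 0 and 1. By
    [tau_fix], applied twice, it is a word in letters of index at least 2, and these commute with
    the two central letters of index 0. *)
Lemma conj_weq0 n t t' (X : gauss_letter n) : places t 0 X -> places t' 0 X ->
  weq n (conj_word t 0 X.2) (conj_word t' 0 X.2).
Proof.
move=> [vt n1 p1 p2] [vt' _ p1' p2'].
have [x [y [px py px' py']]] : exists x y : 'I_n,
    [/\ state n (tau_word t) x = 0 :> nat, state n (tau_word t) y = 1 :> nat,
        state n (tau_word t') x = 0 :> nat & state n (tau_word t') y = 1 :> nat].
  by case: (X.2) p1 p2 p1' p2' => *; [exists X.1.2, X.1.1 | exists X.1.1, X.1.2].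
pose a := Ordinal (ltnW n1); pose b := Ordinal n1.
have inj_nat (u v : 'I_n) : u = v :> nat -> u = v by move/val_inj.
have xa : state n (tau_word t) x = a by apply: inj_nat.
have yb : state n (tau_word t) y = b by apply: inj_nat.
have xa' : state n (tau_word t') x = a by apply: inj_nat.
have yb' : state n (tau_word t') y = b by apply: inj_nat.
pose s := rev t' ++ t.
have vs : all (fun i => i.+1 < n)%N s by rewrite all_cat all_rev vt'.
have Es : state n (tau_word s) = ((state n (tau_word t'))^-1 * state n (tau_word t))%g.
  by rewrite state_tau_cat -inv_tau state_inv.
have k0 : all (fun i => 0 <= i)%N s by exact/allP.
have [|s1 [k1 v1 E1]] := @tau_fix n 0 s a k0 vs erefl.
  by rewrite Es permM -{1}xa' permK.
have [|s2 [k2 v2 E2]] := @tau_fix n 1 s1 b k1 v1 erefl.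
  by rewrite E1 Es permM -{1}yb' permK.
have Et : weq n (tau_word t) (tau_word t' ++ tau_word s2).
  rewrite -map_cat; apply: weq_tau; rewrite ?all_cat ?vt' //.
  by rewrite -/(tau_word _) state_tau_cat E2 E1 Es mulKVg.
have Et' : weq n (inv_word (tau_word t)) (inv_word (tau_word t' ++ tau_word s2)).
  apply: weq_inv Et; first by rewrite valid_tau.
  by rewrite /valid all_cat -!/(valid n _) !valid_tau vt'.
rewrite /conj_word inv_word_cat in Et' *.
apply: (weq_trans (weq_cat Et (weq_cat (weq_refl _ _) Et'))).
rewrite -!catA; apply: weq_catl; rewrite !catA; apply: weq_catr.
have fs2 x0 : x0.2 = 0%N -> weq n (tau_word s2 ++ [:: x0]) ([:: x0] ++ tau_word s2).
  move=> x00; rewrite cats1; apply: weq_sym; apply: weq_far_word.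
    rewrite all_map; apply/allP => i /(allP k2) /=; rewrite /far x00 /=; lia.
  by rewrite /valid /= x00 n1 -/(valid n _) valid_tau.
rewrite -[X in weq n _ X]cats0.
apply: (weq_trans (w' := [:: signed X.2 0; tau 0] ++
                         (tau_word s2 ++ inv_word (tau_word s2)))); last first.
  by apply: weq_catl; apply: weq_invr; rewrite valid_tau.
rewrite catA; apply: weq_catr.
apply: (weq_trans (w' := [:: signed X.2 0] ++ (tau_word s2 ++ [:: tau 0]))).
  rewrite -(cat1s (signed _ _) [:: _]) !catA; apply: weq_catr.
  by apply: fs2; rewrite signed_pos.
by rewrite -(cat1s (signed _ _) [:: _]) -catA; apply: weq_catl; apply: fs2.
Qed.

Lemma conj_weq n t t' p p' (X : gauss_letter n) : places t p X -> places t' p' X ->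
  weq n (conj_word t p X.2) (conj_word t' p' X.2).
Proof.
move=> /conj_base[t1 P1 E1] /conj_base[t2 P2 E2].
apply: (weq_trans E1); apply: weq_sym; apply: (weq_trans E2).
by apply: weq_sym; apply: conj_weq0.
Qed.

Lemma uniq_size_ord n (xs : seq 'I_n) : uniq xs -> (size xs <= n)%N.
Proof. by move=> /card_uniqP <-; rewrite -[leqRHS](card_ord n) max_card. Qed.

Lemma perm_place n (xs : seq 'I_n) : uniq xs ->
  exists p : 'S_n, forall x0 m, (m < size xs)%N -> p (nth x0 xs m) = m :> nat.
Proof.
move=> ux; pose l := xs ++ [seq x <- enum 'I_n | x \notin xs].
have ul : uniq l.
  rewrite cat_uniq ux filter_uniq ?enum_uniq // andbT.
  by apply/hasPn => x; rewrite mem_filter => /andP[].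
have ml x : x \in l by rewrite mem_cat mem_filter mem_enum andbT orbN.
have sl : size l = n.
  by rewrite -[RHS]card_ord cardE; apply/perm_size/uniq_perm;
    rewrite ?enum_uniq // => x; rewrite ml mem_enum.
have lt x : (index x l < n)%N by rewrite -[X in (_ < X)%N]sl index_mem.
have inj : injective (fun x => Ordinal (lt x)).
  move=> x y [] E; rewrite -(nth_index x (ml x)) -(nth_index x (ml y)).
  by rewrite E.
exists (perm inj) => x0 m mx; rewrite permE /= /l index_cat mem_nth //.
by rewrite index_uniq.
Qed.

(** By [conj_weq] the chosen placement is irrelevant up to [weq]. The default occurs only when tail
    and head of the arrow lie on the same interval. *)
Definition pure_word n (X : gauss_letter n) : seq letter :=
  xget [::] [set w | exists t p, places t p X /\ w = conj_word t p X.2].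

Lemma pure_wordP n (X : gauss_letter n) t p : places t p X ->
  weq n (pure_word X) (conj_word t p X.2).
Proof.
move=> P; rewrite /pure_word; case: xgetP => [w _ [t' [p' [P' ->]]]|H].
  exact: conj_weq.
by case: (H (conj_word t p X.2)); exists t, p.
Qed.

Lemma tau_place n (xs : seq 'I_n) : uniq xs ->
  exists2 t, all (fun i => i.+1 < n)%N t &
  forall x0 m, (m < size xs)%N -> state n (tau_word t) (nth x0 xs m) = m :> nat.
Proof.
move=> /perm_place[p Hp]; have [t vt E] := tau_realize p.
by exists t => //; rewrite E.
Qed.

Lemma places_exists n (X : gauss_letter n) : gauss_valid X ->
  exists t p, places t p X.
Proof.
case: X => [[i j] e]; rewrite /gauss_valid /= => ij.
have n1 : (1 < n)%N.
  have u2 : uniq [:: i; j] by rewrite /= inE ij.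
  exact: (uniq_size_ord u2).
have [|t vt H] := @tau_place n (if e then [:: j; i] else [:: i; j]).
  by case: e; rewrite /= inE ?ij // eq_sym ij.
exists t, 0%N; split=> //=.
  by case: e H => H; [apply: (H i 1) | apply: (H i 0)].
by case: e H => H; [apply: (H i 0) | apply: (H i 1)].
Qed.

Lemma valid_conj n t p (X : gauss_letter n) : places t p X ->
  valid n (conj_word t p X.2).
Proof.
move=> [vt lp _ _]; rewrite /valid !all_cat -!/(valid n _) valid_inv valid_tau vt.
by rewrite /valid /= signed_pos lp.
Qed.

Lemma pure_wordE n (X : gauss_letter n) : gauss_valid X ->
  exists t p, places t p X /\ pure_word X = conj_word t p X.2.
Proof.
move=> /places_exists[t [p P]]; rewrite /pure_word.
by case: xgetP => [w _ //|H]; case: (H (conj_word t p X.2)); exists t, p.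
Qed.

Lemma state_conj n t p e : state n (conj_word t p e) = 1%g.
Proof.
rewrite /conj_word !state_cat state_inv !state_cons state_nil signed_pos mulg1.
by rewrite -{2}(adjV n p) mulgV mul1g mulgV.
Qed.

Lemma gauss_word_conj n t p (X : gauss_letter n) : places t p X ->
  gauss_word 1 (conj_word t p X.2) = [:: X].
Proof.
case: X => [[i j] e] [vt lp px py].
rewrite /conj_word -[[:: _; _]](cat1s (signed e p) (tau_word [:: p])).
rewrite inv_tau !gauss_word_cat !gauss_word_tau !cats0 /= mul1g.
exact: gauss_word_signed.
Qed.

Definition pure_words n (W : seq (gauss_letter n)) : seq letter :=
  flatten (map (@pure_word n) W).

Lemma pure_words_cat n (W W' : seq (gauss_letter n)) :
  pure_words (W ++ W') = pure_words W ++ pure_words W'.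
Proof. by rewrite /pure_words map_cat flatten_cat. Qed.

Lemma pure_words_spec n (W : seq (gauss_letter n)) : all (@gauss_valid n) W ->
  [/\ valid n (pure_words W), state n (pure_words W) = 1%g &
      gauss_word 1 (pure_words W) = W].
Proof.
elim: W => [|X W IH] /=; first by rewrite state_nil.
move=> /andP[/pure_wordE[t [p [P E]]] /IH[vW sW gW]].
rewrite -cat1s pure_words_cat /pure_words /= cats0 E.
rewrite state_cat gauss_word_cat state_conj !mul1g gauss_word_conj // gW.
by rewrite /valid all_cat -!/(valid n _) valid_conj.
Qed.

Lemma word_realize n (W : seq (gauss_letter n)) (p : 'S_n) :
  all (@gauss_valid n) W ->
  exists w, [/\ valid n w, state n w = p & gauss_word 1 w = W].
Proof.
move=> /pure_words_spec[vW sW gW]; have [s vs E] := tau_realize p.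
exists (pure_words W ++ tau_word s).
rewrite state_cat gauss_word_cat gauss_word_tau cats0 sW mul1g.
by rewrite /valid all_cat -!/(valid n _) vW valid_tau.
Qed.

Lemma letterP (x : letter) :
  x = tau x.2 \/ exists e, x = signed e x.2.
Proof.
by case: x => -[] i; [right; exists true | right; exists false | left].
Qed.

(* Virtual braids are the semidirect product of pure virtual braids by
   permutations; this is the decomposition of a word along it. *)
Lemma weq_pure n w s : valid n w -> all (fun i => i.+1 < n)%N s ->
  state n (tau_word s) = state n w ->
  weq n w (pure_words (@gauss_word n 1 w) ++ tau_word s).
Proof.
elim/last_ind: w s => [|w x IH] s.
  move=> _ vs E /=.
  exact: (@weq_tau n [::] s).
rewrite -cats1 /valid all_cat -!/(valid n _) => /andP[vw vx] vs.
have {vx} vx : (x.2.+1 < n)%N by move: vx; rewrite /valid /= andbT.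
rewrite state_cat state1 => Es.
have [s' vs' Es'] := tau_realize (state n w).
have /weq_catr - /(_ [:: x]) H := IH s' vw vs' Es'.
apply: (weq_trans H) => {H}; rewrite gauss_word_cat pure_words_cat -!catA mul1g.
apply: weq_catl.
have Esx : weq n (tau_word s' ++ [:: tau x.2]) (tau_word s).
  rewrite -(map_cat tau s' [:: _]); apply: weq_tau => //.
    by rewrite all_cat vs' /= vx.
  by rewrite state_tau_cat Es Es' state1.
have [E|[e E]] := letterP x.
  rewrite {2}E (gauss_word_tau _ [:: x.2]) /=.
  by rewrite {1}E.
(* With [s'] the virtual part reached so far, appending a signed letter amounts to appending its
   pure word, conjugated by [s'], and then [s'] and one virtual letter: the inner copies of [s']
   cancel, and then the two virtual letters. *)
have [a [b [pa pb _]]] := crossing_at_valid (state n w) Virtual vx.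
pose X : gauss_letter n := (if e then a else b, if e then b else a, e).
have PX : places s' x.2 X.
  by rewrite /X; split=> //=; rewrite Es'; case: (e).
have -> : gauss_word (state n w) [:: x] = [:: X].
  rewrite E; apply: gauss_word_signed; rewrite -Es'; by case: PX.
rewrite /pure_words /= cats0.
apply: weq_sym; apply: (weq_trans (weq_catr _ (pure_wordP PX))).
apply: (weq_trans (weq_catl _ (weq_sym Esx))).
rewrite /conj_word -!catA; apply: weq_catl.
apply: (weq_trans (w' := [:: signed e x.2; tau x.2] ++ ([::] ++ [:: tau x.2]))).
  rewrite /X /=; apply: (@weq_catl n [:: _; _]); rewrite catA.
  apply: (@weq_catr n _ _ [::]); apply: weq_invl.
  by rewrite valid_tau.
rewrite [X in weq _ _ [:: X]]E; apply: (@weq_catl n [:: signed e x.2] [:: tau x.2; tau x.2] [::]).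
by apply: weq_move; rewrite /valid /= ?vx //; exact: V2.
Qed.

Lemma weq_cancel n w w' s : valid n s -> weq n (w ++ s) (w' ++ s) -> weq n w w'.
Proof.
move=> vs H; have := weq_catr (inv_word s) H; rewrite -!catA => {}H.
have K u : weq n u (u ++ s ++ inv_word s).
  rewrite -{1}(cats0 u); apply: weq_catl; apply: weq_sym; exact: weq_invr.
apply: weq_trans (K w) _; apply: weq_trans H _; apply: weq_sym; exact: K.
Qed.

(** Turns a relation between words into one between the pure words of their arrows, for strands
    placed by [t]: both sides are factorized by [weq_pure] and the common permutation is cancelled.
    All relations of Gauss words are lifted in this way. *)
Lemma weq_pure_move n t u u' : all (fun i => i.+1 < n)%N t -> valid n u ->
  valid n u' -> weq n u u' ->
  weq n (pure_words (gauss_word (state n (tau_word t)) u))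
        (pure_words (gauss_word (state n (tau_word t)) u')).
Proof.
move=> vt vu vu' H; have [s vs Es] := tau_realize (state n (tau_word t ++ u)).
have Es' : state n (tau_word s) = state n (tau_word t ++ u').
  by rewrite Es !state_cat (weq_state H).
apply: (@weq_cancel n _ _ (tau_word s)); first by rewrite valid_tau.
have G z : gauss_word (state n (tau_word t)) z = gauss_word 1 (tau_word t ++ z).
  by rewrite gauss_word_cat gauss_word_tau mul1g.
rewrite !G.
have V z : valid n z -> valid n (tau_word t ++ z).
  by move=> vz; rewrite /valid all_cat -!/(valid n _) valid_tau vt.
apply: weq_trans (weq_sym (weq_pure (V _ vu) vs Es)) _.
apply: weq_trans (weq_pure (V _ vu') vs Es').
exact: weq_catl.
Qed.

Lemma gauss_word_cons n (p : 'S_n) x w :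
  gauss_word p (x :: w) = gauss_word p [:: x] ++ gauss_word (p * adj n x.2)%g w.
Proof. by rewrite -cat1s gauss_word_cat state1. Qed.

Lemma gauss_word_nil n (p : 'S_n) : gauss_word p [::] = [::].
Proof. by []. Qed.

(** Each relation is the trace of one relation of words between strands placed in the lowest
    positions: R2 for Omega2, R3 for Omega3, and far commutation for disjoint arrows. The sign
    decides the order of placement. *)
Lemma gequiv_pure n (W W' : seq (gauss_letter n)) : gequiv W W' ->
  weq n (pure_words W) (pure_words W').
Proof.
elim=> {W W'} //.
- by move=> W W' _; exact: weq_sym.
- by move=> W W' W'' _ H _; exact: weq_trans.
- by move=> U U' W W' _ H _ H'; rewrite !pure_words_cat; exact: weq_cat.
- move=> W W' [i j e ij|i j k e ij jk ik].
  + have u2 : uniq (if e then [:: j; i] else [:: i; j]).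
      by case: (e); rewrite /= inE ?ij // eq_sym ij.
    have n1 : (1 < n)%N by have := uniq_size_ord u2; case: (e).
    have [t vt H] := tau_place u2.
    have H0 := H i 0%N; have H1 := H i 1%N => {H}.
    pose u := [:: signed e 0; signed (~~ e) 0].
    have vu : valid n u by rewrite /valid /= !signed_pos n1.
    have : weq n u [::].
      have -> : u = [:: signed e 0] ++ inv_word [:: signed e 0].
        by rewrite /u; case: (e).
      by apply: weq_invr; rewrite /valid /= signed_pos n1.
    move=> /(@weq_pure_move n t u [::] vt vu isT).
    rewrite /u gauss_word_cons signed_pos gauss_word_nil.
    rewrite (@gauss_word_signed _ _ e 0 i j); last 2 first.
    - by case: (e) H0 H1 => /= H0 H1; [exact: H1 | exact: H0].
    - by case: (e) H0 H1 => /= H0 H1; [exact: H0 | exact: H1].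
    rewrite (@gauss_word_signed _ _ (~~ e) 0 i j) //; rewrite permM.
    - by case: (e) H0 H1 => /= /(_ isT) H0 /(_ isT) H1; adj_lia.
    - by case: (e) H0 H1 => /= /(_ isT) H0 /(_ isT) H1; adj_lia.
  + have u3 : uniq (if e then [:: k; j; i] else [:: i; j; k]).
      case: (e); rewrite /= !inE ?negb_or ?ij ?jk ?ik //.
      by rewrite (eq_sym k) jk (eq_sym k) ik eq_sym ij.
    have n2 : (2 < n)%N by have := uniq_size_ord u3; case: (e).
    have [t vt H] := tau_place u3.
    have H0 := H i 0%N; have H1 := H i 1%N; have H2 := H i 2%N => {H}.
    have pi : state n (tau_word t) i = (if e then 2 else 0)%N :> nat.
      by case: (e) H0 H1 H2 => /= /(_ isT) H0 /(_ isT) H1 /(_ isT) H2.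
    have pj : state n (tau_word t) j = 1%N :> nat.
      by case: (e) H0 H1 H2 => /= /(_ isT) H0 /(_ isT) H1 /(_ isT) H2.
    have pk : state n (tau_word t) k = (if e then 0 else 2)%N :> nat.
      by case: (e) H0 H1 H2 => /= /(_ isT) H0 /(_ isT) H1 /(_ isT) H2.
    clear H0 H1 H2.
    (* Here [e] is also coerced to an index: it is the letter adjacent to strand [i], which is
       placed on top for a positive sign and at the bottom for a negative one. *)
    pose u := [:: signed e e; signed e (~~ e); signed e e].
    pose u' := [:: signed e (~~ e); signed e e; signed e (~~ e)].
    have n1 : (1 < n)%N by exact: ltnW.
    have vu : valid n u by rewrite /u /valid; case: (e); rewrite /= ?n1 ?n2.
    have vu' : valid n u' by rewrite /u' /valid; case: (e); rewrite /= ?n1 ?n2.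
    have : weq n u u'.
      have := weq_R3 e n2; rewrite /u /u'; case: (e) => // H.
      exact: weq_sym.
    move=> /(weq_pure_move vt vu vu').
    set p := state n _ in pi pj pk *.
    rewrite /u /u' !(gauss_word_cons _ _ (_ :: _)) !signed_pos.
    have S (q : 'S_n) d x y : q x = (if e then d.+1 else d) :> nat ->
        q y = (if e then d else d.+1) :> nat ->
        gauss_word q [:: signed e d] = [:: (x, y, e)].
      exact: gauss_word_signed.
    rewrite (S p _ i j); [|by case: (e) pi pj pk => /= *; lia..].
    rewrite (S _ _ i k); [|by rewrite permM; case: (e) pi pj pk => /= *; adj_lia..].
    rewrite (S _ _ j k); [|by rewrite !permM; case: (e) pi pj pk => /= *; adj_lia..].
    rewrite (S p _ j k); [|by case: (e) pi pj pk => /= *; lia..].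
    rewrite (S _ _ i k); [|by rewrite permM; case: (e) pi pj pk => /= *; adj_lia..].
    by rewrite (S _ _ i j); [|by rewrite !permM; case: (e) pi pj pk => /= *; adj_lia..].
- move=> [[i j] e] [[k l] f]; rewrite /gauss_valid /gauss_disjoint /=.
  move=> ij kl /and4P[ik il jk jl].
  have u4 : uniq ((if e then [:: j; i] else [:: i; j]) ++
                  (if f then [:: l; k] else [:: k; l])).
    by case: (e); case: (f); rewrite /= !inE ?negb_or ?ij ?ik ?il ?jk ?jl ?kl //=
      ?(eq_sym j i) ?ij ?(eq_sym l k) ?kl.
  have n3 : (3 < n)%N by have := uniq_size_ord u4; case: (e); case: (f).
  have [t vt H] := tau_place u4.
  have H0 := H i 0%N; have H1 := H i 1%N; have H2 := H i 2%N; have H3 := H i 3%N => {H}.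
  set p := state n _ in H0 H1 H2 H3.
  have pi : p i = (if e then 1 else 0)%N :> nat.
    by case: (e) H0 H1 => /= H0 H1; [exact: H1 | exact: H0].
  have pj : p j = (if e then 0 else 1)%N :> nat.
    by case: (e) H0 H1 => /= H0 H1; [exact: H0 | exact: H1].
  have pk : p k = (if f then 3 else 2)%N :> nat.
    by case: (e) H2 H3; case: (f) => /= H2 H3; by [exact: H3 | exact: H2].
  have pl : p l = (if f then 2 else 3)%N :> nat.
    by case: (e) H2 H3; case: (f) => /= H2 H3; by [exact: H3 | exact: H2].
  clear H0 H1 H2 H3.
  have n1 : (1 < n)%N by lia.
  pose u := [:: signed e 0; signed f 2]; pose u' := [:: signed f 2; signed e 0].
  have vu : valid n u by rewrite /u /valid /= !signed_pos n1 n3.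
  have vu' : valid n u' by rewrite /u' /valid /= !signed_pos n1 n3.
  have : weq n u u' by apply: weq_far; rewrite /far ?signed_pos.
  move=> /(weq_pure_move vt vu vu'); rewrite -/p.
  rewrite /u /u' !(gauss_word_cons _ _ (_ :: _)) !signed_pos.
  rewrite (@gauss_word_signed _ p e 0 i j) //.
  rewrite (@gauss_word_signed _ p f 2 k l) //.
  rewrite (@gauss_word_signed _ _ e 0 i j) ?permM; last 2 first.
  - by rewrite adjE // pi; case: (e).
  - by rewrite adjE // pj; case: (e).
  rewrite (@gauss_word_signed _ _ f 2 k l) ?permM //.
  - by rewrite adjE // pk; case: (f).
  - by rewrite adjE // pl; case: (f).
Qed.

(** After factorization by [weq_pure], the pure parts are related by [gequiv_pure] and the virtual
    parts can be taken equal. *)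
Lemma weq_of_geq n w w' : valid n w -> valid n w' -> state n w = state n w' ->
  gequiv (@gauss_word n 1 w) (gauss_word 1 w') -> weq n w w'.
Proof.
move=> vw vw' E /gequiv_pure H; have [s vs Es] := tau_realize (state n w).
apply: weq_trans (weq_pure vw vs Es) _; rewrite E in Es.
apply: weq_trans (weq_sym (weq_pure vw' vs Es)).
exact: weq_catr.
Qed.

(** * Increasing homeomorphisms *)

Section Kink.
Variable R : realType.
Implicit Types (l r p q x y : R) (f g h : R -> R).

Definition increasing f := {homo f : x y / x < y}.

Lemma increasing_lt f x y : increasing f -> (f x < f y) = (x < y).
Proof.
move=> incf; apply/idP/idP => [|/incf //]; apply: contraTT.
by rewrite -!leNgt le_eqVlt => /predU1P[->|/incf/ltW].
Qed.

Lemma increasing_le f x y : increasing f -> (f x <= f y) = (x <= y).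
Proof. by move=> incf; rewrite !leNgt increasing_lt. Qed.

Lemma increasing_eq f x y : increasing f -> (f x == f y) = (x == y).
Proof. by move=> incf; rewrite !eq_le !increasing_le. Qed.

Definition tent l r p x : R :=
  Num.max 0 (Num.min ((x - l) / (p - l)) ((r - x) / (r - p))).

(* Piecewise linear; maps p to q and is the identity outside ]l, r[. *)
Definition kink l r p q x : R := x + (q - p) * tent l r p x.

(** Rise and fall are bounded separately: [kink] could decrease only where a positive multiple of
    the tent falls or a negative one rises, and each bound settles one sign of [q - p]. *)
Lemma tent_lip l r p x y : l < p -> p < r -> x <= y ->
  tent l r p y <= tent l r p x + (y - x) / (p - l) /\
  tent l r p x <= tent l r p y + (y - x) / (r - p).
Proof.
move=> lp pr xy; rewrite /tent.
have a0 : 0 < (p - l)^-1 by rewrite invr_gt0 subr_gt0.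
have b0 : 0 < (r - p)^-1 by rewrite invr_gt0 subr_gt0.
move: (_^-1) a0 (_^-1) b0 => a a0 b b0.
have A : 0 <= a * (y - x) by apply: mulr_ge0; [exact: ltW | rewrite subr_ge0].
have B : 0 <= b * (y - x) by apply: mulr_ge0; [exact: ltW | rewrite subr_ge0].
rewrite !maxEle !minEle.
case: (leP ((x - l) * a)) => /= ?; case: (leP ((y - l) * a)) => /= ?;
  split; do ! [case: ifPn; rewrite -?ltNge => ?]; lra.
Qed.

Lemma kink_increasing l r p q : l < p -> p < r -> l < q -> q < r ->
  increasing (kink l r p q).
Proof.
move=> lp pr lq qr x y xy.
have [] := tent_lip lp pr (ltW xy); rewrite /kink.
move: (tent l r p x) (tent l r p y) => tx ty.
have a0 : 0 < (p - l)^-1 by rewrite invr_gt0 subr_gt0.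
have b0 : 0 < (r - p)^-1 by rewrite invr_gt0 subr_gt0.
have Ea : (p - l) * (p - l)^-1 = 1 by rewrite mulfV // gt_eqF // subr_gt0.
have Eb : (r - p) * (r - p)^-1 = 1 by rewrite mulfV // gt_eqF // subr_gt0.
move: (_^-1) a0 Ea (_^-1) b0 Eb => a a0 Ea b b0 Eb H1 H2.
have z0 : 0 < y - x by rewrite subr_gt0.
have [d0|d0] := leP 0 (q - p).
- have : (q - p) * (b * (y - x)) < y - x.
    rewrite mulrA gtr_pMl // -Eb ltr_pM2r //; lra.
  have : (q - p) * (tx - ty) <= (q - p) * (b * (y - x)).
    by apply: ler_wpM2l => //; lra.
  lra.
- have : (p - q) * (a * (y - x)) < y - x.
    rewrite mulrA gtr_pMl // -Ea ltr_pM2r //; lra.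
  have : (p - q) * (ty - tx) <= (p - q) * (a * (y - x)).
    by apply: ler_wpM2l; lra.
  lra.
Qed.

Lemma kink_continuous l r p q : continuous (kink l r p q).
Proof.
have affine (c d : R) : continuous (fun x : R => (x - c) * d).
  move=> x; apply: cvgM; last exact: cvg_cst.
  by apply: cvgB; [exact: cvg_id | exact: cvg_cst].
have affine' (c d : R) : continuous (fun x : R => (c - x) * d).
  move=> x; apply: cvgM; last exact: cvg_cst.
  by apply: cvgB; [exact: cvg_cst | exact: cvg_id].
move=> x; rewrite /kink /tent; apply: cvgD; first exact: cvg_id.
apply: cvgM; first exact: cvg_cst.
apply: (@continuous_max R R (fun=> 0) (fun x =>
  Num.min ((x - l) / (p - l)) ((r - x) / (r - p)))); first exact: cvg_cst.
apply: (@continuous_min R R (fun x => (x - l) / (p - l))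
  (fun x => (r - x) / (r - p))); [exact: affine | exact: affine'].
Qed.

Lemma kink_out l r p q x : l < p -> p < r -> (x <= l) || (r <= x) ->
  kink l r p q x = x.
Proof.
move=> lp pr H; suff -> : kink l r p q x = x + (q - p) * 0 by rewrite mulr0 addr0.
congr (_ + _ * _); rewrite /tent; apply/max_idPl; rewrite ge_min.
case/orP: H => H; apply/orP; [left|right].
  by rewrite pmulr_lle0 ?invr_gt0 ?subr_gt0 // subr_le0.
by rewrite pmulr_lle0 ?invr_gt0 ?subr_gt0 // subr_le0.
Qed.

Lemma kink_at l r p q : l < p -> p < r -> kink l r p q p = q.
Proof.
move=> lp pr; rewrite /kink /tent !divff ?gt_eqF ?subr_gt0 //.
by rewrite minxx maxEle ler01 mulr1 addrC subrK.
Qed.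

(** A composition of kinks. The first moves [f x] to [g x] and fixes everything below [l]; the
    others are built above [g x] and so leave it in place. The left bound [l] is generalized for
    this induction, while 1 stays fixed. *)
Lemma increasing_interpolation (T : eqType) (f g : T -> R) (s : seq T) l :
  pairwise (fun x y : T => f x < f y) s -> pairwise (fun x y : T => g x < g y) s ->
  (forall x : T, x \in s -> l < f x < 1 /\ l < g x < 1) ->
  exists h, [/\ continuous h, increasing h,
    forall x, (x <= l) || (1 <= x) -> h x = x & forall x : T, x \in s -> h (f x) = g x].
Proof.
elim: s f l => [|x s IH] f l.
  by move=> _ _ _; exists id; split=> // y; exact: cvg_id.
rewrite /= => /andP[/allP fx fs] /andP[/allP gx gs] H.
have [/andP[lf f1] /andP[lg g1]] := H x (mem_head _ _).
pose k := kink l 1 (f x) (g x).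
have ki : increasing k by exact: kink_increasing.
have kx : k (f x) = g x by exact: kink_at.
have [||h [hc hi ho hs]] := IH (k \o f) (g x) _ gs.
- by apply: sub_pairwise fs => a b /=; rewrite increasing_lt.
- move=> y ys; rewrite /= -{1}kx increasing_lt // fx // gx //=.
  have [/andP[_ fy1] /andP[_ ->]] := H y (mem_behead (s := _ :: _) ys).
  split=> //; have <- : k 1 = 1 by apply: kink_out; rewrite ?lexx ?orbT.
  by rewrite increasing_lt.
exists (h \o k); split.
- by move=> y; apply: continuous_comp; [exact: kink_continuous | exact: hc].
- by move=> a b /ki/hi.
- move=> y H'; rewrite /= /k (kink_out _ lf f1 H') ho //.
  by case/orP: H' => [yl|->]; rewrite ?orbT // (le_trans yl (ltW lg)).
- by move=> y; rewrite inE => /predU1P[->|/hs //]; rewrite /= kx ho ?lexx.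
Qed.

Lemma increasing_surj h v : continuous h -> increasing h ->
  h 0 = 0 -> h 1 = 1 -> 0 <= v <= 1 -> exists2 x, 0 <= x <= 1 & h x = v.
Proof.
move=> hc hi h0 h1 H.
have [||x] := @IVT R h 0 1 v ler01.
- exact: continuous_subspaceT.
- by rewrite h0 h1 minEle maxEle ler01.
- by rewrite in_itv /= => ? ?; exists x.
Qed.

Lemma unitIE x : unitI R x = (0 <= x <= 1) :> Prop.
Proof. by rewrite /unitI /= in_itv. Qed.

Lemma increasing_homeo_of h : continuous h -> increasing h -> h 0 = 0 ->
  h 1 = 1 -> increasing_homeo h.
Proof.
move=> hc hi h0 h1; split; last by move=> *; exact: hi.
- split.
  + move=> x; rewrite /= !unitIE -{2}h0 -{2}h1 => /andP[x0 x1].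
    by rewrite !increasing_le // x0.
  + by move=> x y _ _ /eqP; rewrite increasing_eq // => /eqP.
  + move=> y; rewrite unitIE => /(increasing_surj hc hi h0 h1)[x x01 <-].
    by exists x => //; rewrite unitIE.
- exact: continuous_subspaceT.
Qed.

Lemma homeo_interpolation (T : eqType) (f g : T -> R) (s : seq T) :
  pairwise (fun x y : T => f x < f y) s -> pairwise (fun x y : T => g x < g y) s ->
  (forall x : T, x \in s -> 0 < f x < 1 /\ 0 < g x < 1) ->
  exists2 h, increasing_homeo h & forall x : T, x \in s -> h (f x) = g x.
Proof.
move=> fs gs H; have [h [hc hi ho hs]] := increasing_interpolation fs gs H.
by exists h => //; apply: increasing_homeo_of; rewrite // ho ?lexx ?orbT.
Qed.

Lemma finite_set_sort (T : choiceType) (A : set T) (f : T -> R) :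
  finite_set A ->
  exists s, [/\ uniq s, A = [set` s] & sorted (fun x y : T => f x <= f y) s].
Proof.
move=> /finite_seqP[s ->]; exists (sort (fun x y : T => f x <= f y) (undup s)).
split; first by rewrite sort_uniq undup_uniq.
  by apply/seteqP; split=> x /=; rewrite mem_sort mem_undup.
by apply: sort_sorted => x y; exact: le_total.
Qed.

Lemma sorted_lt_of_le (T : eqType) (f : T -> R) (s : seq T) :
  uniq s -> {in s &, injective f} ->
  sorted (fun x y : T => f x <= f y) s -> sorted (fun x y : T => f x < f y) s.
Proof.
move=> us finj; rewrite !sorted_pairwise; last 2 first.
- by move=> x y z; exact: lt_trans.
- by move=> x y z; exact: le_trans.
elim: s us finj => //= x s IH /andP[xs us] finj /andP[/allP fx fs].
rewrite IH // ?andbT; last first.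
  by move=> a b sa sb; apply: finj; rewrite inE ?sa ?sb orbT.
apply/allP => y ys; rewrite lt_neqAle fx // andbT.
apply: contraNneq xs => /finj -> //; rewrite ?mem_head //.
by rewrite inE ys orbT.
Qed.

End Kink.

(** * Linear extensions of Gauss diagrams *)

Section Gauss.
Variables (R : realType) (n : nat).
Implicit Types (g : gauss_diagram R n) (a b : arrow R n) (k : 'I_n).

Definition touches k a := (k == (tail a).1) || (k == (head a).1).

Definition time_on k a : R := if k == (tail a).1 then (tail a).2 else (head a).2.

(** Vacuous for arrows without a common interval, hence not transitive: this is why lists of arrows
    are required to be [pairwise before] rather than [sorted]. *)
Definition before a b : bool :=
  [forall k, touches k a && touches k b ==> (time_on k a < time_on k b)].

(* W lists the arrows of g in an order compatible with their order on every
   interval. *)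
Definition linear_extension g (W : seq (gauss_letter n)) : Prop :=
  exists s : seq (arrow R n), [/\ arrows g = [set` s], pairwise before s,
    {in s, forall a, gauss_valid (letter_of a)} & W = map (@letter_of R n) s].

Lemma beforeP a b k : before a b -> touches k a -> touches k b ->
  time_on k a < time_on k b.
Proof. by move=> /forallP/(_ k)/implyP H ta tb; apply: H; rewrite ta. Qed.

Lemma touches_letter k a b : letter_of a = letter_of b -> touches k a = touches k b.
Proof. by rewrite /touches => -[-> -> _]. Qed.

Lemma touches_tail a : touches (tail a).1 a. Proof. by rewrite /touches eqxx. Qed.

Lemma touches_head a : touches (head a).1 a.
Proof. by rewrite /touches eqxx orbT. Qed.

Lemma time_on_tail a : time_on (tail a).1 a = (tail a).2.
Proof. by rewrite /time_on eqxx. Qed.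

Lemma time_on_head a : gauss_valid (letter_of a) ->
  time_on (head a).1 a = (head a).2.
Proof. by rewrite /gauss_valid /= eq_sym /time_on => /negbTE ->. Qed.

Lemma time_on_interior g a k : arrows g a -> 0 < time_on k a < 1.
Proof. by move=> /arrows_interior[? ?]; rewrite /time_on; case: ifP. Qed.

Lemma sub_mem_pairwise (T : eqType) (r r' : rel T) (s : seq T) :
  {in s &, subrel r r'} -> pairwise r s -> pairwise r' s.
Proof. by move=> H; apply: (sub_in_pairwise H); exact/allP. Qed.

Lemma pairwise_nth_lt (T : Type) (r : rel T) x0 (s : seq T) i j :
  pairwise r s -> (i < j < size s)%N -> r (nth x0 s i) (nth x0 s j).
Proof.
by move=> /(pairwiseP x0) H /andP[ij js]; apply: H => //; rewrite inE //;
  exact: ltn_trans js.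
Qed.

(** A common linear extension matches the arrows and puts their endpoints in the same order on each
    interval; the homeomorphisms are then interpolated interval by interval. *)
Lemma gauss_homeo_of_extension g g' W : linear_extension g W ->
  linear_extension g' W -> gauss_perm g = gauss_perm g' -> gauss_homeo g g'.
Proof.
move=> [s [gs ps vs Ws]] [s' [gs' ps' vs' Ws']] Ep.
have ss : size s = size s' by rewrite -(size_map (@letter_of R n)) -Ws Ws' size_map.
case: (posnP (size s)) => [s0|s0].
  exists (fun=> id); split=> //.
    by move=> k; apply: increasing_homeo_of => // x; exact: cvg_id.
  move: s0 ss gs gs'; case: s {ps vs Ws} => // _; case: s' {ps' vs' Ws'} => // _.
  by move=> -> ->; rewrite set_nil image_set0.
have [a0 _] : exists a0 : arrow R n, True by case: s s0 {gs ps vs Ws ss} => // a; exists a.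
have el i : (i < size s)%N -> letter_of (nth a0 s i) = letter_of (nth a0 s' i).
  move=> lt; rewrite -!(nth_map _ (letter_of a0)) -?ss //.
  by rewrite -Ws Ws'.
have H k : exists2 h, increasing_homeo h & forall i, (i < size s)%N ->
    touches k (nth a0 s i) -> h (time_on k (nth a0 s i)) = time_on k (nth a0 s' i).
  pose l := [seq i <- iota 0 (size s) | touches k (nth a0 s i)].
  have [|||h hh H] := @homeo_interpolation R _ (fun i => time_on k (nth a0 s i))
    (fun i => time_on k (nth a0 s' i)) l.
  - apply/(pairwiseP 0%N) => i j il jl ij; rewrite !inE in il jl.
    have /allP ml : all (fun i => (i < size s)%N && touches k (nth a0 s i)) l.
      by apply/allP => m; rewrite mem_filter mem_iota andbC.
    have /andP[mi ti] := ml _ (mem_nth 0%N il).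
    have /andP[mj tj] := ml _ (mem_nth 0%N jl).
    apply: beforeP => //; apply: pairwise_nth_lt => //; rewrite mj andbT.
    apply: (@pairwise_nth_lt _ ltn 0%N l) => //; last by rewrite ij.
    by rewrite -sorted_pairwise; [apply: sorted_filter (iota_ltn_sorted _ _);
      exact: ltn_trans | exact: ltn_trans].
  - apply/(pairwiseP 0%N) => i j il jl ij; rewrite !inE in il jl.
    have /allP ml : all (fun i => (i < size s)%N && touches k (nth a0 s i)) l.
      by apply/allP => m; rewrite mem_filter mem_iota andbC.
    have /andP[mi ti] := ml _ (mem_nth 0%N il).
    have /andP[mj tj] := ml _ (mem_nth 0%N jl).
    rewrite (touches_letter k (el _ mi)) in ti.
    rewrite (touches_letter k (el _ mj)) in tj.
    apply: beforeP => //; apply: pairwise_nth_lt => //; rewrite -ss mj andbT.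
    apply: (@pairwise_nth_lt _ ltn 0%N l) => //; last by rewrite ij.
    by rewrite -sorted_pairwise; [apply: sorted_filter (iota_ltn_sorted _ _);
      exact: ltn_trans | exact: ltn_trans].
  - move=> i; rewrite mem_filter mem_iota /= => /andP[_ lt]; split.
      by apply: (@time_on_interior g); rewrite gs /= mem_nth.
    by apply: (@time_on_interior g'); rewrite gs' /= mem_nth // -ss.
  exists h => // i lt ti; apply: H.
  by rewrite mem_filter ti mem_iota.
have {H} /choice[h Hh] : forall k, exists h : R -> R, increasing_homeo h /\ forall i, (i < size s)%N ->
    touches k (nth a0 s i) -> h (time_on k (nth a0 s i)) = time_on k (nth a0 s' i).
  by move=> k; have [h ? ?] := H k; exists h.
have M i : (i < size s)%N -> move_arrow h (nth a0 s i) = nth a0 s' i.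
  move=> lt; have E := el i lt.
  have Hi k := (Hh k).2 i lt.
  have := Hi _ (touches_tail _); have := Hi _ (touches_head _).
  have v : gauss_valid (letter_of (nth a0 s i)) by apply: vs; exact: mem_nth.
  have v' := v; rewrite E in v'.
  have [Et Eh Es] : [/\ (tail (nth a0 s i)).1 = (tail (nth a0 s' i)).1,
      (head (nth a0 s i)).1 = (head (nth a0 s' i)).1 &
      asign (nth a0 s i) = asign (nth a0 s' i)] by case: E.
  rewrite time_on_tail time_on_head // {2}Et {2}Eh time_on_tail time_on_head //.
  rewrite /move_arrow => -> ->; rewrite Et Eh Es.
  by case: (nth a0 s' i) => -[[? ?] [? ?]] ?.
exists h; split=> //; first by move=> k; case: (Hh k).
rewrite gs gs'; apply/seteqP; split=> a /=.
  move=> /(nthP a0)[i]; rewrite -ss => lt <-; exists (nth a0 s i) => //=.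
    exact: mem_nth.
  exact: M.
move=> [b /= /(nthP a0)[i lt <-] <-]; rewrite M //; apply: mem_nth.
by rewrite -ss.
Qed.

Lemma before_uniq (s : seq (arrow R n)) : pairwise before s -> uniq s.
Proof.
elim: s => //= a s IH /andP[/allP pa /IH ->]; rewrite andbT.
apply/negP => /pa /beforeP/(_ (touches_tail a) (touches_tail a)).
by rewrite ltxx.
Qed.

Lemma pairwise_index (T : eqType) (s : seq T) : uniq s ->
  pairwise (fun a b : T => (index a s < index b s)%N) s.
Proof.
elim: s => //= a s IH /andP[nas us]; apply/andP; split.
  apply/allP => b sb; rewrite eqxx; case: eqP => // E.
  by rewrite E sb in nas.
apply: sub_mem_pairwise (IH us) => b c sb sc lt.
by rewrite !ifN ?ltnS //; apply: contraNneq nas => ->.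
Qed.

(** Common times for the arrows can be assigned at will along the list; each interval is
    reparametrized so as to realize them. *)
Lemma represents_of_extension g W : linear_extension g W -> represents g W.
Proof.
move=> [s [gs ps vs Ws]].
have [tm tm_lt tm01] : exists2 tm : arrow R n -> R,
    (forall a b, (tm a < tm b) = (index a s < index b s)%N) &
    forall a, a \in s -> 0 < tm a < 1.
  (* Equally spaced times in the order of the list; the two successors keep them strictly between 0
     and 1. *)
  exists (fun a => (index a s).+1%:R / (size s).+1%:R).
    by move=> a b; rewrite ltr_pM2r ?invr_gt0 ?ltr0Sn // ltr_nat.
  move=> a sa; rewrite divr_gt0 ?ltr0Sn //= ltr_pdivrMr ?ltr0Sn // mul1r.
  by rewrite ltr_nat ltnS index_mem.
have us := before_uniq ps.
have tms : pairwise (fun a b => tm a < tm b) s.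
  by apply: sub_pairwise (pairwise_index us) => a b; rewrite tm_lt.
have H k : exists2 h, increasing_homeo h &
    forall a, a \in s -> touches k a -> h (time_on k a) = tm a.
  pose l := [seq a <- s | touches k a].
  have [|||h hh H] := @homeo_interpolation R _ (time_on k) tm l.
  - have : pairwise before l by apply: subseq_pairwise ps; exact: filter_subseq.
    apply: sub_mem_pairwise.
    move=> a b; rewrite !mem_filter => /andP[ta _] /andP[tb _] /beforeP.
    by apply.
  - by apply: subseq_pairwise tms; exact: filter_subseq.
  - move=> a; rewrite mem_filter => /andP[_ sa]; split; last exact: tm01.
    by apply: (@time_on_interior g); rewrite gs.
  by exists h => // a sa ta; apply: H; rewrite mem_filter ta.
have {H} /choice[h Hh] : forall k, exists h : R -> R, increasing_homeo h /\
    forall a, a \in s -> touches k a -> h (time_on k a) = tm a.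
  by move=> k; have [h ? ?] := H k; exists h.
have ht a : a \in s -> arrow_time h a = tm a.
  by move=> sa; rewrite -((Hh _).2 a sa (touches_tail a)) time_on_tail.
have hh a : a \in s -> h (head a).1 (head a).2 = tm a.
  by move=> sa; rewrite -((Hh _).2 a sa (touches_head a)) time_on_head // vs.
have tm_inj a b : a \in s -> b \in s -> tm a = tm b -> a = b.
  move=> sa sb E; have : index a s = index b s.
    have := tm_lt a b; have := tm_lt b a; rewrite E ltxx.
    by case: ltngtP.
  by move=> E'; rewrite -(nth_index a sa) E' nth_index.
have bp : braid_parametrization g h.
  split; first by move=> k; case: (Hh k).
    by move=> a; rewrite gs /= => sa; rewrite hh // -ht.
  by move=> a b; rewrite gs /= => sa sb; rewrite !ht //; exact: tm_inj.
split; last first.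
  exists h, s; split=> //; rewrite sorted_pairwise; last first.
    by move=> x y z; exact: lt_trans.
  by apply: sub_mem_pairwise tms => a b sa sb; rewrite !ht.
split; last by exists h.
  have dis a b k : a \in s -> b \in s -> a <> b -> touches k a -> touches k b ->
      time_on k a <> time_on k b.
    move=> sa sb ne ta tb E; apply: ne; apply: tm_inj => //.
    by rewrite -((Hh k).2 a) // -((Hh k).2 b) // E.
  move=> a b; rewrite gs /= => sa sb ne; apply/seteqP; split=> // -[k t] [Ha Hb].
  have {}Ha : touches k a /\ time_on k a = t.
    case: Ha => /= E; have -> : k = ((k, t) : 'I_n * R).1 by []; rewrite E /=.
      by rewrite touches_tail time_on_tail -E.
    by rewrite touches_head time_on_head ?vs // -E.
  have {}Hb : touches k b /\ time_on k b = t.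
    case: Hb => /= E; have -> : k = ((k, t) : 'I_n * R).1 by []; rewrite E /=.
      by rewrite touches_tail time_on_tail -E.
    by rewrite touches_head time_on_head ?vs // -E.
  case: Ha Hb => ta Ea [tb Eb]; apply: (dis a b k sa sb ne ta tb).
  by rewrite Ea Eb.
by move=> a; rewrite gs /= => /vs.
Qed.

Lemma extension_of_param g h (s : seq (arrow R n)) :
  braid_gauss g -> braid_parametrization g h -> arrows g = [set` s] ->
  sorted (fun a b => arrow_time h a < arrow_time h b) s ->
  linear_extension g (map (@letter_of R n) s).
Proof.
move=> [_ vg _] [hh ht _] gs; rewrite sorted_pairwise => [ps|]; last first.
  by move=> x y z; exact: lt_trans.
have ton a k : a \in s -> touches k a -> arrow_time h a = h k (time_on k a).
  move=> sa /orP[] /eqP ->; first by rewrite time_on_tail.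
  rewrite time_on_head; last by apply: vg; rewrite gs.
  by rewrite /arrow_time ht // gs.
exists s; split=> //; last by move=> a sa; apply: vg; rewrite gs.
apply: sub_mem_pairwise ps => a b sa sb lt; apply/forallP => k; apply/implyP => /andP[ta tb].
  move: lt; rewrite (ton a k) // (ton b k) // => lt.
  have Ia : unitI R (time_on k a).
    have /andP[? ?] := @time_on_interior g a k ltac:(by rewrite gs).
    by rewrite unitIE !ltW.
  have Ib : unitI R (time_on k b).
    have /andP[? ?] := @time_on_interior g b k ltac:(by rewrite gs).
    by rewrite unitIE !ltW.
  rewrite ltNge; apply/negP; rewrite le_eqVlt => /predU1P[E|].
    by move: lt; rewrite E ltxx.
  have [_ _ inc] := hh k.
  by move=> /(inc _ _ Ib Ia); rewrite ltNge (ltW lt).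
Qed.

Lemma extension_of_represents g W : represents g W -> linear_extension g W.
Proof. by move=> [bg [h [s [bp gs ss ->]]]]; exact: extension_of_param ss. Qed.

Lemma braid_gauss_extension g : braid_gauss g -> exists W, linear_extension g W.
Proof.
move=> bg; case: (bg) => _ _ [h bp].
have [s [us gs ss]] := finite_set_sort (arrow_time h) (arrows_finite g).
exists (map (@letter_of R n) s); apply: (extension_of_param bg bp gs).
apply: sorted_lt_of_le => // a b sa sb.
by case: bp => _ _; apply; rewrite gs.
Qed.

Lemma extension_homeo g g' W : gauss_homeo g g' -> linear_extension g W ->
  linear_extension g' W.
Proof.
move=> [h [hh gg' _]] [s [gs ps vs ->]].
exists (map (move_arrow h) s); split.
- rewrite gg' gs; apply/seteqP; split=> a /=.
    by move=> [b /= sb <-]; exact: map_f.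
  by move=> /mapP[b sb ->]; exists b.
- rewrite pairwise_map.
  have T k a : touches k (move_arrow h a) = touches k a by [].
  have ton k a : touches k a -> time_on k (move_arrow h a) = h k (time_on k a).
    rewrite /touches /time_on /=; case: eqP => [->//|_ /= /eqP ->] //.
  have I k a : a \in s -> unitI R (time_on k a).
    move=> sa; have /andP[? ?] := @time_on_interior g a k ltac:(by rewrite gs).
    by rewrite unitIE !ltW.
  apply: sub_mem_pairwise ps => a b sa sb ab.
  apply/forallP => k; rewrite !T; apply/implyP => /andP[ta tb].
  rewrite !ton //; have [_ _ inc] := hh k; apply: inc; try exact: I.
  exact: beforeP.
- by move=> a /mapP[b sb ->]; exact: (vs b sb).
- by rewrite -map_comp.
Qed.

(** The list is pulled back arrow by arrow instead of inverting [h]; strict monotonicity of each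
    [h k] on [0,1] makes the preimages unique. *)
Lemma extension_homeo_inv g g' W : gauss_homeo g g' -> linear_extension g' W ->
  linear_extension g W.
Proof.
move=> [h [hh gg' _]] [s' [gs' ps' vs' ->]].
have [s [Es gs]] : exists s, map (move_arrow h) s = s' /\ {in s, forall a, arrows g a}.
  have : {in s', forall b, (move_arrow h @` arrows g) b}.
    by move=> b sb; rewrite -gg' gs'.
  elim: s' {gs' ps' vs'} => [|b s' IH] H; first by exists [::].
  have [|s [<- gs]] := IH; first by move=> c sc; apply: H; rewrite inE sc orbT.
  have [a ga <-] := H b (mem_head _ _).
  by exists (a :: s); split=> // c; rewrite inE => /predU1P[->//|/gs].
have I k a : arrows g a -> unitI R (time_on k a).
  by move=> ga; have /andP[? ?] := time_on_interior k ga; rewrite unitIE !ltW.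
have inj k x y : unitI R x -> unitI R y -> h k x = h k y -> x = y.
  move=> Ix Iy E; have [_ _ inc] := hh k.
  by have [/(inc _ _ Ix Iy)|/(inc _ _ Iy Ix)|//] := ltgtP x y; rewrite E ltxx.
have ton k a : touches k a -> time_on k (move_arrow h a) = h k (time_on k a).
  rewrite /touches /time_on /=; case: eqP => [->//|_ /= /eqP ->] //.
exists s; split.
- apply/seteqP; split=> a /=; last exact: gs.
  move=> ga; have : arrows g' (move_arrow h a) by rewrite gg'; exists a.
  rewrite gs' -Es /= => /mapP[b sb E].
  suff -> : a = b by [].
  have gb := gs _ sb.
  have := arrows_interior ga; have := arrows_interior gb.
  case: a b E {ga gb sb} => [[[i t] [j u]] e] [[[i' t'] [j' u']] e'].
  rewrite /move_arrow /= => -[<- Et <- Eu ->].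
  move=> [/andP[t0' t1'] /andP[u0' u1']] [/andP[t0 t1] /andP[u0 u1]].
  have It : t = t' by apply: inj Et; rewrite unitIE !ltW.
  have Iu : u = u' by apply: inj Eu; rewrite unitIE !ltW.
  by rewrite It Iu.
- move: ps'; rewrite -Es pairwise_map; apply: sub_mem_pairwise => a b sa sb /= ab.
  apply/forallP => k; apply/implyP => /andP[ta tb].
  have := beforeP (k := k) ab ta tb; rewrite !ton // => lt.
  rewrite ltNge; apply/negP; rewrite le_eqVlt => /predU1P[E|].
    by move: lt; rewrite E ltxx.
  have [_ _ inc] := hh k.
  by move=> /(inc _ _ (I _ _ (gs _ sb)) (I _ _ (gs _ sa))); rewrite ltNge (ltW lt).
- move=> a sa; apply: (vs' (move_arrow h a)); rewrite -Es; exact: map_f.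
- by rewrite -Es -map_comp.
Qed.

Lemma gequiv_disjoint (X : gauss_letter n) U : gauss_valid X ->
  all (@gauss_valid n) U -> all (gauss_disjoint X) U -> gequiv (X :: U) (U ++ [:: X]).
Proof.
move=> vX; elim: U => [|Y U IH] /=; first by move=> *; exact: gequiv_refl.
move=> /andP[vY vU] /andP[dY dU].
apply: (gequiv_trans (W' := [:: Y] ++ (X :: U))).
  by apply: (@gequiv_cat _ [:: X; Y] [:: Y; X] U U); [exact: gequiv_comm | exact: gequiv_refl].
by apply: (@gequiv_cat _ [:: Y] [:: Y]); [exact: gequiv_refl | exact: IH].
Qed.

(* Two linear extensions of one partial order differ by exchanges of
   consecutive unrelated elements. *)
Lemma gequiv_extensions (s s' : seq (arrow R n)) :
  {in s, forall a, gauss_valid (letter_of a)} ->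
  pairwise before s -> pairwise before s' -> perm_eq s s' ->
  gequiv (map (@letter_of R n) s) (map (@letter_of R n) s').
Proof.
elim: s s' => [|a s IH] s' vs ps ps' pss'.
  by move: pss'; rewrite perm_sym => /perm_nilP ->; exact: gequiv_refl.
have sa' : a \in s' by rewrite -(perm_mem pss') mem_head.
case/splitPr: sa' pss' ps' => u v pss' ps'.
have puv : perm_eq s (u ++ v).
  by rewrite -(perm_cons a); apply: perm_trans pss' _; rewrite perm_catC /= perm_cons perm_catC.
move: ps' ps; rewrite pairwise_cat /= => /and3P[auv pu /andP[_ pv]] /andP[/allP pa ps].
rewrite map_cat /=.
apply: (gequiv_trans (W' := letter_of a :: (map (@letter_of R n) (u ++ v)))).
  apply: (@gequiv_cat _ [:: letter_of a] [:: letter_of a]); first exact: gequiv_refl.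
  apply: IH => //; first by move=> b sb; apply: vs; rewrite inE sb orbT.
  rewrite pairwise_cat pu pv !andbT.
  by move: auv; rewrite allrel_consr => /andP[].
rewrite map_cat -cat_cons -[_ :: map _ v]cat1s catA.
apply: gequiv_cat; last exact: gequiv_refl.
apply: gequiv_disjoint.
- by apply: vs; rewrite mem_head.
- rewrite all_map; apply/allP => b ub /=; apply: vs.
  by rewrite inE (perm_mem puv) mem_cat ub orbT.
- rewrite all_map; apply/allP => b ub /=.
  have ab : before a b by apply: pa; rewrite (perm_mem puv) mem_cat ub.
  have ba : before b a.
    by move: auv; rewrite allrel_consr => /andP[/allP /(_ b ub)].
  have no k : touches k a -> touches k b -> False.
    move=> ta tb; have := beforeP ab ta tb; have := beforeP ba tb ta.
    by move=> lt /(lt_trans lt); rewrite ltxx.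
  rewrite /gauss_disjoint /=; apply/and4P; split; apply/negP => /eqP E.
  + by apply: (no (tail a).1); rewrite ?touches_tail // E touches_tail.
  + by apply: (no (tail a).1); rewrite ?touches_tail // E touches_head.
  + by apply: (no (head a).1); rewrite ?touches_head // E touches_tail.
  + by apply: (no (head a).1); rewrite ?touches_head // E touches_head.
Qed.

Lemma gequiv_extension g W W' : linear_extension g W -> linear_extension g W' ->
  gequiv W W'.
Proof.
move=> [s [gs ps vs ->]] [s' [gs' ps' _ ->]]; apply: gequiv_extensions => //.
apply: uniq_perm; rewrite ?before_uniq // => a.
by move: gs; rewrite gs' => /seteqP[H1 H2]; apply/idP/idP; [exact: H2 | exact: H1].
Qed.

Lemma extension_valid g W : linear_extension g W -> all (@gauss_valid n) W.
Proof. by move=> [s [_ _ vs ->]]; rewrite all_map; apply/allP. Qed.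

Lemma braid_gauss_of_extension g W : linear_extension g W -> braid_gauss g.
Proof. by move=> /represents_of_extension[]. Qed.

(** Being a braid Gauss diagram is carried along in both directions, because transitivity requires a
    linear extension of the intermediate diagram. *)
Lemma reidemeister_geq g g' : reidemeister_equivalent g g' ->
  (braid_gauss g <-> braid_gauss g') /\ forall W W', linear_extension g W ->
    linear_extension g' W' -> gequiv W W' /\ gauss_perm g = gauss_perm g'.
Proof.
have homeo_sym (f f' : gauss_diagram R n) : gauss_homeo f f' -> braid_gauss f -> braid_gauss f'.
  move=> ff' bf; have [W] := braid_gauss_extension bf.
  by move=> /(extension_homeo ff')/braid_gauss_of_extension.
elim=> {g g'}.
- move=> g g' [[h [hh gg' pp]]|[W1 [U [U' [W2 [m r r' pp]]]]]].
    have hgg' : gauss_homeo g g' by exists h.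
    split; last first.
      move=> W W' /(extension_homeo hgg') e e'; split; last by rewrite pp.
      exact: gequiv_extension e e'.
    split; first exact: homeo_sym.
    move=> bg'; have [W] := braid_gauss_extension bg'.
    by move=> /(extension_homeo_inv hgg')/braid_gauss_of_extension.
  split; first by case: r r' => ? _ [].
  move=> W W' e e'; split=> //.
  apply: gequiv_trans (gequiv_extension e (extension_of_represents r)) _.
  apply: gequiv_trans _ (gequiv_extension (extension_of_represents r') e').
  apply: gequiv_cat; first exact: gequiv_refl.
  by apply: gequiv_cat; [exact: gequiv_move | exact: gequiv_refl].
- by move=> g; split=> // W W' e e'; split=> //; exact: gequiv_extension e e'.
- move=> g g' _ [bb IH]; split; first by rewrite bb.
  by move=> W W' e e'; have [? ->] := IH W' W e' e; split=> //; exact: gequiv_sym.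
- move=> g g' g'' _ [b1 IH1] _ [b2 IH2]; split; first by rewrite b1.
  move=> W W'' e e''.
  have [W' e'] : exists W', linear_extension g' W'.
    by apply: braid_gauss_extension; apply/b1; exact: braid_gauss_of_extension e.
  have [? ->] := IH1 _ _ e e'; have [? ->] := IH2 _ _ e' e''.
  by split=> //; apply: gequiv_trans; eauto.
Qed.
End Gauss.

(** * Diagrams as families of heights *)

Lemma fst_continuous (X Y : topologicalType) : continuous (@fst X Y).
Proof. by move=> p; exact: (@cvg_fst _ _ (nbhs p.1) (nbhs p.2)). Qed.

Lemma snd_continuous (X Y : topologicalType) : continuous (@snd X Y).
Proof. by move=> p; exact: (@cvg_snd _ _ (nbhs p.1) (nbhs p.2)). Qed.

Lemma comp_continuous (X Y Z : topologicalType) (f : X -> Y) (g : Y -> Z) :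
  continuous f -> continuous g -> continuous (fun x => g (f x)).
Proof. by move=> fc gc x; apply: (continuous_comp (fc x) (gc (f x))). Qed.

Lemma pair_continuous (X Y Z : topologicalType) (f : X -> Y) (g : X -> Z) :
  continuous f -> continuous g -> continuous (fun x => (f x, g x)).
Proof. by move=> fc gc x; apply: (cvg_pair (fc x) (gc x)). Qed.

Lemma uniq_map_inj_in (T U : eqType) (f : T -> U) (s : seq T) :
  uniq (map f s) -> {in s &, injective f}.
Proof.
elim: s => //= a s IH /andP[na us] x y; rewrite !inE.
move=> /predU1P[->|xs] /predU1P[->|ys] E //.
- by move: na; rewrite E map_f.
- by move: na; rewrite -E map_f.
- exact: IH.
Qed.

Section Topology.
Variable R : realType.

(** The infimum of the counterexamples would satisfy [P] by the hypothesis on the left, and the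
    hypothesis on the right would then keep counterexamples away from it. *)
Lemma real_induction (P : R -> Prop) : P 0 ->
  (forall u, 0 <= u < 1 -> (forall v, 0 <= v <= u -> P v) ->
    exists2 r, u < r & forall v, u < v < r -> P v) ->
  (forall u, 0 < u <= 1 -> (forall v, 0 <= v < u -> P v) -> P u) ->
  forall t, 0 <= t <= 1 -> P t.
Proof.
move=> P0 Pr Pl t /andP[t0 t1]; apply: contrapT => nPt.
pose B : set R := [set u | 0 <= u <= 1 /\ ~ P u].
have Bt : B t by split; rewrite ?t0.
have lB : lbound B 0 by move=> u [/andP[]].
have hB : has_lbound B by exists 0.
set m := inf B.
have m0 : 0 <= m by apply: lb_le_inf => //; exists t.
have mt : m <= t by exact: ge_inf.
have below v : 0 <= v < m -> P v.
  move=> /andP[v0 vm]; apply: contrapT => nP.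
  have : B v by split=> //; rewrite v0 (le_trans (ltW vm)) // (le_trans mt).
  by move=> /(ge_inf hB); rewrite leNgt vm.
have Pm : P m.
  have [<- //|m0'] := eqVneq 0 m.
  by apply: Pl => //; rewrite lt_neqAle m0' m0 (le_trans mt).
have lmt : m < t by rewrite lt_neqAle mt andbT; apply/eqP => E; apply: nPt; rewrite -E.
have [||r mr Hr] := Pr m.
- by rewrite m0 (lt_le_trans lmt).
- move=> v /andP[v0]; rewrite le_eqVlt => /predU1P[-> //|vm].
  by apply: below; rewrite v0.
suff : r <= m by rewrite leNgt mr.
apply: lb_le_inf; first by exists t.
move=> u [/andP[u0 u1] nP]; rewrite leNgt; apply/negP => ur.
apply: nP; have [um|] := ltP u m; first by apply: below; rewrite u0.
rewrite le_eqVlt => /predU1P[<- //|mu]; apply: Hr.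
by rewrite mu.
Qed.

Lemma continuous_gt (f : R -> R) x z : {for x, continuous f} -> z < f x ->
  exists2 e, 0 < e & forall v, x - e < v < x + e -> z < f v.
Proof.
move=> fc zf; have [e /= e0 He] := @cvgr_gt _ _ (nbhs x) _ f (f x) fc z zf.
exists e => // v /andP[v1 v2]; apply: He.
by rewrite /ball /= ltr_norml; apply/andP; split; lra.
Qed.

Lemma continuous_lt (f : R -> R) x z : {for x, continuous f} -> f x < z ->
  exists2 e, 0 < e & forall v, x - e < v < x + e -> f v < z.
Proof.
move=> fc zf; have [e /= e0 He] := @cvgr_lt _ _ (nbhs x) _ f (f x) fc z zf.
exists e => // v /andP[v1 v2]; apply: He.
by rewrite /ball /= ltr_norml; apply/andP; split; lra.
Qed.

(** A continuous function can turn negative only after a zero, so the sign has to be checked only to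
    the right of zeros. In [same_order] these zeros are crossings. *)
Lemma ge0_induction (f : R -> R) : continuous f -> 0 <= f 0 ->
  (forall u, 0 <= u < 1 -> f u = 0 ->
     exists2 r, u < r & forall v, u < v < r -> 0 <= f v) ->
  forall t, 0 <= t <= 1 -> 0 <= f t.
Proof.
move=> fc f0 fr; apply: real_induction => //.
- move=> u u01 H; have u0 : 0 <= u by case/andP: u01.
  have := H u; rewrite u0 lexx => /(_ isT).
  rewrite le_eqVlt => /predU1P[E|fu]; first exact: fr.
  have [e e0 He] := continuous_gt (fc u) fu.
  exists (u + e) => [|v /andP[uv ve]]; first by rewrite ltrDl.
  apply/ltW/He; apply/andP; split; lra.
- move=> u /andP[u0 u1] H; rewrite leNgt; apply/negP => fu.
  have [e e0 He] := continuous_lt (fc u) fu.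
  pose v := Num.max 0 (u - e / 2).
  have vu : v < u by rewrite gt_max u0 /= ltrBlDr ltrDl divr_gt0.
  have v0 : 0 <= v by rewrite le_max lexx.
  have : 0 <= f v by apply: H; rewrite v0.
  rewrite leNgt => /negP; apply; apply: He.
  have : u - e / 2 <= v by rewrite le_max lexx orbT.
  move=> ?; apply/andP; split; lra.
Qed.

Lemma IVT_zero (f : R -> R) a b : continuous f -> a <= b -> f a * f b <= 0 ->
  exists2 x, a <= x <= b & f x = 0.
Proof.
move=> fc ab fab.
have [||x] := @IVT R f a b 0 ab; first exact: continuous_subspaceT.
  rewrite ge_min le_max.
  have [fa|fa] := ltP 0 (f a); have [fb|fb] := ltP 0 (f b).
  - by have := mulr_gt0 fa fb; rewrite ltNge fab.
  - by rewrite /= (ltW fa).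
  - by rewrite /= (ltW fb) orbT.
  - rewrite (le_eqVlt (f a)) (le_eqVlt (f b)) in fa fb.
    case/predU1P: fa => [->|fa]; first by rewrite lexx.
    case/predU1P: fb => [->|fb]; first by rewrite lexx !orbT.
    have : 0 < f a * f b by rewrite nmulr_rgt0.
    by rewrite ltNge fab.
by rewrite in_itv /= => ? ?; exists x.
Qed.

(** Retraction of the line onto [0,1]: composition with it turns continuity within the interval into
    continuity on the whole line. *)
Definition clamp (x : R) : R := Num.max 0 (Num.min x 1).

Lemma clamp01 x : 0 <= clamp x <= 1.
Proof. by rewrite /clamp le_max lexx /= ge_max ler01 ge_min lexx orbT. Qed.

Lemma clamp_id x : 0 <= x <= 1 -> clamp x = x.
Proof.
by move=> /andP[x0 x1]; rewrite /clamp (min_idPl x1) (max_idPr x0).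
Qed.

Lemma clamp_continuous : continuous clamp.
Proof.
move=> x; apply: (@continuous_max R R (fun=> 0) (fun x => Num.min x 1)).
  exact: cvg_cst.
by apply: (@continuous_min R R id (fun=> 1)); [exact: cvg_id | exact: cvg_cst].
Qed.

Lemma within_comp (X Y Z : topologicalType) (A : set Y) (f : Y -> Z) (c : X -> Y) :
  {within A, continuous f} -> continuous c -> (forall x, A (c x)) ->
  continuous (f \o c).
Proof.
move=> /subspace_continuousP fA cc Ac x B nB.
have := fA (c x) (Ac x) B nB; rewrite nbhs_simpl /= => H.
by apply: (@filterS _ (nbhs x) _ _ _ _ (cc x _ H)) => z /= Hz; exact: Hz.
Qed.

Lemma within_eq (X Y : topologicalType) (A : set X) (f g : X -> Y) :
  (forall x, A x -> f x = g x) -> continuous g -> {within A, continuous f}.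
Proof.
move=> E gc; apply: (@subspace_eq_continuous _ A _ (g : subspace A -> Y)).
  by move=> x /set_mem Ax; exact: (esym (E x Ax)).
exact: continuous_subspaceT.
Qed.

Variable n : nat.
Implicit Types (b : virtual_braid_diagram R n) (y : 'I_n -> R -> R) (i j k : 'I_n).

Definition ht (b : strand_diagram R n) k (t : R) : R := (curve b k (clamp t)).2.

Lemma curveE (b : strand_diagram R n) k t : 0 <= t <= 1 ->
  curve b k t = (t, ht b k t).
Proof.
move=> t01; rewrite /ht clamp_id //.
have := @curve_monotone _ _ b k t; rewrite unitIE => /(_ t01).
by case: (curve b k t) => u v /= ->.
Qed.

Lemma ht_continuous (b : strand_diagram R n) k : continuous (ht b k).
Proof.
have : continuous (curve b k \o clamp).
  apply: within_comp (@curve_continuous _ _ b k) clamp_continuous _ => x.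
  by rewrite unitIE clamp01.
by move=> H; apply: (comp_continuous H (@snd_continuous R R)).
Qed.

(* Strand i descends with respect to strand j at time t. *)
Definition crosses y i j (t : R) : Prop := exists l r,
  [/\ 0 <= l, l < t, t < r & r <= 1] /\
  [/\ y i t = y j t, forall u, l < u < t -> y j u < y i u &
      forall u, t < u < r -> y i u < y j u].

Lemma crosses_ext y y' i j t :
  (forall k u, 0 <= u <= 1 -> y k u = y' k u) -> crosses y i j t -> crosses y' i j t.
Proof.
move=> E [l [r [[l0 lt tr r1] [e H1 H2]]]]; exists l, r; split=> //.
have I u : l < u < r -> 0 <= u <= 1 by move=> /andP[? ?]; apply/andP; split; lra.
split; first by rewrite -!E // I // lt tr.
- move=> u /andP[lu ut]; rewrite -!E; first by apply: H1; rewrite lu.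
    by apply: I; rewrite lu (lt_trans ut).
  by apply: I; rewrite lu (lt_trans ut).
- move=> u /andP[tu ur]; rewrite -!E; first by apply: H2; rewrite tu.
    by apply: I; rewrite ur andbT (lt_trans lt).
  by apply: I; rewrite ur andbT (lt_trans lt).
Qed.

Lemma crosses_in y i j t : crosses y i j t -> 0 < t < 1.
Proof.
by move=> [l [r [[l0 lt tr r1] _]]]; rewrite (le_lt_trans l0 lt) (lt_le_trans tr).
Qed.

Lemma crosses_inW y i j t : crosses y i j t -> 0 <= t <= 1.
Proof. by move=> /crosses_in/andP[? ?]; rewrite !ltW. Qed.

Lemma crosses_asym y i j t : crosses y i j t -> crosses y j i t -> False.
Proof.
move=> [l [r [[l0 lt tr r1] [_ H _]]]] [l' [r' [[l0' lt' tr' r1'] [_ H' _]]]].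
pose u := (Num.max l l' + t) / 2.
have m1 : Num.max l l' < t by rewrite gt_max lt.
have m2 : l <= Num.max l l' by rewrite le_max lexx.
have m3 : l' <= Num.max l l' by rewrite le_max lexx orbT.
have : y j u < y i u by apply: H; rewrite /u; apply/andP; split; lra.
have : y i u < y j u by apply: H'; rewrite /u; apply/andP; split; lra.
by move=> /lt_trans H1 /H1; rewrite ltxx.
Qed.

Lemma crosses_irrefl y i t : ~ crosses y i i t.
Proof. by move=> c; exact: (crosses_asym c c). Qed.

Lemma crosses_eq y i j t : crosses y i j t -> y i t = y j t.
Proof. by move=> [l [r [_ []]]]. Qed.

Lemma passesE (b : strand_diagram R n) k p : passes (curve b) k p <->
  0 <= p.1 <= 1 /\ p.2 = ht b k p.1.
Proof.
split=> [[t]|[p1 p2]].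
  by rewrite unitIE => t01; rewrite curveE // => <-.
by exists p.1; rewrite ?unitIE // curveE // -p2; case: p {p1 p2}.
Qed.

Lemma near_left_ex (P : R -> Prop) (t : R) : 0 < t ->
  (\forall u \near t^'-, P u) <-> exists l, 0 <= l < t /\ forall u, l < u < t -> P u.
Proof.
move=> t0; split=> [[e /= e0 H]|[l [/andP[l0 lt] H]]].
  exists (Num.max 0 (t - e)); rewrite le_max lexx gt_max t0 /=; split; first lra.
  move=> u /andP[+ ut]; rewrite gt_max => /andP[u0 ue]; apply: H => //.
  by rewrite /ball /= ltr_norml; apply/andP; split; lra.
near=> u; apply: H; apply/andP; split; near: u; first exact: nbhs_left_gt.
exact: nbhs_left_lt.
Unshelve. all: by end_near.
Qed.

Lemma near_right_ex (P : R -> Prop) (t : R) : t < 1 ->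
  (\forall u \near t^'+, P u) <-> exists r, t < r <= 1 /\ forall u, t < u < r -> P u.
Proof.
move=> t0; split=> [[e /= e0 H]|[r [/andP[tr r1] H]]].
  exists (Num.min 1 (t + e)); rewrite ge_min lexx lt_min t0 /= andbT; split; first lra.
  move=> u /andP[tu]; rewrite lt_min => /andP[u0 ue]; apply: H => //.
  by rewrite /ball /= ltr_norml; apply/andP; split; lra.
near=> u; apply: H; apply/andP; split; near: u; first exact: nbhs_right_gt.
exact: nbhs_right_lt.
Unshelve. all: by end_near.
Qed.

Lemma descendsE (b : strand_diagram R n) i j p : i != j ->
  descends (curve b) i j p <-> p.2 = ht b i p.1 /\ crosses (ht b) i j p.1.
Proof.
move=> ij; split.
  move=> [pi pj Hl Hr].
  have /andP[p0 p1] : 0 < p.1 < 1 by apply: (@crossing_interior R n b); exists i, j.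
  move: pi pj => /passesE[p01 Ei] /passesE[_ Ej]; split=> //.
  have [l [/andP[l0 lp] Hl']] := (near_left_ex _ p0).1 Hl.
  have [r [/andP[pr r1] Hr']] := (near_right_ex _ p1).1 Hr.
  exists l, r; split=> //; split; first by rewrite -Ei.
    move=> u /andP[lu up]; have := Hl' u; rewrite lu up => /(_ isT).
    by rewrite !curveE //; apply/andP; split; lra.
  move=> u /andP[lu up]; have := Hr' u; rewrite lu up => /(_ isT).
  by rewrite !curveE //; apply/andP; split; lra.
move=> [E c]; have p01 := crosses_inW c; have /andP[p0 p1] := crosses_in c.
case: (c) => l [r [[l0 lp pr r1] [e Hl Hr]]]; split.
- by apply/passesE.
- by apply/passesE; rewrite -e.
- apply/(near_left_ex _ p0); exists l; rewrite l0 lp; split=> // u lup.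
  have := Hl u lup; case/andP: lup => ? ?.
  by rewrite !curveE //; apply/andP; split; lra.
- apply/(near_right_ex _ p1); exists r; rewrite pr r1; split=> // u lup.
  have := Hr u lup; case/andP: lup => ? ?.
  by rewrite !curveE //; apply/andP; split; lra.
Qed.

Definition meet_times y : set R :=
  [set t | 0 <= t <= 1 /\ exists i j, i != j /\ y i t = y j t].

(** The conditions on heights from which [diagram_of_heights] rebuilds a strand diagram. Continuity
    is asked on the whole line, as clamped heights provide it. *)
Definition admissible (p : 'S_n) y : Prop :=
  [/\ forall k, continuous (y k),
      forall k t, 0 <= t <= 1 -> 0 <= y k t <= 1,
      forall k, y k 0 = height R k /\ y k 1 = height R (p k),
      finite_set (meet_times y) &
      forall t i j, i != j -> 0 <= t <= 1 -> y i t = y j t ->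
        (forall k, y k t = y i t -> k = i \/ k = j) /\
        (crosses y i j t \/ crosses y j i t)].

Lemma admissible_ht (b : strand_diagram R n) : admissible (strand_perm b) (ht b).
Proof.
split.
- by move=> k; exact: ht_continuous.
- move=> k t t01; have := @curve_square _ _ b k t; rewrite unitIE => /(_ t01).
  by rewrite curveE // => -[_ /=]; rewrite unitIE.
- move=> k; have := @curve_left _ _ b k; have := @curve_right _ _ b k.
  by rewrite !curveE ?lexx ?ler01 // => -[->] [->].
- apply: (@sub_finite_set _ _ (fst @` multiple_points (curve b))).
    move=> t [t01 [i [j [ij e]]]]; exists (t, ht b i t) => //.
    by exists i, j; split=> //; apply/passesE.
  by apply: finite_image; case: (curve_general b).
- move=> t i j ij t01 e; have [_ G] := curve_general b.
  have [||H1 H2] := G (t, ht b i t) i j ij; try by apply/passesE.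
  split; first by move=> k E; apply: H1; apply/passesE; rewrite /= E.
  have ji : j != i by rewrite eq_sym.
  by case: H2 => [/(descendsE _ _ ij)[_ c]|/(descendsE _ _ ji)[_ c]]; [left | right].
Qed.

Lemma diagram_of_heights (p : 'S_n) y : admissible p y ->
  exists b : strand_diagram R n, strand_perm b = p /\
    forall k t, 0 <= t <= 1 -> ht b k t = y k t.
Proof.
move=> [yc y01 ye yf yg].
pose c k t : R * R := (t, y k t).
have pE k q : passes c k q <-> 0 <= q.1 <= 1 /\ q.2 = y k q.1.
  split=> [[t]|[q1 q2]]; first by rewrite unitIE => ? <-.
  by exists q.1; rewrite ?unitIE // /c -q2; case: q {q1 q2}.
have cc k : {within unitI R, continuous (c k)}.
  apply: continuous_subspaceT; apply: pair_continuous; last exact: yc.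
  by move=> t; exact: cvg_id.
have cs k t : unitI R t -> (unitI R `*` unitI R) (c k t).
  by move=> It; split=> //=; move: It; rewrite !unitIE => /y01.
have cm k t : unitI R t -> (c k t).1 = t by [].
have cl k : c k 0 = (0, height R k) by rewrite /c (ye k).1.
have cr k : c k 1 = (1, height R (p k)) by rewrite /c (ye k).2.
have cg : general_position c.
  split.
    apply: (@sub_finite_set _ _ ((fun ti : R * 'I_n => (ti.1, y ti.2 ti.1)) @`
      (meet_times y `*` [set: 'I_n]))).
      move=> q [i [j [ij /pE[q01 qi] /pE[_ qj]]]]; exists (q.1, i) => /=.
        by split=> //; split=> //; exists i, j; rewrite -qi.
      by rewrite -qi; case: q {q01 qi qj}.
    by apply: finite_image; apply: finite_setX => //; exact: finite_finset.
  move=> q i j ij /pE[q01 qi] /pE[_ qj].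
  have [|H1 H2] := yg q.1 i j ij q01; first by rewrite -qi.
  split; first by move=> k /pE[_ qk]; apply: H1; rewrite -qk qi.
  have D k l : k != l -> q.2 = y k q.1 -> crosses y k l q.1 -> descends c k l q.
    move=> kl E cr'; have /andP[q0 q1] := crosses_in cr'.
    case: cr' => u [v [[u0 uq qv v1] [e Hl Hr]]]; split.
    - exact/pE.
    - by apply/pE; rewrite -e.
    - apply/(near_left_ex _ q0); exists u; rewrite u0 uq; split=> // t; exact: Hl.
    - apply/(near_right_ex _ q1); exists v; rewrite qv v1; split=> // t; exact: Hr.
  by case: H2 => cr'; [left | right]; apply: D => //; rewrite eq_sym.
exists (StrandDiagram cc cs cm cl cr cg); split=> // k t t01.
by rewrite /ht /= clamp_id.
Qed.

(** * Finite lists of timed and labelled crossings *)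

Definition entry := (R * crossing_label n)%type.
Implicit Types (e : entry) (L : seq entry).

Definition pairs L : seq (R * ('I_n * 'I_n)) := [seq (e.1, e.2.1) | e <- L].

Definition traces y L : Prop :=
  uniq (pairs L) /\
  forall t i j, (t, (i, j)) \in pairs L <-> crosses y i j t.

(** The finite content of a diagram. The order of [L] is left free, so that it can be adapted to
    times, to a disc or to an isotopy. *)
Definition data b L : Prop :=
  traces (ht b) L /\
  forall e, e \in L -> cvalue b (e.1, ht b e.2.1.1 e.1) = e.2.2.

Lemma traces_ext y y' L :
  (forall k t, 0 <= t <= 1 -> y k t = y' k t) -> traces y L -> traces y' L.
Proof.
move=> E [uL HL]; split=> // t i j; rewrite HL; split; apply: crosses_ext => //.
by move=> k u u01; rewrite E.
Qed.

Lemma traces_crosses y L e : traces y L -> e \in L ->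
  crosses y e.2.1.1 e.2.1.2 e.1.
Proof.
move=> [_ H] eL; apply/H/mapP; exists e => //; by case: e {eL} => t [[i j] v].
Qed.

Lemma traces_meet p y L i j t : admissible p y -> traces y L -> i != j ->
  0 <= t <= 1 -> y i t = y j t ->
  exists2 e, e \in L & e.1 = t /\ (e.2.1 = (i, j) \/ e.2.1 = (j, i)).
Proof.
move=> [_ _ _ _ G] [_ H] ij t01 E; have [_ [c|c]] := G t i j ij t01 E.
  have /mapP[e eL [-> Ee]] : (t, (i, j)) \in pairs L by apply/H.
  by exists e => //; split=> //; left.
have /mapP[e eL [-> Ee]] : (t, (j, i)) \in pairs L by apply/H.
by exists e => //; split=> //; right.
Qed.

Lemma crosses_same p y i j k l t : admissible p y -> crosses y i j t ->
  crosses y k l t -> y i t = y k t -> (i, j) = (k, l).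
Proof.
move=> [_ _ _ _ G] c c' E.
have ij : i != j by apply/eqP => F; rewrite F in c; exact: crosses_irrefl c.
have kl : k != l by apply/eqP => F; rewrite F in c'; exact: crosses_irrefl c'.
have [H _] := G t i j ij (crosses_inW c) (crosses_eq c).
have := H k (esym E); have := H l; rewrite -(crosses_eq c') -E => /(_ erefl).
move=> [] El [] Ek; subst => //.
- by rewrite eqxx in kl.
- by case: (crosses_asym c c').
- by rewrite eqxx in kl.
Qed.

Lemma traces_inj p y L e f : admissible p y -> traces y L -> e \in L -> f \in L ->
  e.1 = f.1 -> y e.2.1.1 e.1 = y f.2.1.1 f.1 -> (e.1, e.2.1) = (f.1, f.2.1).
Proof.
move=> A T eL fL Et E; rewrite Et; congr (_, _).
have c := traces_crosses T eL; have c' := traces_crosses T fL.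
rewrite -Et in c' E.
by have := crosses_same A c c' E; case: e f {eL fL Et E c c'} => t [[i j] v] [u [[k l] w]].
Qed.

Lemma diagram_with_data p y L : admissible p y -> traces y L ->
  exists b, [/\ strand_perm b = p, forall k t, 0 <= t <= 1 -> ht b k t = y k t &
    data b L].
Proof.
move=> A T; have [s [sp sh]] := diagram_of_heights A.
(* The value is looked up in [L]; by [traces_inj] only one entry lies at a given crossing. Elsewhere
   [Virtual] is an arbitrary default. *)
pose val (q : R * R) : crossing_value :=
  if [seq e <- L | (e.1, y e.2.1.1 e.1) == q] is e :: _ then e.2.2 else Virtual.
exists (VirtualBraidDiagram s val); split=> //; split=> /=.
  by apply: traces_ext T => k t t01; rewrite sh.
move=> e eL; rewrite sh; last by apply: crosses_inW (traces_crosses T eL).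
rewrite /val; case E: [seq _ <- _ | _] => [|f l].
  have : e \in [seq f <- L | (f.1, y f.2.1.1 f.1) == (e.1, y e.2.1.1 e.1)].
    by rewrite mem_filter eqxx.
  by rewrite E.
have : f \in [seq f <- L | (f.1, y f.2.1.1 f.1) == (e.1, y e.2.1.1 e.1)].
  by rewrite E mem_head.
rewrite mem_filter => /andP[/eqP[Et Ey] fL].
by rewrite (uniq_map_inj_in T.1 fL eL (traces_inj A T fL eL Et Ey)).
Qed.

Lemma data_exists b : exists2 L, data b L & sorted (fun e f : entry => e.1 <= f.1) L.
Proof.
have [hc h01 he hf hg] := admissible_ht b.
pose A : set entry := [set e | crosses (ht b) e.2.1.1 e.2.1.2 e.1 /\
  e.2.2 = cvalue b (e.1, ht b e.2.1.1 e.1)].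
have fA : finite_set A.
  apply: (@sub_finite_set _ _ ((fun q : R * ('I_n * 'I_n) =>
    (q.1, (q.2, cvalue b (q.1, ht b q.2.1 q.1))) : entry) @`
    (meet_times (ht b) `*` [set: 'I_n * 'I_n]))).
    move=> [t [[i j] v]] [/= c ->]; exists (t, (i, j)) => //; split=> //=.
    split; first exact: crosses_inW c.
    exists i, j; split; last exact: crosses_eq c.
    by apply/eqP => F; rewrite F in c; exact: crosses_irrefl c.
  by apply: finite_image; apply: finite_setX => //; exact: finite_finset.
have [L [uL AL sL]] := finite_set_sort (fun e : entry => e.1) fA.
have LA e : e \in L <-> A e by rewrite AL.
exists L; last exact: sL.
split; last by move=> e /LA[_ ->].
split; last (move=> t i j; split).
- rewrite map_inj_in_uniq // => -[t [[i j] v]] [u [[k l] w]] /LA[/= _ ->] /LA[/= _ ->].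
  by case=> -> -> ->.
- by move=> /mapP[e /LA[c _] [-> E]]; move: c; rewrite -E.
- move=> c; apply/mapP; exists (t, ((i, j), cvalue b (t, ht b i t))) => //.
  by apply/LA.
Qed.

End Topology.

(** * Isotopies *)

Section Isotopies.
Variables (R : realType) (n : nat).
Implicit Types (b : virtual_braid_diagram R n) (y : 'I_n -> R -> R) (i j k : 'I_n).
Implicit Types (e : entry R n) (L : seq (entry R n)).

Lemma addf_continuous (X : topologicalType) (f g : X -> R) :
  continuous f -> continuous g -> continuous (fun x => f x + g x).
Proof. by move=> fc gc x; apply: cvgD; [exact: fc | exact: gc]. Qed.

Lemma subf_continuous (X : topologicalType) (f g : X -> R) :
  continuous f -> continuous g -> continuous (fun x => f x - g x).
Proof. by move=> fc gc x; apply: cvgB; [exact: fc | exact: gc]. Qed.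

Lemma mulf_continuous (X : topologicalType) (f g : X -> R) :
  continuous f -> continuous g -> continuous (fun x => f x * g x).
Proof. by move=> fc gc x; apply: cvgM; [exact: fc | exact: gc]. Qed.

Lemma id_continuous (X : topologicalType) : continuous (@id X).
Proof. by move=> x; exact: cvg_id. Qed.

(** The common construction of isotopies. [isotopic] wants [b0] and [b1] themselves at the ends,
    while the family only knows their heights and crossings; so [H] takes the given records at 0 and
    1 and chosen ones in between. *)
Lemma isotopic_of_family b0 b1 p (y : R -> 'I_n -> R -> R)
    (T : R -> entry R n -> R) L :
  (forall k, continuous (fun st : R * R => y st.1 k st.2)) ->
  (forall s, 0 <= s <= 1 -> admissible p (y s)) ->
  (forall e, e \in L -> continuous (T ^~ e)) ->
  (forall s, 0 <= s <= 1 -> traces (y s) [seq (T s e, e.2) | e <- L]) ->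
  (forall k t, 0 <= t <= 1 -> ht b0 k t = y 0 k t) ->
  (forall k t, 0 <= t <= 1 -> ht b1 k t = y 1 k t) ->
  data b0 [seq (T 0 e, e.2) | e <- L] -> data b1 [seq (T 1 e, e.2) | e <- L] ->
  isotopic b0 b1.
Proof.
move=> yc A Tc Tr h0 h1 d0 d1.
have /choice[H HH] : forall s, exists h : virtual_braid_diagram R n,
    [/\ s = 0 -> h = b0, s = 1 -> h = b1 & 0 <= s <= 1 ->
      (forall k t, 0 <= t <= 1 -> ht h k t = y s k t) /\
      data h [seq (T s e, e.2) | e <- L]].
  move=> s; have [->|s0] := eqVneq s 0.
    by exists b0; split=> // /esym/eqP; rewrite oner_eq0.
  have [->|s1] := eqVneq s 1.
    by exists b1; split=> // /eqP; rewrite oner_eq0.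
  case: (boolP (0 <= s <= 1)) => [s01|_]; last first.
    by exists b0; split=> // /eqP E; rewrite E in s0 s1.
  have [h [_ hy hd]] := diagram_with_data (A s s01) (Tr s s01).
  by exists h; split=> // /eqP; rewrite ?(negbTE s0) ?(negbTE s1).
exists H; split.
- by have [-> //] := HH 0.
- by have [_ -> //] := HH 1.
- move=> k; apply: (@within_eq _ _ _ _ (fun st : R * R => (st.2, y st.1 k st.2))).
    move=> [s t] [/= s01 t01]; rewrite !unitIE in s01 t01.
    have [_ _ /(_ s01)[hy _]] := HH s.
    by rewrite curveE // hy.
  by apply: pair_continuous; [exact: snd_continuous | exact: yc].
pose E (a : 'I_(size L)) := tnth (in_tuple L) a.
have EL a : E a \in L by exact: mem_tnth.
exists (size L), (fun a s => (T s (E a), y s (E a).2.1.1 (T s (E a)))); split.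
- move=> a; apply: continuous_subspaceT; apply: pair_continuous; first exact: Tc.
  apply: (comp_continuous (pair_continuous (@id_continuous R) (Tc _ (EL a)))
    (yc (E a).2.1.1)).
- move=> s; rewrite unitIE => s01; have [_ _ /(_ s01)[hy hd]] := HH s.
  have tr := Tr s s01.
  have cr a : crosses (y s) (E a).2.1.1 (E a).2.1.2 (T s (E a)).
    by apply: (traces_crosses tr (e := (T s (E a), (E a).2))); apply: map_f.
  split.
  + move=> a _ /=; have c := cr a; have t01 := crosses_inW c.
    exists (E a).2.1.1, (E a).2.1.2; split.
    * by apply/eqP => F; rewrite F in c; exact: crosses_irrefl c.
    * by apply/passesE => /=; rewrite hy.
    * by apply/passesE => /=; rewrite hy // (crosses_eq c).
  + move=> a a' _ _ /= [Et Ey].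
    have ma c : (T s (E c), (E c).2) \in [seq (T s e, e.2) | e <- L] by exact: map_f.
    have /= := traces_inj (A s s01) tr (ma a) (ma a') Et Ey.
    have [ut _] := tr.
    have P c : (T s (E c), (E c).2.1) =
        nth (T s (E a), (E a).2.1) (pairs [seq (T s e, e.2) | e <- L]) c.
      rewrite /pairs -map_comp (nth_map (E a)) //= /E (tnth_nth (tnth (in_tuple L) a)).
      by [].
    rewrite (P a) (P a') => /eqP.
    by rewrite nth_uniq ?size_map // => /eqP /val_inj.
  + move=> q [i [j [ij /passesE[q01 qi] /passesE[_ qj]]]].
    have [|e] := traces_meet (A s s01) tr ij q01; first by rewrite -!hy // -qi.
    move=> /mapP[f fL ->] /= [Et Ef].
    have lt : (index f L < size L)%N by rewrite index_mem.
    have Ea : E (Ordinal lt) = f by rewrite /E (tnth_nth f) /= nth_index.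
    exists (Ordinal lt) => //; rewrite Ea Et.
    have cf := cr (Ordinal lt); rewrite Ea Et in cf.
    have -> : y s f.2.1.1 q.1 = q.2.
      rewrite hy // in qi; rewrite hy // in qj.
      by case: Ef => ->.
    by case: (q).
- move=> a s; rewrite unitIE => s01; have [_ _ /(_ s01)[hy [tr vs]]] := HH s.
  have [_ _ []] := HH 0; first by rewrite lexx ler01.
  move=> hy0 [tr0 v0].
  have ma s' : (T s' (E a), (E a).2) \in [seq (T s' e, e.2) | e <- L] by exact: map_f.
  have := vs _ (ma s); have := v0 _ (ma 0) => /=.
  rewrite hy0; last by apply: crosses_inW (traces_crosses tr0 (ma 0)).
  rewrite hy; last by apply: crosses_inW (traces_crosses tr (ma s)).
  by move=> -> ->.
Qed.

Lemma crosses_order y y' i j t :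
  (forall u, 0 <= u <= 1 -> (y i u < y j u) = (y' i u < y' j u) /\
    (y j u < y i u) = (y' j u < y' i u)) ->
  crosses y i j t -> crosses y' i j t.
Proof.
move=> E [l [r [[l0 lt tr r1] [e H1 H2]]]]; exists l, r; split=> //.
split.
- have [|F1 F2] := E t; first by apply/andP; split; lra.
  by apply/eqP; rewrite eq_le !leNgt -F1 -F2 e !ltxx.
- move=> u /andP[lu ut]; have [|F1 <-] := E u; first by apply/andP; split; lra.
  by apply: H1; rewrite lu.
- move=> u /andP[lu ut]; have [|<- F1] := E u; first by apply/andP; split; lra.
  by apply: H2; rewrite lu.
Qed.

Lemma crosses_reparam y (F : R -> R) i j t : continuous F -> increasing F ->
  F 0 = 0 -> F 1 = 1 -> 0 <= t <= 1 ->
  crosses (fun k u => y k (F u)) i j t <-> crosses y i j (F t).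
Proof.
move=> Fc Fi F0 F1 t01; split.
  move=> [l [r [[l0 lt tr r1] [e H1 H2]]]]; exists (F l), (F r).
  rewrite -F0 -F1 !increasing_lt // !increasing_le //; split=> //; split=> //.
  - move=> u /andP[lu ut].
    have [|x x01 xu] := increasing_surj Fc Fi F0 F1 (v := u).
      rewrite -F0 -F1; have : F 0 <= F l by rewrite increasing_le.
      have : F t <= F 1 by rewrite increasing_le //; case/andP: t01.
      by move=> ? ?; apply/andP; split; lra.
    rewrite -xu; apply: H1; rewrite -xu !increasing_lt // in lu ut.
    by rewrite lu.
  - move=> u /andP[lu ut].
    have [|x x01 xu] := increasing_surj Fc Fi F0 F1 (v := u).
      rewrite -F0 -F1; have : F 0 <= F t by rewrite increasing_le //; case/andP: t01.
      have : F r <= F 1 by rewrite increasing_le.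
      by move=> ? ?; apply/andP; split; lra.
    rewrite -xu; apply: H2; rewrite -xu !increasing_lt // in lu ut.
    by rewrite lu.
move=> [l [r [[l0 lt tr r1] [e H1 H2]]]].
have Ft1 : F t <= 1 by rewrite -F1 increasing_le //; case/andP: t01.
have Ft0 : 0 <= F t by rewrite -F0 increasing_le //; case/andP: t01.
have [|x /andP[x0 x1] xl] := increasing_surj Fc Fi F0 F1 (v := l).
  by apply/andP; split; lra.
have [|z /andP[z0 z1] zr] := increasing_surj Fc Fi F0 F1 (v := r).
  by apply/andP; split; lra.
rewrite -xl -zr !increasing_lt // in lt tr H1 H2.
exists x, z; split=> //; split=> //.
- by move=> u /andP[xu ut]; apply: H1; rewrite !increasing_lt // xu.
- by move=> u /andP[xu ut]; apply: H2; rewrite !increasing_lt // xu.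
Qed.

Lemma convex_gt0 (s u v : R) : 0 <= s <= 1 -> 0 < u -> 0 < v ->
  0 < (1 - s) * u + s * v.
Proof.
move=> /andP[s0 s1] u0 v0; move: s0; rewrite le_eqVlt => /predU1P[<-|s0].
  by rewrite subr0 mul1r mul0r addr0.
apply: ltr_wpDl; last exact: mulr_gt0.
by apply: mulr_ge0; [rewrite subr_ge0 | exact: ltW].
Qed.

(** * Isotopies changing the time of the crossings within a set of strands *)

Section Shift.
Variables (b : virtual_braid_diagram R n) (L : seq (entry R n)) (S : pred 'I_n).
Variables (psi : R -> R) (l r : R).
Hypotheses (dL : data b L) (psic : continuous psi) (psii : increasing psi).
Hypotheses (psio : forall t, (t <= l) || (r <= t) -> psi t = t).
Hypotheses (l0 : 0 <= l) (r1 : r <= 1).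
(** The times [t] and [u] are independent because a retimed strand, read at one time of the window,
    faces the other strands read at another one. *)
Hypothesis sep : forall k m, S k -> ~~ S m ->
  (forall t u, l <= t <= r -> l <= u <= r -> ht b k t < ht b m u) \/
  (forall t u, l <= t <= r -> l <= u <= r -> ht b m u < ht b k t).

(** A convex combination of increasing functions is increasing, so [F s] is a legitimate change of
    time at each stage [s]. *)
Let F (s t : R) : R := (1 - s) * t + s * psi t.
Let y (s : R) (k : 'I_n) (t : R) : R := if S k then ht b k (F s t) else ht b k t.

Let F_increasing s : 0 <= s <= 1 -> increasing (F s).
Proof.
move=> s01 u v uv; rewrite -subr_gt0.
have -> : F s v - F s u = (1 - s) * (v - u) + s * (psi v - psi u).
  by rewrite /F; ring.
by apply: convex_gt0; rewrite ?subr_gt0 //; exact: psii.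
Qed.

Let F2_continuous : continuous (fun st : R * R => F st.1 st.2).
Proof.
rewrite /F; apply: addf_continuous.
  apply: mulf_continuous; last exact: snd_continuous.
  by apply: subf_continuous; [move=> x; exact: cvg_cst | exact: fst_continuous].
apply: mulf_continuous; first exact: fst_continuous.
exact: (comp_continuous (@snd_continuous R R) psic).
Qed.

Let F_continuous s : continuous (F s).
Proof.
have c : continuous (fun t : R => (s, t)).
  by apply: pair_continuous; [move=> x; exact: cvg_cst | exact: id_continuous].
exact: (comp_continuous c F2_continuous).
Qed.

Let F_out s t : (t <= l) || (r <= t) -> F s t = t.
Proof. by move=> H; rewrite /F psio //; ring. Qed.

Let F0 s : F s 0 = 0. Proof. by rewrite F_out // l0. Qed.
Let F1 s : F s 1 = 1. Proof. by rewrite F_out // r1 orbT. Qed.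

Let F_in s t : 0 <= s <= 1 -> l <= t <= r -> l <= F s t <= r.
Proof.
move=> s01 /andP[lt tr].
have El : F s l = l by rewrite F_out // lexx.
have Er : F s r = r by rewrite F_out // lexx orbT.
have Fi := F_increasing s01.
by rewrite -[X in X <= _]El -[X in _ && (_ <= X)]Er !(increasing_le _ _ Fi) lt.
Qed.

Let F01 s t : 0 <= s <= 1 -> 0 <= t <= 1 -> 0 <= F s t <= 1.
Proof.
move=> s01 /andP[t0 t1]; have Fi := F_increasing s01.
rewrite -[X in X <= _](F0 s) -[X in _ && (_ <= X)](F1 s).
by rewrite !(increasing_le _ _ Fi) t0.
Qed.

Let mixed_order s k m t : 0 <= s <= 1 -> S k -> ~~ S m ->
  (y s k t < y s m t) = (ht b k t < ht b m t) /\
  (y s m t < y s k t) = (ht b m t < ht b k t).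
Proof.
move=> s01 Sk Sm; rewrite /y Sk (negbTE Sm).
have [out|] := boolP ((t <= l) || (r <= t)); first by rewrite F_out.
rewrite negb_or -!ltNge => /andP[lt tr].
have I : l <= t <= r by rewrite !ltW.
have J := F_in s01 I.
case: (sep Sk Sm) => H; have H1 := H _ _ I I; have H2 := H _ _ J I.
  by rewrite H1 H2 !ltNge (ltW H1) (ltW H2).
by rewrite H1 H2 !ltNge (ltW H1) (ltW H2).
Qed.

Let crosses_y s i j t : 0 <= s <= 1 -> 0 <= t <= 1 ->
  crosses (y s) i j t <->
  crosses (ht b) i j (if S i && S j then F s t else t).
Proof.
move=> s01 t01; case Si: (S i); case Sj: (S j) => /=.
- rewrite -(@crosses_reparam (ht b) (F s) i j t (@F_continuous s) (F_increasing s01) (F0 s) (F1 s) t01).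
  by split; apply: crosses_order => u _; rewrite /y Si Sj.
- split; apply: crosses_order => u _;
    by have [-> ->] := mixed_order u s01 Si (negbT Sj).
- split; apply: crosses_order => u _;
    by have [-> ->] := mixed_order u s01 Sj (negbT Si).
- by split; apply: crosses_order => u _; rewrite /y Si Sj.
Qed.

Let y_admissible s : 0 <= s <= 1 -> admissible (strand_perm b) (y s).
Proof.
move=> s01; have [hc h01 he hf hg] := admissible_ht b; split.
- move=> k; rewrite /y; case: (S k); last exact: hc.
  exact: (comp_continuous (@F_continuous s) (hc k)).
- move=> k t t01; rewrite /y; case: (S k); last exact: h01.
  by apply: h01; exact: F01.
- by move=> k; rewrite /y F0 F1; have [-> ->] := he k; case: (S k).
- have : finite_set (meet_times (ht b) `|` F s @^-1` meet_times (ht b)).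
    rewrite finite_setU; split=> //.
    apply: finite_preimage hf => u v _ _ /eqP.
    by rewrite increasing_eq => [/eqP //|]; exact: F_increasing.
  apply: sub_finite_set => t [t01 [i [j [ij E]]]].
  have [out|ins] := boolP ((t <= l) || (r <= t)).
    left; split=> //; exists i, j; split=> //; move: E; rewrite /y F_out //.
    by do 2 case: ifP.
  move: E; rewrite /y; case Si: (S i); case Sj: (S j) => E.
  + by right; split; [exact: F01 | exists i, j].
  + have [E1 E2] := mixed_order t s01 Si (negbT Sj); left; split=> //.
    exists i, j; split=> //; apply/eqP; rewrite eq_le !leNgt -E1 -E2.
    by rewrite /y Si Sj E ltxx.
  + have [E1 E2] := mixed_order t s01 Sj (negbT Si); left; split=> //.
    exists i, j; split=> //; apply/eqP; rewrite eq_le !leNgt -E1 -E2.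
    by rewrite /y Si Sj E ltxx.
  + by left; split=> //; exists i, j.
- move=> t i j ij t01 E.
  have [out|] := boolP ((t <= l) || (r <= t)).
    have yE k : y s k t = ht b k t by rewrite /y F_out //; case: ifP.
    rewrite !yE in E; have [G1 G2] := hg t i j ij t01 E.
    split; first by move=> k; rewrite !yE; exact: G1.
    rewrite !crosses_y // (andbC (S j)) F_out // !if_same.
    exact: G2.
  rewrite negb_or -!ltNge => /andP[lt tr].
  have I : l <= t <= r by rewrite !ltW.
  have J := F_in s01 I.
  have nomix k m : S k -> ~~ S m -> y s k t <> y s m t.
    move=> Sk Sm; rewrite /y Sk (negbTE Sm) => E'.
    by case: (sep Sk Sm) => H; have := H _ _ J I; rewrite E' ltxx.
  case Si: (S i); case Sj: (S j).
  + have E' := E; rewrite /y Si Sj in E'.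
    have [G1 G2] := hg _ i j ij (F01 s01 t01) E'.
    split; last by rewrite !crosses_y // Si Sj.
    move=> k; case Sk: (S k); first by rewrite /y Sk Si; exact: G1.
    by move=> /esym /nomix; rewrite Si Sk => /(_ isT isT).
  + by have := @nomix i j; rewrite Si Sj => /(_ isT isT).
  + by have := @nomix j i; rewrite Si Sj => /(_ isT isT) /(_ (esym E)).
  + have E' := E; rewrite /y Si Sj in E'.
    have [G1 G2] := hg _ i j ij t01 E'.
    split; last by rewrite !crosses_y // Si Sj.
    move=> k; case Sk: (S k); last by rewrite /y Sk Si; exact: G1.
    by move=> /nomix; rewrite Si Sk => /(_ isT isT).
Qed.

(** At the end of the isotopy the strands of [S] are read at time [psi t], so a crossing between two
    of them at [t] moves to the inverse image [phi t]. All other crossings keep their times, since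
    the order between a strand of [S] and one outside [S] never changes. *)
Lemma shift_isotopy : exists2 phi : R -> R,
  forall t, 0 <= t <= 1 -> 0 <= phi t <= 1 /\ psi (phi t) = t &
  exists2 b', isotopic b b' &
    data b' [seq (if S e.2.1.1 && S e.2.1.2 then phi e.1 else e.1, e.2) | e <- L].
Proof.
have /choice[tau' tauP] : forall st : R * R, exists x : R,
    0 <= st.1 <= 1 -> 0 <= st.2 <= 1 -> 0 <= x <= 1 /\ F st.1 x = st.2.
  move=> [s t] /=; case: (boolP (0 <= s <= 1)) => s01; last by exists 0.
  case: (boolP (0 <= t <= 1)) => t01; last by exists 0.
  have [x x01 xt] := increasing_surj (@F_continuous s) (F_increasing s01) (F0 s) (F1 s) t01.
  by exists x.
(* The inverse of [F s], for [s] in [0,1]; clamping [s] extends it so that continuity in [s] makes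
   sense on the whole line. *)
pose tau s t := tau' (clamp s, t).
have tau_in s t : 0 <= t <= 1 -> 0 <= tau s t <= 1.
  by move=> t01; case: (tauP (clamp s, t)) => //=; exact: clamp01.
have tauE s t : 0 <= s <= 1 -> 0 <= t <= 1 -> F s (tau s t) = t.
  move=> s01 t01; case: (tauP (clamp s, t)) => //=; first exact: clamp01.
  by rewrite /tau (clamp_id s01).
have tau_unique s t u : 0 <= s <= 1 -> 0 <= t <= 1 -> F s u = t -> tau s t = u.
  move=> s01 t01 E; apply/eqP; rewrite -(increasing_eq _ _ (F_increasing s01)).
  by rewrite tauE // E.
(* As [F] increases in time, it is enough that the values of [F (clamp s')] at [tau s t - eps] and
   [tau s t + eps] stay on their sides of [t] for [s'] near [s]. *)
have tau_cont t : 0 <= t <= 1 -> continuous (tau ^~ t).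
  move=> t01 s; apply/cvgrPdist_lt => eps eps0.
  have tE s' : F (clamp s') (tau s' t) = t.
    by case: (tauP (clamp s', t)) => //=; exact: clamp01.
  have Fc z : continuous (fun s' => F (clamp s') z).
    apply: (comp_continuous (pair_continuous (@clamp_continuous R) _) F2_continuous).
    by move=> x; exact: cvg_cst.
  have [|e1 e10 H1] := @continuous_lt R (fun s' => F (clamp s') (tau s t - eps)) s t (Fc _ s).
    rewrite -{2}(tE s); apply: F_increasing; first exact: clamp01.
    by rewrite gtrBl.
  have [|e2 e20 H2] := @continuous_gt R (fun s' => F (clamp s') (tau s t + eps)) s t (Fc _ s).
    rewrite -{1}(tE s); apply: F_increasing; first exact: clamp01.
    by rewrite ltrDl.
  exists (Num.min e1 e2); first by rewrite /= lt_min e10.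
  move=> s' /=; rewrite lt_min ltr_distl => /andP[/andP[a1 a2]].
  rewrite ltr_distl => /andP[a3 a4].
  have {}H1 := H1 s'; have {}H2 := H2 s'.
  have G1 : F (clamp s') (tau s t - eps) < t by apply: H1; apply/andP; split; lra.
  have G2 : t < F (clamp s') (tau s t + eps) by apply: H2; apply/andP; split; lra.
  rewrite -{1}(tE s') increasing_lt in G2; last exact: F_increasing (clamp01 _).
  rewrite -{2}(tE s') increasing_lt in G1; last exact: F_increasing (clamp01 _).
  by rewrite ltr_distl; apply/andP; split; lra.
pose T s (e : entry R n) := if S e.2.1.1 && S e.2.1.2 then tau s e.1 else e.1.
have e01 e : e \in L -> 0 <= e.1 <= 1.
  by move=> eL; apply: crosses_inW (traces_crosses dL.1 eL).
have T01 s e : e \in L -> 0 <= T s e <= 1.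
  by move=> /e01 ?; rewrite /T; case: ifP => // _; exact: tau_in.
have Tr s : 0 <= s <= 1 -> traces (y s) [seq (T s e, e.2) | e <- L].
  move=> s01; split.
    rewrite /pairs -map_comp map_inj_in_uniq; first by apply: map_uniq dL.1.1.
    move=> e f eL fL /= [Et Ep]; apply: (uniq_map_inj_in dL.1.1 eL fL).
    rewrite Ep; congr (_, _); move: Et; rewrite /T Ep.
    case: ifP => // _ Et.
    by rewrite -(tauE s e.1) ?e01 // Et tauE // e01.
  move=> t i j; split.
    move=> /mapP[_ /mapP[e eL ->] /= [-> E]].
    have c := traces_crosses dL.1 eL; rewrite -E /= in c.
    apply/crosses_y => //; first exact: T01.
    rewrite /T -E /=; case: (S i && S j); last exact: c.
    by rewrite tauE ?e01.
  move=> c; have t01 := crosses_inW c; move/(crosses_y _ _ s01 t01): c => c.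
  have /mapP[e eL [Et Ep]] := (dL.1.2 _ _ _).2 c.
  apply/mapP; exists (T s e, e.2); first exact: map_f.
  rewrite /= -Ep /T -Ep /= -Et; congr (_, _); case: (S i && S j) => //.
  by apply/esym/tau_unique => //; exact: F01.
have T1 := Tr 1; have A1 := @y_admissible 1.
rewrite lexx ler01 in T1 A1; have {}T1 := T1 isT; have {}A1 := A1 isT.
have [b' [_ b'y db']] := diagram_with_data A1 T1.
exists (tau 1).
  move=> t t01; split; first exact: tau_in.
  rewrite -[RHS](tauE 1) ?lexx ?ler01 // /F; ring.
exists b'; last exact: db'.
apply: (@isotopic_of_family _ _ (strand_perm b) y T L) => //.
- move=> k; rewrite /y; case Sk: (S k).
    exact: (comp_continuous F2_continuous (@ht_continuous R n b k)).
  exact: (comp_continuous (@snd_continuous R R) (@ht_continuous R n b k)).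
- move=> e eL; rewrite /T; case: (S e.2.1.1 && S e.2.1.2) => /=; last first.
    by move=> x; exact: cvg_cst.
  by apply: tau_cont; exact: e01.
- by move=> k t t01; rewrite /y; case: ifP => // _; rewrite /F; congr (ht b k _); ring.
- have -> // : [seq (T 0 e, e.2) | e <- L] = L.
  rewrite -[RHS]map_id; apply/eq_in_map => e eL.
  have -> : T 0 e = e.1; last by case: (e).
  rewrite /T; case: ifP => // _; apply: tau_unique; rewrite ?lexx ?ler01 ?e01 //.
  by rewrite /F; ring.
Qed.

End Shift.

(** The product of the two height differences starts as a square. Its zeros are crossings of both
    families, in the same direction, so it is nonnegative just after each of them and hence
    everywhere. *)
Lemma same_order p p' y y' L i j t : admissible p y -> admissible p' y' ->
  traces y L -> traces y' L -> 0 <= t <= 1 -> (y i t < y j t) = (y' i t < y' j t).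
Proof.
move=> A A' T T' t01.
have [->|ij] := eqVneq i j; first by rewrite !ltxx.
have E k l u : crosses y k l u <-> crosses y' k l u.
  by rewrite -(T.2 u k l) (T'.2 u k l).
pose P u := (y i u - y j u) * (y' i u - y' j u).
have meet u : 0 <= u <= 1 -> y i u = y j u \/ y' i u = y' j u ->
    [/\ y i u = y j u, y' i u = y' j u & crosses y i j u \/ crosses y j i u].
  have [_ _ _ _ G] := A; have [_ _ _ _ G'] := A'.
  move=> u01 [e|e].
    have [_ [c|c]] := G u i j ij u01 e.
      by split=> //; [apply: crosses_eq; apply/E | left].
    by split=> //; [apply/esym/crosses_eq; apply/E | right].
  have [_ [c|c]] := G' u i j ij u01 e.
    by split=> //; [apply: crosses_eq; apply/E | left; apply/E].
  by split=> //; [apply/esym/crosses_eq; apply/E | right; apply/E].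
have P0 : 0 <= P t.
  apply: ge0_induction t01.
  - have [yc _ _ _ _] := A; have [yc' _ _ _ _] := A'.
    apply: mulf_continuous; apply: subf_continuous => //; by [exact: yc | exact: yc'].
  - have [_ _ ye _ _] := A; have [_ _ ye' _ _] := A'.
    rewrite /P !(ye _).1 !(ye' _).1 -expr2; exact: sqr_ge0.
  - move=> u /andP[u0 u1] /eqP; rewrite mulf_eq0 !subr_eq0 => Hu.
    have [||_ _ C] := meet u; first by rewrite u0 ltW.
      by case/orP: Hu => /eqP; [left | right].
    case: C => c.
      have c' := (E _ _ _).1 c.
      case: c c' => [a [r [[_ _ ur _] [_ _ H]]]] [a' [r' [[_ _ ur' _] [_ _ H']]]].
      exists (Num.min r r'); first by rewrite lt_min ur.
      move=> v /andP[uv]; rewrite lt_min => /andP[vr vr'].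
      have {}H := H v; rewrite uv vr in H; have {}H' := H' v; rewrite uv vr' in H'.
      by apply: mulr_le0; rewrite subr_le0 ltW ?H ?H'.
    have c' := (E _ _ _).1 c.
    case: c c' => [a [r [[_ _ ur _] [_ _ H]]]] [a' [r' [[_ _ ur' _] [_ _ H']]]].
    exists (Num.min r r'); first by rewrite lt_min ur.
    move=> v /andP[uv]; rewrite lt_min => /andP[vr vr'].
    have {}H := H v; rewrite uv vr in H; have {}H' := H' v; rewrite uv vr' in H'.
    by apply: mulr_ge0; rewrite subr_ge0 ltW ?H ?H'.
apply/idP/idP => lt.
  rewrite ltNge; apply/negP; rewrite le_eqVlt => /predU1P[e|lt'].
    by have [|e' _ _] := meet t t01; [right | rewrite e' ltxx in lt].
  by move: P0; rewrite leNgt nmulr_rlt0 ?subr_lt0 // subr_gt0 lt'.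
rewrite ltNge; apply/negP; rewrite le_eqVlt => /predU1P[e|lt'].
  by have [|_ e' _] := meet t t01; [left | rewrite e' ltxx in lt].
by move: P0; rewrite leNgt nmulr_llt0 ?subr_lt0 // subr_gt0 lt'.
Qed.

(** The quotient of [p] and [q] and its inverse preserve the order, and an order-preserving
    permutation of a finite chain lies above the identity. *)
Lemma perm_of_order (p q : 'S_n) :
  (forall i j : 'I_n, (p i < p j)%N = (q i < q j)%N) -> p = q.
Proof.
have le (s : 'S_n) : (forall i j : 'I_n, (i < j)%N -> (s i < s j)%N) -> forall i, (i <= s i)%N.
  move=> H i; case: i => k; elim: k => //= k IH lk.
  have lk' : (k < n)%N by exact: ltnW.
  by apply: leq_ltn_trans (IH lk') _; apply: H.
move=> H; apply/permP => i.
have L1 : forall j, (j <= (p^-1 * q)%g j)%N.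
  by apply: le => a b ab; rewrite !permM -H !permKV.
have L2 : forall j, (j <= (q^-1 * p)%g j)%N.
  by apply: le => a b ab; rewrite !permM H !permKV.
have := L1 (p i); have := L2 (q i); rewrite !permM !permK => a b.
by apply/val_inj/eqP; rewrite eqn_leq b.
Qed.

Lemma height_lt (i j : 'I_n) : (height R i < height R j) = (i < j)%N.
Proof. by rewrite /height ltr_pM2r ?invr_gt0 ?ltr0Sn // ltr_nat. Qed.

Lemma same_perm p p' y y' L : admissible p y -> admissible p' y' ->
  traces y L -> traces y' L -> p = p'.
Proof.
move=> A A' T T'; apply: perm_of_order => i j.
have [_ _ e _ _] := A; have [_ _ e' _ _] := A'.
rewrite -!height_lt -!(e _).2 -!(e' _).2.
by apply: (same_order i j A A' T T'); rewrite lexx ler01.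
Qed.

(* If the strands are in the same order at each time, then so are they during
   the linear homotopy. *)
Lemma linear_isotopy b b' L : data b L -> data b' L -> isotopic b b'.
Proof.
move=> d d'; have A := admissible_ht b; have A' := admissible_ht b'.
have O i j t := same_order i j A A' d.1 d'.1 (t := t).
have Ep := same_perm A A' d.1 d'.1.
pose z (s : R) (k : 'I_n) (t : R) := (1 - s) * ht b k t + s * ht b' k t.
have zO s i j t : 0 <= s <= 1 -> 0 <= t <= 1 ->
    (z s i t < z s j t) = (ht b i t < ht b j t).
  move=> s01 t01.
  have zlt k l : ht b k t < ht b l t -> z s k t < z s l t.
    move=> lt; have lt' : ht b' k t < ht b' l t by rewrite -O.
    rewrite -subr_gt0 -[X in 0 < X]/(_ - _).
    have -> : z s l t - z s k t =
        (1 - s) * (ht b l t - ht b k t) + s * (ht b' l t - ht b' k t).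
      by rewrite /z; ring.
    by apply: convex_gt0; rewrite ?subr_gt0.
  have [/zlt //|/zlt/ltW|E] := ltgtP (ht b i t) (ht b j t).
    by rewrite leNgt => /negbTE.
  have E' : ht b' i t = ht b' j t.
    by apply/eqP; rewrite eq_le !leNgt -!O // E ltxx.
  by rewrite /z E E' ltxx.
have zc s i j t : 0 <= s <= 1 -> crosses (z s) i j t <-> crosses (ht b) i j t.
  by move=> s01; split; apply: crosses_order => u u01; rewrite !zO.
have [hc h01 he hf hg] := A; have [hc' h01' he' _ _] := A'.
have zA s : 0 <= s <= 1 -> admissible (strand_perm b) (z s).
  move=> s01; have zE i j t : 0 <= t <= 1 -> z s i t = z s j t -> ht b i t = ht b j t.
    by move=> t01 E; apply/eqP; rewrite eq_le !leNgt -!(zO s) // E ltxx.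
  have /andP[s0 s1] := s01; have s1' : 0 <= 1 - s by rewrite subr_ge0.
  split.
  - by move=> k; apply: addf_continuous; apply: mulf_continuous => //;
      move=> x; exact: cvg_cst.
  - move=> k t t01; have /andP[a0 a1] := h01 k t t01.
    have /andP[a0' a1'] := h01' k t t01.
    rewrite /z addr_ge0 ?mulr_ge0 //=.
    apply: (@le_trans _ _ ((1 - s) * 1 + s * 1)); last by rewrite !mulr1 subrK.
    by apply: lerD; apply: ler_wpM2l.
  - by move=> k; rewrite /z (he _).1 (he _).2 (he' _).1 (he' _).2 -Ep; split; ring.
  - apply: sub_finite_set hf => t [t01 [i [j [ij E]]]]; split=> //.
    by exists i, j; split=> //; exact: zE E.
  - move=> t i j ij t01 /(zE _ _ _ t01) E; have [G1 G2] := hg t i j ij t01 E.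
    split; first by move=> k /(zE _ _ _ t01); exact: G1.
    by rewrite !zc.
have mapL (f : entry R n -> entry R n) : (forall e, f e = e) -> map f L = L.
  by move=> H; rewrite -[RHS]map_id; apply: eq_map.
apply: (@isotopic_of_family _ _ (strand_perm b) z (fun s e => e.1) L) => //.
- move=> k; apply: addf_continuous; apply: mulf_continuous.
  + by apply: subf_continuous; [move=> x; exact: cvg_cst | exact: fst_continuous].
  + exact: (comp_continuous (@snd_continuous R R) (hc k)).
  + exact: fst_continuous.
  + exact: (comp_continuous (@snd_continuous R R) (hc' k)).
- by move=> e _ x; exact: cvg_cst.
- move=> s s01; rewrite mapL; last by case.
  by split; [exact: d.1.1 | move=> t i j; rewrite zc //; exact: d.1.2].
- by move=> k t _; rewrite /z; ring.
- by move=> k t _; rewrite /z; ring.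
- by rewrite mapL; last by case.
- by rewrite mapL; last by case.
Qed.

(** Retiming gives [b] the crossing times of [b']; the linear homotopy does the rest. *)
Lemma same_labels_isotopic b b' L L' : data b L -> data b' L' ->
  sorted (fun e f : entry R n => e.1 < f.1) L ->
  sorted (fun e f : entry R n => e.1 < f.1) L' ->
  map snd L = map snd L' ->
  exists2 c, isotopic b c & isotopic c b'.
Proof.
move=> d d' sL sL' E.
have sz : size L = size L' by rewrite -(size_map snd) E size_map.
case: (posnP (size L)) => [L0|L0].
  exists b'; last first.
    exact: (linear_isotopy d' d').
  move: L0 sz d d'; case: L {sL E} => // _; case: L' {sL'} => // _ d d'.
  exact: (linear_isotopy d d').
have [e0 _] : exists e0 : entry R n, True by case: (L) L0 => // e; exists e.
pose tm (X : seq (entry R n)) m : R := (nth e0 X m).1.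
have tm_sorted X : sorted (fun e f : entry R n => e.1 < f.1) X ->
    pairwise (fun a c : nat => tm X a < tm X c) (iota 0 (size X)).
  rewrite sorted_pairwise => [sX|]; last by move=> ? ? ?; exact: lt_trans.
  apply/(pairwiseP 0%N) => a c; rewrite !inE size_iota => aX cX ac.
  rewrite !nth_iota // !add0n; exact: (pairwiseP e0 sX).
have tm01 c X m : data c X -> (m < size X)%N -> 0 < tm X m < 1.
  move=> dc mX; apply: crosses_in (traces_crosses dc.1 _).
  exact: mem_nth.
have [|||psi [psic psii psio psiE]] :=
    @increasing_interpolation R _ (tm L') (tm L) (iota 0 (size L)) 0.
- by rewrite sz; exact: tm_sorted.
- exact: tm_sorted.
- move=> m; rewrite mem_iota /= add0n => mL.
  by split; [apply: (tm01 b') => //; rewrite -sz | exact: (tm01 b)].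
(* All strands are retimed together, so the separation hypothesis is vacuous. [psi] sends the times
   of [L'] to those of [L] because crossings move by its inverse. *)
have [phi phiE [c bc dc]] := @shift_isotopy b L predT psi 0 1 d psic psii psio
  (lexx _) (lexx _) (fun k m _ (H : ~~ true) => False_ind _ (elimN idP H isT)).
exists c => //; apply: (linear_isotopy _ d').
suff -> : L' = [seq (if predT e.2.1.1 && predT e.2.1.2 then phi e.1 else e.1, e.2) | e <- L].
  exact: dc.
apply: (@eq_from_nth _ e0); first by rewrite size_map.
move=> m mL'; have mL : (m < size L)%N by rewrite sz.
rewrite (nth_map e0) //=.
have E2 : (nth e0 L m).2 = (nth e0 L' m).2.
  by rewrite -!(nth_map e0 e0.2 snd) ?E.
have <- : (nth e0 L' m).1 = phi (nth e0 L m).1.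
  have [] := phiE (nth e0 L m).1.
    by have /andP[? ?] := tm01 _ _ _ d mL; rewrite !ltW.
  move=> _ F; apply/eqP; rewrite -(increasing_eq _ _ psii) F.
  by apply/eqP; apply: psiE; rewrite mem_iota.
by rewrite E2; case: (nth e0 L' m).
Qed.

End Isotopies.

(** * From diagrams to words *)

Section Words.
Variables (R : realType) (n : nat).
Implicit Types (b : virtual_braid_diagram R n) (i j k m : 'I_n).
Implicit Types (e f : entry R n) (L : seq (entry R n)).

Lemma veq_isotopic b b' : isotopic b b' -> virtually_equivalent b b'.
Proof. by move=> H; apply: rst_step; left. Qed.

Lemma veq_move b b' : diagram_move b b' -> virtually_equivalent b b'.
Proof. by move=> H; apply: rst_step; right. Qed.

Lemma data_perm b L L' : perm_eq L L' -> data b L -> data b L'.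
Proof.
move=> P [[uL HL] vL]; have P' := perm_map (fun e : entry R n => (e.1, e.2.1)) P.
split; last by move=> e; rewrite -(perm_mem P); exact: vL.
split; first by rewrite -(perm_uniq P').
by move=> t i j; rewrite -HL -(perm_mem P').
Qed.

Lemma data_uniq b L : data b L -> uniq L.
Proof. by move=> [[/map_uniq]]. Qed.

Lemma finite_delta (I : finType) (P : I -> R -> Prop) (t : R) :
  (forall a, exists2 d, 0 < d & forall v, t - d < v < t + d -> P a v) ->
  exists2 d, 0 < d & forall a v, t - d < v < t + d -> P a v.
Proof.
move=> H; suff [d d0 Hd] : exists2 d : R, 0 < d & forall a, a \in enum I ->
    forall v, t - d < v < t + d -> P a v.
  by exists d => // a v; apply: Hd; rewrite mem_enum.
elim: (enum I) => [|a s [d d0 Hd]]; first by exists 1.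
have [d' d0' Hd'] := H a.
exists (Num.min d d'); first by rewrite lt_min d0.
have m1 : Num.min d d' <= d by rewrite ge_min lexx.
have m2 : Num.min d d' <= d' by rewrite ge_min lexx orbT.
move=> c; rewrite inE => /predU1P[->|cs] v /andP[v1 v2].
  by apply: Hd'; apply/andP; split; lra.
by apply: Hd => //; apply/andP; split; lra.
Qed.

Lemma crosses_two (y : 'I_n -> R -> R) i j k m (t : R) : crosses y i j t ->
  crosses y k m t -> pred2 i j k -> pred2 i j m -> (k, m) = (i, j).
Proof.
move=> c c' /orP[] /eqP Ek /orP[] /eqP Em; rewrite Ek Em in c' *.
- by case: (crosses_irrefl c').
- by [].
- by case: (crosses_asym c c').
- by case: (crosses_irrefl c').
Qed.

Definition ntimes L := size (undup (map fst L)).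

(** Of two simultaneous crossings [e] and [f], the first is delayed in a window that contains no
    crossing time but [t] and in which its two strands keep away from the others. The time [t]
    survives through [f], so one more distinct time appears. *)
Lemma separate_one b L : data b L -> ~~ uniq (map fst L) ->
  exists b' L', [/\ isotopic b b', data b' L', size L' = size L &
    (ntimes L < ntimes L')%N].
Proof.
move=> d nu.
have [e [f [eL fL ne Et]]] : exists e f, [/\ e \in L, f \in L, e <> f & e.1 = f.1].
  apply: contrapT => H; move/negP: nu; apply; rewrite map_inj_in_uniq ?(data_uniq d) //.
  move=> e f eL fL Et; apply: contrapT => ne; apply: H; by exists e, f.
have c := traces_crosses d.1 eL; have /andP[t0 t1] := crosses_in c.
set t := e.1 in c t0 t1 *; set i := e.2.1.1 in c *; set j := e.2.1.2 in c *.
have E := crosses_eq c.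
have [hc _ _ _ hg] := admissible_ht b.
have ij : i != j by apply/eqP => F; rewrite F in c; exact: crosses_irrefl c.
have [G _] := hg t i j ij (crosses_inW c) E.
(* Near [t] the level [z], halfway between strand [m] and the meeting point, separates [m] from both
   [i] and [j]; a fixed level also compares them at different times. *)
have [d1 d10 H1] : exists2 d : R, 0 < d & forall m v, t - d < v < t + d ->
    m != i -> m != j ->
    (ht b m t < ht b i t -> let z := (ht b m t + ht b i t) / 2 in
      [/\ ht b m v < z, z < ht b i v & z < ht b j v]) /\
    (ht b i t < ht b m t -> let z := (ht b m t + ht b i t) / 2 in
      [/\ z < ht b m v, ht b i v < z & ht b j v < z]).
  apply: finite_delta => m; have [lt|lt|Em] := ltgtP (ht b m t) (ht b i t).
  - pose z := (ht b m t + ht b i t) / 2.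
    have [x1 p1 Hx1] := @continuous_lt R (ht b m) t z (hc m t) ltac:(rewrite /z; lra).
    have [x2 p2 Hx2] := @continuous_gt R (ht b i) t z (hc i t) ltac:(rewrite /z; lra).
    have [x3 p3 Hx3] := @continuous_gt R (ht b j) t z (hc j t) ltac:(rewrite /z -E; lra).
    pose x := Num.min x1 (Num.min x2 x3).
    have [y1 y2 y3] : [/\ x <= x1, x <= x2 & x <= x3].
      by rewrite /x !ge_min !lexx !orbT.
    exists x; first by rewrite !lt_min p1 p2.
    move=> v /andP[v1 v2] _ _; split=> // _ /=; split.
    + by apply: Hx1; apply/andP; split; lra.
    + by apply: Hx2; apply/andP; split; lra.
    + by apply: Hx3; apply/andP; split; lra.
  - pose z := (ht b m t + ht b i t) / 2.
    have [x1 p1 Hx1] := @continuous_gt R (ht b m) t z (hc m t) ltac:(rewrite /z; lra).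
    have [x2 p2 Hx2] := @continuous_lt R (ht b i) t z (hc i t) ltac:(rewrite /z; lra).
    have [x3 p3 Hx3] := @continuous_lt R (ht b j) t z (hc j t) ltac:(rewrite /z -E; lra).
    pose x := Num.min x1 (Num.min x2 x3).
    have [y1 y2 y3] : [/\ x <= x1, x <= x2 & x <= x3].
      by rewrite /x !ge_min !lexx !orbT.
    exists x; first by rewrite !lt_min p1 p2.
    move=> v /andP[v1 v2] _ _; split=> // _ /=; split.
    + by apply: Hx1; apply/andP; split; lra.
    + by apply: Hx2; apply/andP; split; lra.
    + by apply: Hx3; apply/andP; split; lra.
  - by exists 1.
have [d2 d20 H2] : exists2 d : R, 0 < d & forall (a : 'I_(size L)) v,
    t - d < v < t + d -> (nth e L a).1 != t -> (nth e L a).1 != v.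
  apply: finite_delta => a; have [lt|lt|_] := ltgtP (nth e L a).1 t.
  - exists (t - (nth e L a).1); first by rewrite subr_gt0.
    by move=> v /andP[v1 v2] _; apply/eqP; lra.
  - exists ((nth e L a).1 - t); first by rewrite subr_gt0.
    by move=> v /andP[v1 v2] _; apply/eqP; lra.
  - by exists 1.
(* Halving makes all four bounds strict; the last two keep the window inside ]0,1[. The new time [q]
   is the middle of [t] and [r]. *)
pose x := Num.min (Num.min d1 d2) (Num.min t (1 - t)) / 2.
have [x0 x1 x2 x3 x4] : [/\ 0 < x, x < d1, x < d2, x < t & x < 1 - t].
  pose M := Num.min (Num.min d1 d2) (Num.min t (1 - t)).
  have M0 : 0 < M by rewrite !lt_min d10 d20 t0 subr_gt0.
  have [M1 M2 M3 M4] : [/\ M <= d1, M <= d2, M <= t & M <= 1 - t].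
    by rewrite /M !ge_min !lexx !orbT.
  by rewrite /x -/M; split; lra.
pose l := t - x; pose r := t + x; pose q := t + x / 2.
have lq : l < q by rewrite /l /q; lra.
have qr : q < r by rewrite /r /q; lra.
have lt : l < t by rewrite /l; lra.
have tr : t < r by rewrite /r; lra.
pose psi := kink l r q t.
have psii : increasing psi by exact: kink_increasing.
have psio u : (u <= l) || (r <= u) -> psi u = u by exact: kink_out.
have psiq : psi q = t by exact: kink_at.
have noL g : g \in L -> g.1 != t -> (g.1 <= l) || (r <= g.1).
  move=> gL gt; rewrite leNgt (leNgt r) -negb_and; apply/negP => /andP[g1 g2].
  have lt' : (index g L < size L)%N by rewrite index_mem.
  have W : t - d2 < g.1 < t + d2.
    by rewrite /l /r in g1 g2; apply/andP; split; lra.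
  by have := H2 (Ordinal lt') g.1 W; rewrite /= nth_index // eqxx => /(_ gt).
pose S : pred 'I_n := pred2 i j.
have sep k m : S k -> ~~ S m ->
    (forall u v, l <= u <= r -> l <= v <= r -> ht b k u < ht b m v) \/
    (forall u v, l <= u <= r -> l <= v <= r -> ht b m v < ht b k u).
  rewrite /S /= negb_or => Sk /andP[mi mj].
  have I u : l <= u <= r -> t - d1 < u < t + d1.
    by rewrite /l /r => /andP[? ?]; apply/andP; split; lra.
  have [lt'|lt'|Em] := ltgtP (ht b m t) (ht b i t).
  - right=> u v /I Iu /I Iv.
    have [/(_ lt')[a1 a2 a3] _] := H1 m u Iu mi mj.
    have [/(_ lt')[b1 b2 b3] _] := H1 m v Iv mi mj.
    by case/orP: Sk => /eqP ->; [exact: lt_trans b1 a2 | exact: lt_trans b1 a3].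
  - left=> u v /I Iu /I Iv.
    have [_ /(_ lt')[a1 a2 a3]] := H1 m u Iu mi mj.
    have [_ /(_ lt')[b1 b2 b3]] := H1 m v Iv mi mj.
    by case/orP: Sk => /eqP ->; [exact: lt_trans a2 b1 | exact: lt_trans a3 b1].
  - by have := G m Em; case=> F; [rewrite F eqxx in mi | rewrite F eqxx in mj].
have l0 : 0 <= l by rewrite /l; lra.
have r1 : r <= 1 by rewrite /r; lra.
have [phi phiE [b' bb' db']] :=
  @shift_isotopy R n b L S psi l r d (@kink_continuous R l r q t) psii psio l0 r1 sep.
have phi_unique u v : 0 <= u <= 1 -> psi v = u -> phi u = v.
  move=> u01 E'; apply/eqP; rewrite -(increasing_eq _ _ psii) E'.
  by have [_ ->] := phiE u u01.
set L' := map _ L in db'.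
exists b', L'; split=> //; first by rewrite size_map.
have t01 : 0 <= t <= 1 by rewrite !ltW.
have qL' : q \in map fst L'.
  rewrite -map_comp; apply/mapP; exists e => //=.
  by rewrite /S /= !eqxx orbT /= (phi_unique _ q).
have sub u : u \in map fst L -> u \in map fst L'.
  move=> /mapP[g gL ->]; rewrite -map_comp.
  have g01 : 0 <= g.1 <= 1 by apply: crosses_inW (traces_crosses d.1 gL).
  have [gt|gt] := eqVneq g.1 t; last first.
    apply/mapP; exists g => //=; case: ifP => // _.
    by rewrite (phi_unique _ g.1) // psio ?noL.
  (* [f] keeps its time: if both of its strands were those of [e], it would be the same crossing. *)
  apply/mapP; exists f => //=; rewrite -Et -/t gt ifF //.
  apply/negP => /andP[Sf1 Sf2]; apply: ne.
  have cf := traces_crosses d.1 fL; rewrite -Et -/t in cf.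
  apply: (uniq_map_inj_in d.1.1 eL fL); rewrite Et; congr (_, _).
  apply/esym; have /= := crosses_two c cf Sf1 Sf2; rewrite /i /j.
  by case: (e.2.1) (f.2.1) => ? ? [? ?].
have qL : q \notin map fst L.
  apply/mapP => -[g gL Eq].
  have gt : g.1 != t by rewrite -Eq /q; apply/eqP; lra.
  by have := noL g gL gt; rewrite -Eq leNgt lq leNgt qr.
rewrite /ntimes; apply: (@uniq_leq_size _ (q :: undup (map fst L))).
  by rewrite /= mem_undup qL undup_uniq.
move=> u; rewrite inE mem_undup => /predU1P[->|]; rewrite mem_undup //.
exact: sub.
Qed.

Lemma separate_times b : exists b' L', [/\ virtually_equivalent b b', data b' L' &
  sorted (fun e f : entry R n => e.1 < f.1) L'].
Proof.
have [L d _] := data_exists b.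
have [N] := ubnP (size L - ntimes L); elim: N => // N IH in b L d * => lt.
have [u|nu] := boolP (uniq (map fst L)).
  pose le (e f : entry R n) := e.1 <= f.1.
  exists b, (sort le L); split; first exact: rst_refl.
    by apply: data_perm d; rewrite perm_sym perm_sort.
  apply: sorted_lt_of_le.
  - by rewrite sort_uniq (data_uniq d).
  - by move=> e f; rewrite !mem_sort; exact: uniq_map_inj_in.
  - by apply: sort_sorted => e f; exact: le_total.
have [b1 [L1 [bb1 d1 s1 lt1]]] := separate_one d nu.
have le1 : (ntimes L1 <= size L1)%N.
  by rewrite /ntimes (leq_trans (size_undup _)) // size_map.
have [|b2 [L2 [b12 d2 sL2]]] := IH b1 L1 d1; first by rewrite s1 in le1 *; lia.
exists b2, L2; split=> //; apply: rst_trans b12; exact: veq_isotopic.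
Qed.

Lemma no_meet_order (y : 'I_n -> R -> R) k m (a c : R) :
  continuous (y k) -> continuous (y m) -> a <= c ->
  (forall u, a <= u <= c -> y k u <> y m u) -> (y k a < y m a) = (y k c < y m c).
Proof.
move=> yk ym ac H.
have K k' m' (a' c' : R) : continuous (y k') -> continuous (y m') -> a' <= c' ->
    (forall u, a' <= u <= c' -> y k' u <> y m' u) -> y k' a' < y m' a' ->
    y k' c' < y m' c'.
  move=> yk' ym' ac' H' lt; rewrite ltNge; apply/negP => le.
  have dc : continuous (fun u : R => y k' u - y m' u) by exact: subf_continuous.
  have [|x x01 /eqP] := IVT_zero dc ac'.
    by apply: mulr_le0_ge0; rewrite ?subr_ge0 // subr_le0 ltW.
  by rewrite subr_eq0 => /eqP; exact: H'.
apply/idP/idP; first exact: K.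
move=> lt; rewrite ltNge; apply/negP; rewrite le_eqVlt => /predU1P[E|lt'].
  by apply: (H a); rewrite ?lexx.
have : y m c < y k c by apply: (K m k a c) => // u /H; apply: nesym.
by rewrite ltNge (ltW lt).
Qed.

Lemma adj_swap (p : 'S_n) i j : p i = (p j).+1 :> nat ->
  (adj n (p j) (p i) < adj n (p j) (p j))%N.
Proof. by move=> pi; have := ltn_ord (p i); rewrite pi => lt; adj_lia. Qed.

Lemma adj_order (p : 'S_n) i j k m : p i = (p j).+1 :> nat ->
  (k, m) <> (i, j) -> (k, m) <> (j, i) ->
  (adj n (p j) (p k) < adj n (p j) (p m))%N = (p k < p m)%N.
Proof.
move=> pi n1 n2; have := ltn_ord (p i); rewrite pi => lt.
have P (a : 'I_n) c : p a = c :> nat -> forall a' : 'I_n, p a' = c :> nat -> a' = a.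
  by move=> <- a' /val_inj/perm_inj.
have Pi := P _ _ pi; have Pj := P j _ erefl.
have N1 : ~ (p k = (p j).+1 :> nat /\ p m = p j :> nat).
  by case=> /Pi Ek /Pj Em; apply: n1; rewrite Ek Em.
have N2 : ~ (p k = p j :> nat /\ p m = (p j).+1 :> nat).
  by case=> /Pj Ek /Pi Em; apply: n2; rewrite Ek Em.
clear P Pi Pj n1 n2 pi.
adj_lia.
Qed.

Lemma adj_below (p : 'S_n) i j k c : p i = (p j).+1 :> nat -> (p i < c)%N ->
  (adj n (p j) (p k) < c)%N = (p k < c)%N.
Proof. by move=> pi; have := ltn_ord (p i); rewrite pi => lt pc; adj_lia. Qed.

Lemma card_below (s : 'S_n) (q : nat) : (q <= n)%N ->
  #|[set k : 'I_n | (s k < q)%N]%SET| = q.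
Proof.
move=> qn; have -> : [set k : 'I_n | (s k < q)%N]%SET =
    [set (s^-1)%g (widen_ord qn m) | m : 'I_q]%SET.
  apply/setP => k; rewrite inE; apply/idP/imsetP => [lt|[m _ ->]].
    exists (Ordinal lt) => //; apply: (@perm_inj _ s); rewrite permKV.
    exact/val_inj.
  by rewrite permKV /=.
rewrite card_imset ?card_ord // => a c /perm_inj E.
by apply/val_inj; have := congr1 val E.
Qed.

Definition below b (A : {set 'I_n}) e : nat :=
  #|[set k in A | ht b k e.1 < ht b e.2.1.1 e.1]%SET|.

Definition letter_at b (A : {set 'I_n}) e : letter := (e.2.2, below b A e).

(* Between the times t and t', the strands of A meet only at the crossings
   listed in L, and p gives their order at time t. *)
Lemma word_of_strands b (A : {set 'I_n}) L (t t' : R) (c : nat) (p : 'S_n) :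
  sorted (fun e f : entry R n => e.1 < f.1) L -> 0 <= t -> t <= t' -> t' <= 1 ->
  (forall e, e \in L -> [/\ e.2.1.1 \in A, e.2.1.2 \in A,
     crosses (ht b) e.2.1.1 e.2.1.2 e.1 & t < e.1 < t']) ->
  (forall k m u, k \in A -> m \in A -> k != m -> t <= u <= t' ->
     ht b k u = ht b m u ->
     exists2 e, e \in L & e.1 = u /\ (e.2.1 = (k, m) \/ e.2.1 = (m, k))) ->
  (forall k, (k \in A) = (p k < c)%N) ->
  {in A &, forall k m, (ht b k t < ht b m t) = (p k < p m)%N} ->
  let w := map (letter_at b A) L in
  [/\ valid n w, map snd L = strand_word p w &
    {in A &, forall k m, (ht b k t' < ht b m t') =
      ((p * state n w)%g k < (p * state n w)%g m)%N}].
Proof.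
have [hc _ _ _ _] := admissible_ht b.
elim: L t p => [|e L IH] t p sL t0 tt' t1 HL HC HA O.
  split=> // k m kA mA; rewrite state_nil mulg1 -O //.
  have [->|km] := eqVneq k m; first by rewrite !ltxx.
  apply/esym/no_meet_order; try exact: hc; first by [].
  by move=> u tu E; have [] := HC k m u kA mA km tu E.
have [iA jA cr /andP[te et']] := HL e (mem_head _ _).
(* A time after the first crossing and before the next, from which the induction resumes with two
   positions exchanged. *)
have [s [es st' Hs]] : exists s : R, [/\ e.1 < s, s <= t' &
    forall f, f \in L -> s < f.1].
  case: L sL HL {IH HC} => [|g L] sL HL; first by exists t'.
  have [_ _ _ /andP[_ g1]] : [/\ g.2.1.1 \in A, g.2.1.2 \in A,
     crosses (ht b) g.2.1.1 g.2.1.2 g.1 & t < g.1 < t'].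
    by apply: HL; rewrite !inE eqxx orbT.
  have /andP[eg sg] := sL.
  exists ((e.1 + g.1) / 2); split; [lra | lra |].
  move=> f; rewrite inE => /predU1P[->|fL]; first lra.
  have /allP/(_ f fL) : all (fun f : entry R n => g.1 < f.1) L.
    by apply: order_path_min sg => ? ? ?; exact: lt_trans.
  by move=> ?; lra.
case: e iA jA cr te et' es sL HL HC => te [[i j] v] /= iA jA cr tte tet' es sL HL HC.
have ij : i != j by apply/eqP => F; rewrite F in cr; exact: crosses_irrefl cr.
have no k m u : k \in A -> m \in A -> k != m -> t <= u <= s ->
    ht b k u = ht b m u -> u = te /\ ((k, m) = (i, j) \/ (k, m) = (j, i)).
  move=> kA mA km /andP[tu us] E.
  have [|f fL [Ef Em]] := HC k m u kA mA km _ E.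
    by rewrite tu (le_trans us).
  move: fL; rewrite inE => /predU1P[F|/Hs]; last by rewrite Ef ltNge us.
  split; first by rewrite -Ef F.
  by rewrite F /= in Em; case: Em => -[-> ->]; [left | right].
have O1 k m u : k \in A -> m \in A -> (k, m) <> (i, j) -> (k, m) <> (j, i) ->
    t <= u <= s -> (ht b k u < ht b m u) = (p k < p m)%N.
  move=> kA mA n1 n2 /andP[tu us]; have [->|km] := eqVneq k m.
    by rewrite ltxx ltnn.
  rewrite -O //; apply/esym/no_meet_order => // x /andP[tx xu] E.
  have tx' : t <= x <= s by rewrite tx (le_trans xu).
  by case: (no k m x kA mA km tx' E) => _ [].
have pji : (p j < p i)%N.
  case: cr => l [r [[l0 lte ter r1] [E Hl Hr]]].
  pose u := (Num.max l t + te) / 2.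
  have m1 : Num.max l t < te by rewrite gt_max lte.
  have m2 : l <= Num.max l t by rewrite le_max lexx.
  have m3 : t <= Num.max l t by rewrite le_max lexx orbT.
  have lu : ht b j u < ht b i u by apply: Hl; rewrite /u; apply/andP; split; lra.
  rewrite -O // (@no_meet_order _ _ _ t u) //; first by rewrite /u; lra.
  move=> x /andP[tx xu] F.
  have xte : x < te by rewrite /u in xu; lra.
  have tx' : t <= x <= s by rewrite tx (le_trans (ltW xte)) // ltW.
  have ji : j != i by rewrite eq_sym.
  by have [Ex _] := no j i x jA iA ji tx' F; move: xte; rewrite Ex ltxx.
have Oij : ht b i s < ht b j s.
  case: cr => l [r [[l0 lte ter r1] [E Hl Hr]]].
  pose u := (Num.min r s + te) / 2.
  have m1 : te < Num.min r s by rewrite lt_min ter.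
  have m2 : Num.min r s <= r by rewrite ge_min lexx.
  have m3 : Num.min r s <= s by rewrite ge_min lexx orbT.
  have lu : ht b i u < ht b j u by apply: Hr; rewrite /u; apply/andP; split; lra.
  rewrite -(@no_meet_order _ _ _ u s) //; first by rewrite /u; lra.
  move=> x /andP[ux xs] F.
  have tex : te < x by rewrite /u in ux; lra.
  have tx' : t <= x <= s by rewrite xs andbT ltW // (lt_trans tte).
  by have [Ex _] := no i j x iA jA ij tx' F; move: tex; rewrite Ex ltxx.
have ttes : t <= te <= s by rewrite !ltW.
have pic : (p i < c)%N by rewrite -HA.
(* A strand in an intermediate position would be strictly between [j] and [i] at the very time when
   they meet. *)
have pi : p i = (p j).+1 :> nat.
  apply/eqP; rewrite eqn_leq pji andbT leqNgt; apply/negP => lt.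
  have ltn : ((p j).+1 < n)%N by apply: ltn_trans lt _.
  pose k := (p^-1)%g (Ordinal ltn).
  have pk : p k = (p j).+1 :> nat by rewrite permKV.
  have kA : k \in A by rewrite HA pk (ltn_trans lt).
  have ki : k <> i by move=> F; move: lt; rewrite -pk F ltnn.
  have kj : k <> j by move=> F; move: pk; rewrite F => /n_Sn.
  have L1 : ht b j te < ht b k te.
    rewrite O1 ?pk // => F; first exact: (kj (congr1 snd F)).
    exact: (ki (congr1 snd F)).
  have L2 : ht b k te < ht b i te.
    rewrite O1 ?pk // => F; first exact: (ki (congr1 fst F)).
    exact: (kj (congr1 fst F)).
  by have := lt_trans L1 L2; rewrite (crosses_eq cr) ltxx.
have pn : ((p j).+1 < n)%N by rewrite -pi.
(* Since [A] occupies the positions below [c], its strands under the crossing are exactly those in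
   the positions below [p j]. *)
have Ebelow : below b A (te, (i, j, v)) = p j.
  rewrite -[RHS](@card_below p); last by rewrite ltnW.
  congr #|pred_of_set _|; apply/setP => k; rewrite !inE /= HA.
  have [->|ki] := eqVneq k i; first by rewrite ltxx andbF ltnNge (ltnW pji).
  have [->|kj] := eqVneq k j.
    by rewrite ltnn (crosses_eq cr) ltxx andbF.
  have [kc|ck] := ltnP (p k) c; last first.
    by apply/esym/negbTE; rewrite -leqNgt (leq_trans _ ck) // (leq_trans (ltnW pji)) // ltnW.
  rewrite (crosses_eq cr) O1 ?HA //= ?(ltn_trans pji) //.
    by move=> F; move/eqP: ki; apply; exact: (congr1 fst F).
  by move=> F; move/eqP: kj; apply; exact: (congr1 fst F).
have [||||||||vw Ew Ow] := IH s (p * adj n (p j))%g.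
- exact: path_sorted sL.
- by rewrite (le_trans t0) // (le_trans (ltW tte)) // ltW.
- by [].
- by [].
- move=> f fL; have [f1 f2 f3 /andP[_ f4]] := HL f (mem_behead (s := _ :: _) fL).
  by split=> //; rewrite Hs.
- move=> k m u kA mA km /andP[su ut'] E.
  have [|f fL Ef] := HC k m u kA mA km _ E.
    by rewrite ut' andbT (le_trans _ su) // (le_trans (ltW tte)) // ltW.
  move: fL; rewrite inE => /predU1P[F|fL]; last by exists f.
  by move: Ef su; rewrite F /= => -[<- _]; rewrite leNgt es.
- move=> k; rewrite HA permM; apply/esym; exact: adj_below pi pic.
- move=> k m kA mA; rewrite !permM.
  have I' : t <= s <= s by rewrite lexx andbT ltW // (lt_trans tte).
  have [[Ek Em]|n1] := pselect ((k, m) = (i, j)).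
    by rewrite Ek Em Oij (adj_swap pi).
  have [[Ek Em]|n2] := pselect ((k, m) = (j, i)).
    by rewrite Ek Em ltNge (ltW Oij) ltnNge ltnW // (adj_swap pi).
  by rewrite O1 // (adj_order pi).
rewrite /= /letter_at Ebelow /=; split.
- by rewrite /valid /= pn.
- by rewrite Ew (crossing_atE _ pi erefl).
- by move=> k m kA mA; rewrite Ow // state_cons mulgA.
Qed.

Lemma word_of_data b L : data b L ->
  sorted (fun e f : entry R n => e.1 < f.1) L ->
  exists w, [/\ valid n w, map snd L = strand_word 1 w & state n w = strand_perm b].
Proof.
move=> d sL; have [_ _ he _ _] := admissible_ht b.
have [|||||||vw Ew Ow] := @word_of_strands b [set: 'I_n] L 0 1 n 1 sL.
- by [].
- exact: ler01.
- by [].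
- move=> e eL; have c := traces_crosses d.1 eL.
  by rewrite !finset.inE; split=> //; exact: crosses_in c.
- by move=> k m u _ _ km u01; exact: traces_meet (admissible_ht b) d.1 km u01.
- by move=> k; rewrite finset.inE perm1 ltn_ord.
- by move=> k m _ _; rewrite !(he _).1 height_lt !perm1.
exists (map (letter_at b [set: 'I_n]) L); split=> //.
apply: perm_of_order => i j.
by have := Ow i j; rewrite !finset.inE !(he _).2 height_lt mul1g => ->.
Qed.

End Words.

(** * From words to diagrams *)

Lemma adj_spec n (p : 'S_n) (x : letter) :
  (crossing_at p x = [::] /\ (p * adj n x.2)%g = p) \/
  exists a b : 'I_n, [/\ p a = x.2.+1 :> nat, p b = x.2 :> nat,
    crossing_at p x = [:: ((a, b), x.1)],
    ((p * adj n x.2)%g a = x.2 :> nat /\ (p * adj n x.2)%g b = x.2.+1 :> nat) &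
    forall k, k <> a -> k <> b -> (p * adj n x.2)%g k = p k].
Proof.
have [lt|ge] := ltnP x.2.+1 n; last first.
  by left; rewrite crossing_at_out // adj_out // mulg1.
right; case: x lt => v q /= lt.
have [a [b [pa pb E]]] := crossing_at_valid p v lt.
exists a, b; split=> //; first by rewrite !permM; adj_lia.
move=> k ka kb; apply/val_inj; rewrite /= permM adjE //.
case: eqP => [F|_]; first by case: kb; apply/(@perm_inj _ p)/val_inj; rewrite /= F.
by case: eqP => [F|//]; case: ka; apply/(@perm_inj _ p)/val_inj; rewrite /= F.
Qed.

Section Realization.
Variables (R : realType) (n : nat).
Implicit Types (b : virtual_braid_diagram R n) (i j k : 'I_n).
Implicit Types (e f : entry R n) (L : seq (entry R n)) (w : seq letter).

(** A sum of clamped ramps interpolates [f] linearly between integers: earlier ramps have reached 1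
    and telescope, later ones are still 0. *)
Lemma ramp_sum (f : nat -> R) (N r : nat) (x : R) : (r < N)%N ->
  r%:R <= x <= r.+1%:R ->
  f 0%N + \sum_(m < N) (f m.+1 - f m) * clamp (x - m%:R) =
  f r + (x - r%:R) * (f r.+1 - f r).
Proof.
move=> rN /andP[rx xr].
rewrite -(big_mkord xpredT (fun m => (f m.+1 - f m) * clamp (x - m%:R))).
rewrite (big_cat_nat (n := r)) //=; last exact: ltnW.
rewrite (big_ltn rN) /=.
have -> : \sum_(0 <= m < r) (f m.+1 - f m) * clamp (x - m%:R) = f r - f 0%N.
  rewrite -(telescope_sumr f (leq0n r)) !big_nat; apply: eq_bigr => m /andP[_ mr].
  have H : m.+1%:R <= r%:R :> R by rewrite ler_nat.
  rewrite /clamp (min_idPr _) ?(max_idPr _) ?ler01 ?mulr1 //.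
  by rewrite -natr1 in H; lra.
have -> : \sum_(r.+1 <= m < N) (f m.+1 - f m) * clamp (x - m%:R) = 0.
  rewrite big_nat big1 // => m /andP[rm _].
  have H : r.+1%:R <= m%:R :> R by rewrite ler_nat.
  by rewrite /clamp (max_idPl _) ?mulr0 // ge_min subr_le0 (le_trans xr H).
have -> : clamp (x - r%:R) = x - r%:R.
  by apply: clamp_id; rewrite -natr1 in xr; apply/andP; split; lra.
ring.
Qed.

Definition stage w r : 'S_n := state n (take r w).

(** Polygonal strands, with vertices at the multiples of [1 / size w]. A single sum of ramps,
    instead of a definition by pieces, makes continuity immediate. *)
Definition pl_height w k (t : R) : R :=
  height R k + \sum_(m < size w)
    (height R (stage w m.+1 k) - height R (stage w m k)) *
    clamp ((size w)%:R * t - m%:R).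

Definition in_piece w (r : nat) (t : R) : Prop :=
  (r < size w)%N /\ r%:R <= (size w)%:R * t <= r.+1%:R.

Lemma pl_heightE w r k t : in_piece w r t ->
  pl_height w k t = height R (stage w r k) +
    ((size w)%:R * t - r%:R) * (height R (stage w r.+1 k) - height R (stage w r k)).
Proof.
move=> [rN tr]; rewrite -(ramp_sum (fun m => height R (stage w m k)) rN tr).
by rewrite /pl_height /stage take0 state_nil perm1.
Qed.

Lemma in_pieceW w r t : in_piece w r t -> 0 <= (size w)%:R * t - r%:R <= 1.
Proof. by move=> [_ /andP[? H]]; rewrite -natr1 in H; apply/andP; split; lra. Qed.

Lemma piece_exists w t : (0 < size w)%N -> 0 <= t <= 1 -> exists r, in_piece w r t.
Proof.
move=> w0 /andP[t0 t1].
have x0 : 0 <= (size w)%:R * t by apply: mulr_ge0; rewrite ?ler0n.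
have x1 : (size w)%:R * t <= (size w)%:R by rewrite -[leRHS]mulr1 ler_wpM2l ?ler0n.
have aux N (x : R) : (0 < N)%N -> 0 <= x -> x <= N%:R ->
    exists r, (r < N)%N /\ r%:R <= x <= r.+1%:R.
  elim: N => // N IH _ y0 y1; have [N0|N0] := posnP N.
    by exists 0%N; rewrite N0 in y1 *; rewrite y0.
  have [xN|Nx] := leP x N%:R.
    by have [r [rN H]] := IH N0 y0 xN; exists r; split=> //; exact: ltnW.
  by exists N; rewrite ltnSn (ltW Nx).
exact: aux w0 x0 x1.
Qed.

Lemma height_in k : 0 < height R k < 1.
Proof.
rewrite /height divr_gt0 ?ltr0Sn //= ltr_pdivrMr ?ltr0Sn // mul1r ltr_nat ltnS.
exact: ltn_ord.
Qed.

Lemma convex_bounds (lo hi u v x : R) : 0 <= x <= 1 -> lo <= u <= hi ->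
  lo <= v <= hi -> lo <= u + x * (v - u) <= hi.
Proof.
move=> /andP[x0 x1] /andP[u0 u1] /andP[v0 v1].
have E : u + x * (v - u) = (1 - x) * u + x * v by ring.
have El : lo = (1 - x) * lo + x * lo by ring.
have Eh : hi = (1 - x) * hi + x * hi by ring.
have x1' : 0 <= 1 - x by rewrite subr_ge0.
by rewrite E; apply/andP; split; [rewrite El | rewrite Eh]; rewrite lerD // ler_wpM2l.
Qed.

Lemma convex_lt (u v u' v' x : R) : 0 <= x <= 1 -> u < u' -> v < v' ->
  u + x * (v - u) < u' + x * (v' - u').
Proof.
move=> x01 uu vv; rewrite -subr_gt0.
have -> : u' + x * (v' - u') - (u + x * (v - u)) = (1 - x) * (u' - u) + x * (v' - v).
  by ring.
by apply: convex_gt0; rewrite ?subr_gt0.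
Qed.

Lemma pl_height_in w k t : (0 < size w)%N -> 0 <= t <= 1 ->
  0 < pl_height w k t < 1.
Proof.
move=> w0 t01; have [r pr] := piece_exists w0 t01.
rewrite (pl_heightE _ pr); have x01 := in_pieceW pr.
have /andP[a0 a1] := height_in (stage w r k).
have /andP[c0 c1] := height_in (stage w r.+1 k).
have := convex_lt x01 a0 c0; have := convex_lt x01 a1 c1.
by rewrite !subrr !mulr0 !addr0 => -> ->.
Qed.

Lemma stageS x0 w r : (r < size w)%N ->
  stage w r.+1 = (stage w r * adj n (nth x0 w r).2)%g.
Proof. by move=> rw; rewrite /stage (take_nth x0) // -cats1 state_cat state1. Qed.

Lemma pl_height0 w k : pl_height w k 0 = height R k.
Proof.
rewrite /pl_height big1 ?addr0 // => m _; rewrite mulr0 sub0r /clamp.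
by rewrite (max_idPl _) ?mulr0 // ge_min oppr_le0 ler0n.
Qed.

Lemma pl_height1 w k : (0 < size w)%N -> pl_height w k 1 = height R (state n w k).
Proof.
move=> w0; have p : in_piece w (size w).-1 1.
  by split; rewrite ?prednK // mulr1 ler_nat leq_pred lexx.
rewrite (pl_heightE _ p) prednK // mulr1.
have -> : (size w)%:R - (size w).-1%:R = 1 :> R.
  by rewrite -{1}(prednK w0) -natr1 addrC addKr.
by rewrite mul1r addrC subrK /stage take_size.
Qed.

Lemma sumf_continuous (X : topologicalType) (I : Type) (s : seq I) (F : I -> X -> R) :
  (forall a, continuous (F a)) -> continuous (fun x => \sum_(a <- s) F a x).
Proof.
move=> Fc; elim: s => [|a s IH].
  have -> : (fun x => \sum_(a <- [::]) F a x) = fun=> 0.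
    by apply/funext => x; rewrite big_nil.
  by move=> x; exact: cvg_cst.
have -> : (fun x => \sum_(c <- a :: s) F c x) =
    (fun x => F a x + \sum_(c <- s) F c x).
  by apply/funext => x; rewrite big_cons.
exact: addf_continuous.
Qed.

Lemma pl_height_continuous w k : continuous (pl_height w k).
Proof.
apply: addf_continuous; first by move=> x; exact: cvg_cst.
apply: sumf_continuous => m.
apply: mulf_continuous; first by move=> ?; exact: cvg_cst.
apply: comp_continuous (@clamp_continuous R).
apply: subf_continuous; last by move=> ?; exact: cvg_cst.
by apply: mulf_continuous; [move=> ?; exact: cvg_cst | exact: id_continuous].
Qed.

(** Two strands exchanging their heights linearly meet halfway through the piece, hence [2^-1]. *)
Definition midtime (N r : nat) : R := (r%:R + 2^-1) / N%:R.

Fixpoint entries (N r : nat) (p : 'S_n) w : seq (entry R n) :=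
  if w is x :: w' then
    [seq (midtime N r, c) | c <- crossing_at p x] ++
    entries N r.+1 (p * adj n x.2)%g w'
  else [::].

Lemma entries_cat N r p w w' : entries N r p (w ++ w') =
  entries N r p w ++ entries N (r + size w) (p * state n w)%g w'.
Proof.
elim: w r p => [|x w IH] r p; first by rewrite addn0 state_nil mulg1.
by rewrite /= IH -catA state_cons mulgA addSnnS.
Qed.

Lemma entries_labels N r p w : map snd (entries N r p w) = strand_word p w.
Proof.
elim: w r p => //= x w IH r p; rewrite map_cat IH -map_comp; congr (_ ++ _).
by rewrite -[RHS]map_id; apply: eq_map.
Qed.

Lemma entriesP x0 N r p w e : e \in entries N r p w <->
  exists m, [/\ (m < size w)%N, e.1 = midtime N (r + m) &
    e.2 \in crossing_at (p * state n (take m w))%g (nth x0 w m)].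
Proof.
elim: w r p => [|x w IH] r p /=; first by split=> // -[m []].
rewrite mem_cat; split.
  move=> /orP[/mapP[c cx ->]|/IH[m [mw E C]]].
    by exists 0%N; rewrite addn0 /= state_nil mulg1.
  by exists m.+1; rewrite /= state_cons mulgA -addSnnS.
move=> [[|m] [mw E C]]; apply/orP.
  left; rewrite /= state_nil mulg1 in C; rewrite addn0 in E.
  by apply/mapP; exists e.2 => //; rewrite -E; case: (e).
by right; apply/IH; exists m; rewrite addSnnS -mulgA -state_cons.
Qed.

Lemma midtime_lt N r r' : (0 < N)%N -> (midtime N r < midtime N r') = (r < r')%N.
Proof.
by move=> N0; rewrite /midtime ltr_pM2r ?invr_gt0 ?ltr0n // ltrD2r ltr_nat.
Qed.

Lemma midtimeE N r : (0 < N)%N -> N%:R * midtime N r = r%:R + 2^-1.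
Proof. by move=> N0; rewrite /midtime mulrC mulfVK // pnatr_eq0 -lt0n. Qed.

Lemma entries_sorted N r p w : (0 < N)%N ->
  sorted (fun e f : entry R n => e.1 < f.1) (entries N r p w).
Proof.
move=> N0; rewrite sorted_pairwise => [|? ? ?]; last exact: lt_trans.
elim: w r p => //= x w IH r p; rewrite pairwise_cat IH andbT.
apply/andP; split.
  apply/allrelP => e f /mapP[c _ ->] /(entriesP x)[m [_ -> _]] /=.
  by rewrite midtime_lt // ltnS leq_addr.
by case: (adj_spec p x) => [[-> _] //|[a [c [_ _ -> _ _]]]].
Qed.

Lemma piece_mid w r : (r < size w)%N -> in_piece w r (midtime (size w) r).
Proof.
move=> rw; split=> //; rewrite midtimeE; last exact: leq_ltn_trans rw.
by rewrite -(natr1 r); apply/andP; split; lra.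
Qed.

Lemma pl_order w r i j t : in_piece w r t ->
  (stage w r i < stage w r j)%N -> (stage w r.+1 i < stage w r.+1 j)%N ->
  pl_height w i t < pl_height w j t.
Proof.
move=> pr; rewrite -!(height_lt R) => lt1 lt2.
by rewrite !(pl_heightE _ pr); apply: convex_lt => //; exact: in_pieceW pr.
Qed.

(** Heights are affine on a piece, so strands in the same order at both of its ends do not meet.
    Only the pair exchanged by the letter does, and by symmetry at the middle time. *)
Lemma pl_meet x0 w r i j t : in_piece w r t -> i != j ->
  pl_height w i t = pl_height w j t ->
  exists a c, [/\ (i, j) = (a, c) \/ (i, j) = (c, a),
    crossing_at (stage w r) (nth x0 w r) = [:: ((a, c), (nth x0 w r).1)] &
    t = midtime (size w) r].
Proof.
move=> pr ij E; have [rw tr] := pr.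
have w0 : (0 < size w)%N by exact: leq_ltn_trans rw.
have SE := stageS x0 rw.
have nopres : ((stage w r i < stage w r j) != (stage w r.+1 i < stage w r.+1 j))%N.
  apply/negP => /eqP F.
  have [lt|lt|F'] := ltngtP (stage w r i) (stage w r j).
  - by have := pl_order pr lt; rewrite -F lt E ltxx => /(_ isT).
  - have nlt : (stage w r.+1 j < stage w r.+1 i)%N.
      rewrite ltnNge leq_eqVlt -F (ltnNge (stage w r i)) (ltnW lt) orbF.
      by apply/negP => /eqP/val_inj/perm_inj/eqP; rewrite (negbTE ij).
    by have := pl_order pr lt nlt; rewrite E ltxx.
  - by move/val_inj/perm_inj/eqP: F'; rewrite (negbTE ij).
case: (adj_spec (stage w r) (nth x0 w r)) => [[_ F]|[a [c [pa pc C [qa qc] q]]]].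
  by rewrite SE F eqxx in nopres.
have ac : (stage w r a = (stage w r c).+1 :> nat) by rewrite pa pc.
have pair : (i, j) = (a, c) \/ (i, j) = (c, a).
  apply: contrapT => /not_orP[n1 n2].
  move/negP: nopres; apply; rewrite SE !permM -pc (adj_order ac) //.
exists a, c; split=> //.
have {E}E : pl_height w a t = pl_height w c t by case: pair => -[<- <-].
rewrite -SE in qa qc.
have Ec : stage w r.+1 a = stage w r c by apply/val_inj; rewrite /= qa pc.
have Ea : stage w r.+1 c = stage w r a by apply/val_inj; rewrite /= qc pa.
move: E; rewrite !(pl_heightE _ pr) Ec Ea => E.
have hac : height R (stage w r c) < height R (stage w r a).
  by rewrite height_lt pa pc.
have /eqP : (height R (stage w r a) - height R (stage w r c)) *
    (1 - 2 * ((size w)%:R * t - r%:R)) = 0 by lra.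
rewrite mulf_eq0 subr_eq0 (gt_eqF hac) /= => /eqP F.
have N0 : (size w)%:R != 0 :> R by rewrite pnatr_eq0 -lt0n.
by apply: (mulfI N0); rewrite midtimeE //; lra.
Qed.

Lemma pl_crosses x0 w r a c : (r < size w)%N ->
  crossing_at (stage w r) (nth x0 w r) = [:: ((a, c), (nth x0 w r).1)] ->
  crosses (pl_height w) a c (midtime (size w) r).
Proof.
move=> rw C; have w0 : (0 < size w)%N by exact: leq_ltn_trans rw.
have N0 : 0 < (size w)%:R :> R by rewrite ltr0n.
have SE := stageS x0 rw.
case: (adj_spec (stage w r) (nth x0 w r)) => [[F _]|[a' [c' [pa pc C' [qa qc] q]]]].
  by rewrite F in C.
move: C; rewrite C' => -[Ea' Ec']; rewrite Ea' Ec' in pa pc qa qc.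
rewrite -SE in qa qc.
have Ec : stage w r.+1 a = stage w r c by apply/val_inj; rewrite /= qa pc.
have Ea : stage w r.+1 c = stage w r a by apply/val_inj; rewrite /= qc pa.
have hac : height R (stage w r c) < height R (stage w r a).
  by rewrite height_lt pa pc.
have D u : in_piece w r u -> pl_height w a u - pl_height w c u =
    (1 - 2 * ((size w)%:R * u - r%:R)) *
    (height R (stage w r a) - height R (stage w r c)).
  by move=> pu; rewrite !(pl_heightE _ pu) Ec Ea; ring.
have hac' : 0 < height R (stage w r a) - height R (stage w r c) by rewrite subr_gt0.
have mE := midtimeE r w0.
have wE (x : R) : (size w)%:R * (x / (size w)%:R) = x.
  by rewrite mulrC mulfVK // gt_eqF.
exists (r%:R / (size w)%:R), (r.+1%:R / (size w)%:R); split.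
  split.
  - by rewrite divr_ge0 ?ler0n.
  - by rewrite -(ltr_pM2l N0) mE wE; lra.
  - by rewrite -(ltr_pM2l N0) mE wE -(natr1 r); lra.
  - by rewrite ler_pdivrMr // mul1r ler_nat.
split.
- apply/eqP; rewrite -subr_eq0 D; last exact: piece_mid.
  by rewrite mE mulf_eq0; apply/orP; left; apply/eqP; lra.
- move=> u /andP[u1 u2].
  rewrite -(ltr_pM2l N0) wE in u1; rewrite -(ltr_pM2l N0) mE in u2.
  rewrite -subr_gt0 D; last by split=> //; rewrite -(natr1 r); apply/andP; split; lra.
  by apply: mulr_gt0 => //; lra.
- move=> u /andP[u1 u2].
  rewrite -(ltr_pM2l N0) mE in u1; rewrite -(ltr_pM2l N0) wE -(natr1 r) in u2.
  rewrite -subr_gt0 -opprB oppr_gt0 D; last by split=> //; rewrite -(natr1 r); apply/andP; split; lra.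
  by rewrite pmulr_llt0 //; lra.
Qed.

Definition word_entries w := entries (size w) 0 1 w.

Lemma word_entriesP x0 w e : e \in word_entries w <->
  exists m, [/\ (m < size w)%N, e.1 = midtime (size w) m &
    e.2 \in crossing_at (stage w m) (nth x0 w m)].
Proof.
rewrite /word_entries (entriesP x0); split=> -[m [mw E C]]; exists m; split=> //.
  by rewrite /stage -(mul1g (state n _)).
by rewrite mul1g.
Qed.

Lemma pl_traces w : (0 < size w)%N -> traces (pl_height w) (word_entries w).
Proof.
move=> w0; have [x0 _] : exists x0 : letter, True by case: (w) w0 => // x; exists x.
split.
  apply: (@map_uniq _ _ fst); rewrite -map_comp.
  apply: (@sorted_uniq _ (fun x y : R => x < y)).
  - by move=> ? ? ?; exact: lt_trans.
  - by move=> ?; exact: ltxx.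
  - by rewrite sorted_map; exact: entries_sorted.
move=> t i j; split.
  move=> /mapP[e /(word_entriesP x0)[m [mw E C]] [-> Ep]].
  case: (adj_spec (stage w m) (nth x0 w m)) => [[F _]|[a [c [_ _ F _ _]]]].
    by rewrite F in C.
  move: C; rewrite F inE => /eqP C; move: Ep; rewrite C /= E => -[-> ->].
  exact: pl_crosses F.
move=> c; have t01 := crosses_inW c.
have [r pr] := piece_exists w0 t01.
have ij : i != j by apply/eqP => F; rewrite F in c; exact: crosses_irrefl c.
have [a [d [P C Et]]] := pl_meet x0 pr ij (crosses_eq c).
have c' := pl_crosses pr.1 C; rewrite -Et in c'.
case: P c => -[-> ->] c; last by case: (crosses_asym c c').
apply/mapP; exists (t, ((a, d), (nth x0 w r).1)) => //.
by apply/(word_entriesP x0); exists r; split=> //; rewrite ?C ?inE //; case: pr.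
Qed.

Lemma pl_admissible w : (0 < size w)%N -> admissible (state n w) (pl_height w).
Proof.
move=> w0; have [x0 _] : exists x0 : letter, True by case: (w) w0 => // x; exists x.
split.
- exact: pl_height_continuous.
- by move=> k t t01; have /andP[? ?] := pl_height_in k w0 t01; rewrite !ltW.
- by move=> k; rewrite pl_height0 pl_height1.
- apply: (@sub_finite_set _ _ ((fun r : 'I_(size w) => midtime (size w) r) @` setT)).
    move=> t [t01 [i [j [ij E]]]]; have [r pr] := piece_exists w0 t01.
    have [a [c [_ _ ->]]] := pl_meet x0 pr ij E.
    by exists (Ordinal pr.1).
  by apply: finite_image; exact: finite_finset.
- move=> t i j ij t01 E; have [r pr] := piece_exists w0 t01.
  have [a [c [P C Et]]] := pl_meet x0 pr ij E; split.
    move=> k Ek; have [->|ki] := eqVneq k i; first by left.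
    have [a' [c' [P' C' _]]] := pl_meet x0 pr ki Ek.
    right; move: C'; rewrite C => -[Ea Ec]; subst a' c'.
    case: P P' => -[Ei Ej] [] [Ek' Ei'] => //.
    + by rewrite Ek' Ei eqxx in ki.
    + by rewrite Ek' Ej.
    + by rewrite Ek' Ej.
    + by rewrite Ek' Ei eqxx in ki.
  have c' := pl_crosses pr.1 C; rewrite -Et in c'.
  by case: P => -[-> ->]; [left | right].
Qed.

(** The empty word is excluded because it gives no subdivision of time; an idle letter is appended
    where it could occur. *)
Definition realizes b w : Prop :=
  [/\ (0 < size w)%N, strand_perm b = state n w,
      forall k t, 0 <= t <= 1 -> ht b k t = pl_height w k t &
      data b (word_entries w)].

Lemma realizes_exists w : (0 < size w)%N -> exists b, realizes b w.
Proof.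
move=> w0; have [b [p h d]] := diagram_with_data (pl_admissible w0) (pl_traces w0).
by exists b.
Qed.

Lemma realizes_labels b b' w w' : realizes b w -> realizes b' w' ->
  @strand_word n 1 w = strand_word 1 w' -> virtually_equivalent b b'.
Proof.
move=> [w0 _ _ d] [w0' _ _ d'] E.
have sl := entries_sorted 0 1 w w0; have sl' := entries_sorted 0 1 w' w0'.
have [|c bc cb'] := same_labels_isotopic d d' sl sl'; first by rewrite !entries_labels.
by apply: rst_trans (veq_isotopic bc) (veq_isotopic cb').
Qed.

End Realization.

(** * Moves realized by diagrams *)

Section Moves.
Variables (R : realType) (n : nat).
Implicit Types (b : virtual_braid_diagram R n) (i j k : 'I_n).
Implicit Types (e f : entry R n) (L : seq (entry R n)) (w u : seq letter).

Lemma entries_bounds N r (p : 'S_n) w e : (0 < N)%N -> e \in entries R N r p w ->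
  r%:R / N%:R < e.1 < (r + size w)%:R / N%:R.
Proof.
move=> N0 ew; have [x0 _] : exists x0 : letter, True by exists (tau 0).
have [m [mw -> _]] := (entriesP x0 N r p w e).1 ew.
have N0' : 0 < N%:R^-1 :> R by rewrite invr_gt0 ltr0n.
rewrite /midtime !ltr_pM2r //.
have H : m.+1%:R <= (size w)%:R :> R by rewrite ler_nat.
rewrite -(natr1 m) in H; rewrite !natrD.
have m0 : 0 <= m%:R :> R by rewrite ler0n.
by apply/andP; split; lra.
Qed.

Lemma stage_cat w1 w r : (r <= size w)%N ->
  stage n (w1 ++ w) (size w1 + r) = (state n w1 * state n (take r w))%g.
Proof. by move=> _; rewrite /stage takeD take_size_cat // drop_size_cat // state_cat. Qed.

Lemma ltr_divN (N : nat) (x y : R) : (0 < N)%N ->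
  (x < y / N%:R) = (N%:R * x < y).
Proof. by move=> N0; rewrite ltr_pdivlMr ?ltr0n // mulrC. Qed.

Lemma ltr_divNl (N : nat) (x y : R) : (0 < N)%N ->
  (y / N%:R < x) = (y < N%:R * x).
Proof. by move=> N0; rewrite ltr_pdivrMr ?ltr0n // mulrC. Qed.

Lemma window_bounds w a (k : 'I_n) (lo hi t : R) : (a.+1 < size w)%N ->
  a%:R / (size w)%:R <= t <= a.+2%:R / (size w)%:R ->
  (forall m, (a <= m <= a.+2)%N -> lo <= height R (stage n w m k) <= hi) ->
  lo <= pl_height w k t <= hi.
Proof.
move=> aw /andP[t1 t2] H.
have w0 : (0 < size w)%N by exact: leq_ltn_trans aw.
rewrite leNgt ltr_divN // -leNgt in t1; rewrite leNgt ltr_divNl // -leNgt in t2.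
have K m : in_piece w m t -> (a <= m <= a.+1)%N -> lo <= pl_height w k t <= hi.
  move=> pm ma; rewrite (pl_heightE _ pm); apply: convex_bounds.
  - exact: in_pieceW pm.
  - by apply: H; lia.
  - by apply: H; lia.
have [le|lt] := leP ((size w)%:R * t) a.+1%:R.
  apply: (K a); last by lia.
  by split; [exact: ltnW | rewrite t1].
apply: (K a.+1); last by lia.
by split=> //; rewrite (ltW lt).
Qed.

Lemma crossing_at_far (p : 'S_n) x y : far x y -> valid n [:: x; y] ->
  crossing_at (p * adj n x.2)%g y = crossing_at p y.
Proof.
case: x y => v q [v' q']; rewrite /far /valid /= andbT => f /andP[lt lt'].
have [a [c [pa pc ->]]] := crossing_at_valid p v' lt'.
by apply: crossing_atE; rewrite permM; move: pa pc; clear v v'; adj_lia.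
Qed.

Lemma height_ge0 k : 0 <= height R k.
Proof. by rewrite ltW //; case/andP: (height_in R k). Qed.

Lemma height_le1 k : height R k <= 1.
Proof. by rewrite ltW //; case/andP: (height_in R k). Qed.

Lemma height_ltn (q : nat) k : (k < q)%N -> height R k <= q%:R / n.+1%:R.
Proof. by move=> qk; rewrite /height ler_pM2r ?invr_gt0 ?ltr0Sn // ler_nat. Qed.

Lemma height_le (q : nat) k : (q <= k)%N -> q.+1%:R / n.+1%:R <= height R k.
Proof. by move=> qk; rewrite /height ler_pM2r ?invr_gt0 ?ltr0Sn // ler_nat. Qed.

Lemma height_ge (q : nat) k : (k <= q)%N -> height R k <= q.+1%:R / n.+1%:R.
Proof. by move=> qk; rewrite /height ler_pM2r ?invr_gt0 ?ltr0Sn // ler_nat. Qed.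

Lemma stages_far (p p1 p2 : 'S_n) x y k : far x y -> valid n [:: x; y] ->
  p1 = (p * adj n x.2)%g -> p2 = (p1 * adj n y.2)%g ->
  ((p k = x.2 :> nat \/ p k = x.2.+1 :> nat) ->
     (x.2 <= p k <= x.2.+1 /\ x.2 <= p1 k <= x.2.+1 /\ x.2 <= p2 k <= x.2.+1)%N) /\
  ((p k <> x.2 :> nat /\ p k <> x.2.+1 :> nat) ->
     (p k < x.2 /\ p1 k < x.2 /\ p2 k < x.2)%N \/
     (x.2.+1 < p k /\ x.2.+1 < p1 k /\ x.2.+1 < p2 k)%N).
Proof.
case: x y => v q [v' q']; rewrite /far /valid /= andbT => f /andP[lt lt'] -> ->.
rewrite !permM; clear v v'; split; adj_lia.
Qed.

Lemma leq_window a m : (a <= m <= a.+2)%N -> m = a \/ m = a.+1 \/ m = a.+2.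
Proof. by lia. Qed.

Lemma far_neq x y : far x y -> y.2.+1 = x.2 \/ y.2.+1 = x.2.+1 -> False.
Proof. by rewrite /far; lia. Qed.

(** Far commutation is no move in a disc but an isotopy: the two strands of [x] are retimed until
    their crossing comes after that of [y]. *)
Lemma far_swap b b' w1 w2 x y : far x y -> valid n [:: x; y] ->
  realizes b (w1 ++ [:: x; y] ++ w2) -> realizes b' (w1 ++ [:: y; x] ++ w2) ->
  virtually_equivalent b b'.
Proof.
move=> fxy vxy; set w := w1 ++ _; set w' := w1 ++ _.
move=> [w0 _ h d] [w0' _ _ d'].
have fyx : far y x by move: fxy; rewrite /far orbC.
have vyx : valid n [:: y; x] by move: vxy; rewrite /valid /= !andbT andbC.
have [vx vy] : (x.2.+1 < n)%N /\ (y.2.+1 < n)%N.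
  by move: vxy; rewrite /valid /= andbT => /andP.
set N := size w in d *; pose a := size w1; pose p := state n w1.
have aN : (a.+2 <= N)%N by rewrite /N /w !size_cat /=; lia.
have [s1 [s2 [ps1 ps2 Cx]]] := crossing_at_valid p x.1 vx.
have [u1 [u2 [pu1 pu2 Cy]]] := crossing_at_valid p y.1 vy.
rewrite -surjective_pairing in Cx; rewrite -surjective_pairing in Cy.
set cx := ((s1, s2), x.1) in Cx; set cy := ((u1, u2), y.1) in Cy.
pose A := @entries R n N 0 1 w1.
pose C := entries R N a.+2 (p * adj n x.2 * adj n y.2)%g w2.
have EL : word_entries R n w = A ++ [:: (midtime R N a, cx); (midtime R N a.+1, cy)] ++ C.
  rewrite /word_entries -/N /w entries_cat add0n mul1g -/a -/p -/A /=; congr (_ ++ _).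
  by rewrite Cx /= crossing_at_far // Cy.
have N0' : 0 < N%:R :> R by rewrite ltr0n.
pose l : R := a%:R / N%:R; pose r : R := a.+2%:R / N%:R.
(* In units of [1 / N] the crossing of [y] is at [a + 3/2] and the window ends at [a + 2]; the value
   7/4 lies strictly between, so [x] passes behind [y]. *)
pose q : R := (a%:R + 7 / 4) / N%:R.
have mE m := @midtimeE R N m w0.
have lq : l < q by rewrite /l /q ltr_pM2r ?invr_gt0 //; lra.
have qr : q < r.
  by rewrite /r /q ltr_pM2r ?invr_gt0 // -(natr1 a.+1) -(natr1 a); lra.
have lm : l < midtime R N a by rewrite /l ltr_divNl // mE; lra.
have mr : midtime R N a < r.
  by rewrite /r ltr_divN // mE -(natr1 a.+1) -(natr1 a); lra.
have mq : midtime R N a.+1 < q.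
  by rewrite /q ltr_divN // mE -(natr1 a); lra.
have lm1 : l < midtime R N a.+1.
  by rewrite /l ltr_divNl // mE -(natr1 a); lra.
pose psi := kink l r q (midtime R N a).
have psii : increasing psi by exact: kink_increasing.
have psio t : (t <= l) || (r <= t) -> psi t = t by exact: kink_out.
have psiq : psi q = midtime R N a by exact: kink_at.
have l0 : 0 <= l by rewrite divr_ge0 ?ler0n.
have r1 : r <= 1 by rewrite /r ler_pdivrMr // mul1r ler_nat.
pose S : pred 'I_n := pred2 s1 s2.
have st0 : stage n w a = p by rewrite /stage take_size_cat.
have st1 : stage n w a.+1 = (p * adj n x.2)%g.
  by rewrite -addn1 stage_cat //= ?take0 state1.
have st2 : stage n w a.+2 = (p * adj n x.2 * adj n y.2)%g.
  by rewrite -addn2 stage_cat //= ?take0 !state_cons state_nil mulg1 mulgA.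
have win (k : 'I_n) lo hi : (forall m, (a <= m <= a.+2)%N ->
    lo <= height R (stage n w m k) <= hi) ->
    forall t, l <= t <= r -> lo <= ht b k t <= hi.
  move=> H t lt; rewrite h; last first.
    by case/andP: lt => ? ?; rewrite (le_trans l0) // (le_trans _ r1).
  exact: window_bounds lt H.
have stg (P : 'I_n -> Prop) k : P (p k) -> P ((p * adj n x.2)%g k) ->
    P ((p * adj n x.2 * adj n y.2)%g k) ->
    forall m, (a <= m <= a.+2)%N -> P (stage n w m k).
  by move=> P0 P1 P2 m /leq_window [->|[->|->]]; rewrite ?st0 ?st1 ?st2.
pose hN (m : nat) : R := m.+1%:R / n.+1%:R.
have hN_lt m m' : (m < m')%N -> hN m < hN m'.
  by move=> mm; rewrite /hN ltr_pM2r ?invr_gt0 ?ltr0Sn // ltr_nat.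
have SP k : S k -> p k = x.2 :> nat \/ p k = x.2.+1 :> nat.
  by case/orP => /eqP ->; [right | left].
have SN k : ~~ S k -> p k <> x.2 :> nat /\ p k <> x.2.+1 :> nat.
  rewrite /S /= negb_or => /andP[k1 k2]; split=> E.
    by rewrite -ps2 in E; move/val_inj/perm_inj: E k2 => ->; rewrite eqxx.
  by rewrite -ps1 in E; move/val_inj/perm_inj: E k1 => ->; rewrite eqxx.
(* Throughout the window the strands of [x] stay within the heights of positions [x.2] and [x.2.+1],
   and every other strand stays below or above this band, as [y] acts on other positions. *)
have sep k m : S k -> ~~ S m ->
    (forall t u : R, l <= t <= r -> l <= u <= r -> ht b k t < ht b m u) \/
    (forall t u : R, l <= t <= r -> l <= u <= r -> ht b m u < ht b k t).
  move=> Sk Sm.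
  have [Fk _] := stages_far k fxy vxy (erefl (p * adj n x.2)%g) (erefl _).
  have [/andP[a1 a2] [/andP[b1 b2] /andP[c1 c2]]] := Fk (SP k Sk).
  have Bk : forall t, l <= t <= r -> hN x.2 <= ht b k t <= hN x.2.+1.
    apply: win; apply: (stg (fun z => hN x.2 <= height R z <= hN x.2.+1));
      by rewrite height_le ?height_ge.
  have [_ Fm] := stages_far m fxy vxy (erefl (p * adj n x.2)%g) (erefl _).
  case: (Fm (SN m Sm)) => -[m0 [m1 m2]].
    right=> t u /Bk/andP[B1 _] It.
    have Bm : forall t, l <= t <= r -> 0 <= ht b m t <= x.2%:R / n.+1%:R.
      by apply: win; apply: (stg (fun z => 0 <= height R z <= x.2%:R / n.+1%:R));
        rewrite height_ge0 height_ltn.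
    have /andP[_ B2] := Bm u It.
    apply: le_lt_trans B2 (lt_le_trans _ B1).
    by rewrite /hN ltr_pM2r ?invr_gt0 ?ltr0Sn // ltr_nat.
  left=> t u /Bk/andP[_ B1] It.
  have Bm : forall t, l <= t <= r -> hN x.2.+2 <= ht b m t <= 1.
    by apply: win; apply: (stg (fun z => hN x.2.+2 <= height R z <= 1));
      rewrite height_le // height_le1.
  have /andP[B2 _] := Bm u It.
  by apply: le_lt_trans B1 (lt_le_trans _ B2); exact: hN_lt.
have [phi phiE [c bc dc]] := @shift_isotopy R n b _ S psi l r d
  (@kink_continuous R l r q (midtime R N a)) psii psio l0 r1 sep.
have phi_unique t v : 0 <= t <= 1 -> psi v = t -> phi t = v.
  move=> t01 E'; apply/eqP; rewrite -(increasing_eq _ _ psii) E'.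
  by have [_ ->] := phiE t t01.
have Abound e : e \in A -> 0 < e.1 < l.
  by move=> /(entries_bounds w0); rewrite mul0r add0n.
have Cbound e : e \in C -> r < e.1 < 1.
  move=> /(entries_bounds w0)/andP[-> /= lt]; apply: (lt_le_trans lt).
  by rewrite ler_pdivrMr // mul1r ler_nat /N /w !size_cat /= addnA addn2.
pose L2 := A ++ [:: (q, cx); (midtime R N a.+1, cy)] ++ C.
have E2 : [seq (if S e.2.1.1 && S e.2.1.2 then phi e.1 else e.1, e.2)
    | e <- word_entries R n w] = L2.
  rewrite EL /L2 !map_cat /=; congr (_ ++ _ :: _ :: _).
  - rewrite -[RHS]map_id; apply/eq_in_map => e /Abound/andP[e1 e2].
    rewrite (phi_unique e.1 e.1); first by case: ifP; case: (e).
      by rewrite ltW // (le_trans (ltW e2)) // (le_trans _ r1) // ltW // (lt_trans lq).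
    by rewrite psio // ltW.
  - rewrite /S /= !eqxx orbT /= (phi_unique _ q) //.
    by rewrite (le_trans l0 (ltW lm)) (le_trans (ltW mr) r1).
  - case: ifP => // /andP[Su1 _].
    by have := SP _ Su1; rewrite pu1 => /(far_neq fxy).
  - rewrite -[RHS]map_id; apply/eq_in_map => e /Cbound/andP[e1 e2].
    rewrite (phi_unique e.1 e.1); first by case: ifP; case: (e).
      by rewrite (ltW e2) andbT ltW // (lt_trans _ e1) // (le_lt_trans l0) // (lt_trans lq).
    by rewrite psio // (ltW e1) orbT.
rewrite E2 in dc.
pose L3 := A ++ [:: (midtime R N a.+1, cy); (q, cx)] ++ C.
have d3 : data c L3.
  apply: data_perm dc; rewrite /L2 /L3 perm_cat2l.
  apply/permPl; exact: (perm_catCA [:: (q, cx)] [:: (midtime R N a.+1, cy)] C).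
have lt_tr : transitive (fun e f : entry R n => e.1 < f.1).
  by move=> ? ? ?; exact: lt_trans.
have s3 : sorted (fun e f : entry R n => e.1 < f.1) L3.
  rewrite sorted_pairwise // /L3 !pairwise_cat /= mq !andbT.
  rewrite -!sorted_pairwise // !entries_sorted // !andbT.
  apply/andP; split.
    apply/allrelP => e f /Abound/andP[_ e2]; rewrite !inE.
    case/or3P => [/eqP ->|/eqP ->|/Cbound/andP[f1 _]] /=.
    - exact: lt_trans lm1.
    - exact: lt_trans lq.
    - by apply: lt_trans (lt_trans e2 (lt_trans lq qr)) f1.
  apply/allrelP => e f; rewrite !inE => ef /Cbound/andP[f1 _].
  apply: lt_trans f1; apply: le_lt_trans qr.
  by case/orP: ef => /eqP -> /=; rewrite ?lexx // ltW.
have [|z cz zb'] := same_labels_isotopic d3 d' s3 (entries_sorted R 0 1 w' w0').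
  rewrite /L3 /A /C map_cat /= /word_entries !entries_labels.
  rewrite /w' strand_word_cat /= mul1g -/p Cy /= (crossing_at_far _ fyx vyx) Cx /=.
  congr (_ ++ [:: _, _ & strand_word _ _]); rewrite -!mulgA; congr (_ * _)%g.
  by have := weq_state (weq_far fxy vxy); rewrite !state_cons state_nil !mulg1.
apply: (rst_trans _ _ _ _ _ (veq_isotopic bc)).
exact: (rst_trans _ _ _ _ _ (veq_isotopic cz) (veq_isotopic zb')).
Qed.

End Moves.

(** * Local moves realized inside vertical strips *)

Section LocalMoves.
Variables (R : realType) (n : nat).
Implicit Types (b : virtual_braid_diagram R n) (i j k : 'I_n).
Implicit Types (e f : entry R n) (L : seq (entry R n)) (w u : seq letter).

Lemma within_cst (A : set R) (c : R) : {within A, continuous (fun _ : R => c)}.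
Proof. by apply: continuous_subspaceT => x; exact: cvg_cst. Qed.

(** With the full height as disc, every strand of a polygonal diagram goes through it, so positions
    counted in the disc are positions in the diagram. *)
Definition strip (l r : R) (H : [/\ 0 <= l, l < r & r <= 1]) : disc R :=
  Disc H (@within_cst _ 0) (@within_cst _ 1)
    (fun t _ => And3 (lexx 0) ltr01 (lexx 1)).

Lemma stripE l r (H : [/\ 0 <= l, l < r & r <= 1]) (b : strand_diagram R n) k t :
  0 <= t <= 1 -> disc_set (strip H) (curve b k t) <-> l <= t <= r.
Proof.
move=> t01; rewrite curveE // /disc_set /=; split=> [[]|] //.
by have [_ h01 _ _ _] := admissible_ht b; split=> //; exact: h01.
Qed.

Lemma entry_of_crossing b L (p : R * R) : data b L -> crossings b p ->
  exists2 e, e \in L & p = (e.1, ht b e.2.1.1 e.1).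
Proof.
move=> d [i [j [ij /passesE[p01 pi] /passesE[_ pj]]]].
have [|e eL [E1 E2]] := traces_meet (admissible_ht b) d.1 ij p01; first by rewrite -pi.
exists e => //; rewrite E1; case: p pi pj {p01} E1 => t z /= pi pj E1.
by case: E2 => ->; rewrite /= -?pi -?pj.
Qed.

Lemma crossing_of_entry b L e : data b L -> e \in L ->
  crossings b (e.1, ht b e.2.1.1 e.1).
Proof.
move=> d eL; have c := traces_crosses d.1 eL; have t01 := crosses_inW c.
exists e.2.1.1, e.2.1.2; split.
- by apply/eqP => F; rewrite F in c; exact: crosses_irrefl c.
- exact/passesE.
- by apply/passesE => /=; rewrite (crosses_eq c).
Qed.

Lemma position_entry b w x0 (V : disc R) m c : realizes b w -> (m < size w)%N ->
  c \in crossing_at (stage n w m) (nth x0 w m) ->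
  (forall k, disc_set V (curve b k (midtime R (size w) m))) ->
  position b V (midtime R (size w) m, ht b c.1.1 (midtime R (size w) m)) =
  (nth x0 w m).2.
Proof.
move=> [w0 _ h d] mw.
case: (adj_spec (stage n w m) (nth x0 w m)) => [[-> //]|[s1 [s2 [p1 p2 C [q1 q2] q]]]].
have := stageS n x0 mw => SE; rewrite -SE in q1 q2 q.
rewrite C inE => /eqP -> /= HV.
have C' : crossing_at (stage n w m) (nth x0 w m) = [:: ((s1, s2), (nth x0 w m).1)].
  by rewrite C; case: (nth x0 w m).
set t := midtime R (size w) m in HV *.
have cr := pl_crosses R mw C'; rewrite -/t in cr.
have t01 := crosses_inW cr.
have pm := piece_mid R mw; rewrite -/t in pm.
rewrite /position -[RHS](@card_below n (stage n w m)); last first.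
  by rewrite -p2 ltnW.
congr #|pred_of_set _|; apply/setP => k; rewrite !inE.
have -> : (stage n w m k < (nth x0 w m).2)%N = (ht b k t < ht b s1 t).
  rewrite !h //; have [->|k1] := eqVneq k s1; first by rewrite ltxx p1 ltnNge leqnSn.
  have [->|k2] := eqVneq k s2.
    by rewrite p2 ltnn (crosses_eq cr) ltxx.
  have qk := q k (elimN eqP k1) (elimN eqP k2).
  have [lt|ge] := ltnP (stage n w m k) (nth x0 w m).2.
    apply/esym/(pl_order pm); first by rewrite p1 ltnS ltnW.
    by rewrite qk q1.
  apply/esym/negbTE; rewrite -leNgt; apply/ltW/(pl_order pm).
    rewrite ltn_neqAle p1 ltn_neqAle ge andbT.
    apply/andP; split.
      by rewrite -p1; apply: contra k1 => /eqP/val_inj/perm_inj ->.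
    by rewrite -p2; apply: contra k2 => /eqP/val_inj/perm_inj ->.
  rewrite qk q1 ltn_neqAle ge andbT -p2.
  by apply: contra k2 => /eqP/val_inj/perm_inj ->.
by apply/asboolP/idP => [[_]|lt]; rewrite ?curveE //=; split=> //; rewrite -curveE.
Qed.

(** Letters out of range draw no crossing, so this is what a strip actually spells. *)
Definition active u := [seq x <- u | (x.2.+1 < n)%N].

Lemma spells_strip b w1 u w2 l r (H : [/\ 0 <= l, l < r & r <= 1]) :
  realizes b (w1 ++ u ++ w2) ->
  l = (size w1)%:R / (size (w1 ++ u ++ w2))%:R ->
  r = (size w1 + size u)%:R / (size (w1 ++ u ++ w2))%:R ->
  spells b (strip H) (active u).
Proof.
set w := w1 ++ u ++ w2 => rb El Er; have [w0 _ h d] := rb.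
set N := size w in El Er.
pose A := @entries R n N 0 1 w1.
pose B := entries R N (size w1) (state n w1) u.
pose C := entries R N (size w1 + size u) (state n w1 * state n u)%g w2.
have EL : word_entries R n w = A ++ B ++ C.
  by rewrite /word_entries -/N /w !entries_cat add0n mul1g.
have Ab e : e \in A -> e.1 < l.
  by move=> /(entries_bounds w0)/andP[_]; rewrite add0n El.
have Bb e : e \in B -> l < e.1 < r by move=> /(entries_bounds w0); rewrite El Er.
have Cb e : e \in C -> r < e.1 by move=> /(entries_bounds w0)/andP[]; rewrite Er.
have BL e : e \in B -> e \in word_entries R n w.
  by move=> eB; rewrite EL !mem_cat eB orbT.
exists [seq (e.1, ht b e.2.1.1 e.1) | e <- B]; split.
- apply/seteqP; split=> p /=.
    move=> [/(entry_of_crossing d)[e + ->] [/= /andP[el er] _]].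
    rewrite EL !mem_cat => /or3P[/Ab|eB|/Cb].
    + by rewrite ltNge el.
    + exact: map_f.
    + by rewrite ltNge er.
  move=> /mapP[e eB ->]; split; first exact: crossing_of_entry (BL e eB).
  have c := traces_crosses d.1 (BL e eB).
  have := (stripE H b e.2.1.1 (crosses_inW c)).2.
  rewrite curveE; last exact: crosses_inW c.
  by apply; have /andP[? ?] := Bb e eB; rewrite !ltW.
- by move=> p /mapP[e /Bb ? ->].
- by rewrite sorted_map; apply: entries_sorted.
rewrite -map_comp /B.
have [x0 _] : exists x0 : letter, True by exists (tau 0).
(* Generalized to the suffixes of [u], in order to keep the permutation reached after [v1]. *)
have : forall v1 v2, u = v1 ++ v2 ->
    [seq (cvalue b (e.1, ht b e.2.1.1 e.1),
      position b (strip H) (e.1, ht b e.2.1.1 e.1)) |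
      e <- entries R N (size w1 + size v1) (state n w1 * state n v1)%g v2] = active v2.
  move=> v1 v2; elim: v2 v1 => [|x v2 IH] v1 Eu //=.
  have := IH (rcons v1 x); rewrite cat_rcons => /(_ Eu).
  rewrite size_rcons -cats1 state_cat state1 mulgA addnS map_cat => ->.
  have mw : (size w1 + size v1 < size w)%N.
    by rewrite /w Eu !size_cat /=; lia.
  have nx : nth x0 w (size w1 + size v1) = x.
    by rewrite /w Eu -(catA v1) (catA w1 v1) nth_cat size_cat ltnn subnn.
  have sx : stage n w (size w1 + size v1) = (state n w1 * state n v1)%g.
    rewrite /w stage_cat; last by rewrite Eu !size_cat; lia.
    by rewrite Eu -catA take_size_cat.
  have xe c : c \in crossing_at (state n w1 * state n v1)%g x ->
      (midtime R N (size w1 + size v1), c) \in B.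
    move=> cx; apply/(entriesP x0); exists (size v1); split=> //.
      by rewrite Eu size_cat /=; lia.
    by rewrite Eu take_size_cat // nth_cat ltnn subnn.
  case: (adj_spec (state n w1 * state n v1)%g x) => [[C0 E0]|[s1 [s2 [p1 p2 C0 _ _]]]].
    rewrite C0 /= ifN //; apply/negP => lt.
    by have [a [c [_ _]]] := crossing_at_valid (state n w1 * state n v1)%g x.1 lt;
      rewrite -surjective_pairing C0.
  rewrite C0 /= -[X in (X < n)%N]p1 ltn_ord /=; congr (_ :: _).
  have c0 : (s1, s2, x.1) \in crossing_at (state n w1 * state n v1)%g x.
    by rewrite C0 mem_head.
  have eB := xe _ c0.
  have /= -> := d.2 _ (BL _ eB).
  have := @position_entry b w x0 (strip H) (size w1 + size v1) (s1, s2, x.1) rb mw.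
  rewrite nx sx => /(_ c0) -> //; first by case: (x).
  move=> k; apply/stripE.
    by apply: crosses_inW (traces_crosses d.1 (BL _ eB)).
  by have /andP[? ?] := Bb _ eB; rewrite !ltW.
move=> /(_ [::] u erefl); rewrite addn0 state_nil mulg1; exact.
Qed.

Lemma outside_strip w1 u u' w2 k (t : R) : size u = size u' ->
  state n u = state n u' -> (0 < size (w1 ++ u ++ w2))%N -> 0 <= t <= 1 ->
  t < (size w1)%:R / (size (w1 ++ u ++ w2))%:R \/
  (size w1 + size u)%:R / (size (w1 ++ u ++ w2))%:R < t ->
  pl_height (w1 ++ u ++ w2) k t = pl_height (w1 ++ u' ++ w2) k t.
Proof.
move=> su Eu w0 t01 out.
have sw : size (w1 ++ u ++ w2) = size (w1 ++ u' ++ w2) by rewrite !size_cat su.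
have [r pr] := piece_exists w0 t01.
have pr' : in_piece (w1 ++ u' ++ w2) r t by case: pr; rewrite /in_piece -sw.
suff E : stage n (w1 ++ u ++ w2) r = stage n (w1 ++ u' ++ w2) r /\
    stage n (w1 ++ u ++ w2) r.+1 = stage n (w1 ++ u' ++ w2) r.+1.
  by rewrite (pl_heightE _ pr) (pl_heightE _ pr') E.1 E.2 sw.
have [_ /andP[r1 r2]] := pr.
case: out => [lt|gt].
  rewrite ltr_divN // in lt.
  have rw : (r < size w1)%N by rewrite -(ltr_nat R) (le_lt_trans r1).
  by split; rewrite /stage !takel_cat // ltnW.
rewrite ltr_divNl // in gt.
have rw : (size w1 + size u <= r)%N.
  by rewrite -ltnS -(ltr_nat R) (lt_le_trans gt).
have T m : (size w1 + size u <= m)%N ->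
    stage n (w1 ++ u ++ w2) m = stage n (w1 ++ u' ++ w2) m.
  move=> lem; rewrite /stage !catA !take_cat !size_cat -su !ltnNge lem /=.
  by rewrite !state_cat Eu.
by split; apply: T => //; exact: leqW.
Qed.

(** Equal lengths give both drawings the same subdivision of time, so they coincide outside the
    strip; the move itself is asked only of the active letters, which leaves room for padding. *)
Lemma move_realized b b' w1 u u' w2 : size u = size u' -> (0 < size u)%N ->
  state n u = state n u' -> local_move (active u) (active u') ->
  realizes b (w1 ++ u ++ w2) -> realizes b' (w1 ++ u' ++ w2) -> diagram_move b b'.
Proof.
move=> su u0 Eu mv rb rb'; have [w0 _ h d] := rb; have [w0' _ h' d'] := rb'.
have sw : size (w1 ++ u ++ w2) = size (w1 ++ u' ++ w2) by rewrite !size_cat su.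
set N := size (w1 ++ u ++ w2) in w0 d sw *.
pose l : R := (size w1)%:R / N%:R; pose r : R := (size w1 + size u)%:R / N%:R.
have N0 : 0 < N%:R :> R by rewrite ltr0n.
have H : [/\ 0 <= l, l < r & r <= 1].
  split; first by rewrite divr_ge0 ?ler0n.
    by rewrite /l /r ltr_pM2r ?invr_gt0 // ltr_nat -addn1 leq_add2l.
  by rewrite /r ler_pdivrMr // mul1r ler_nat /N !size_cat addnA leq_addr.
have same k t : 0 <= t <= 1 -> ~ (l <= t <= r) -> ht b k t = ht b' k t.
  move=> t01 out; rewrite h // h' //; apply: outside_strip => //.
  by have [lt|lt] := ltP t l; [left | right; rewrite ltNge; apply/negP => le;
    apply: out; rewrite lt].
exists (strip H), (active u), (active u'); split=> //.
- split.
    move=> k t; rewrite unitIE => t01 out; rewrite !curveE // same //.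
    by move=> In; case: out; apply; apply/stripE.
  move=> p cp out; have [e eL Ep] := entry_of_crossing d cp.
  have c := traces_crosses d.1 eL; have t01 := crosses_inW c.
  have out' : ~ (l <= e.1 <= r).
    move=> In; apply: out; rewrite Ep -curveE //.
    exact/stripE.
  suff eL' : e \in word_entries R n (w1 ++ u' ++ w2).
    by rewrite Ep d.2 // same // d'.2.
  move: eL; rewrite /word_entries -sw -/N !entries_cat !mem_cat add0n mul1g -su -Eu.
  case/or3P => [->//|/(entries_bounds w0)/andP[e1 e2]|->]; last by rewrite !orbT.
  by case: out'; rewrite !ltW.
- have I t : l <= t <= r -> 0 <= t <= 1.
    by case: H => l0 _ r1 /andP[lt tr]; rewrite (le_trans l0 lt) (le_trans tr r1).
  split=> k; left=> t /I t01; rewrite curveE //=.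
    by rewrite h //; exact: pl_height_in.
  by rewrite h' //; exact: pl_height_in.
- exact: (spells_strip H rb).
- by apply: (spells_strip H rb'); rewrite -sw // -su.
Qed.

(* The index n is out of range: the letter tau n moves no strand and stands for
   no crossing. *)
Definition idle (m : nat) : seq letter := nseq m (tau n).

Lemma strand_word_idle (p : 'S_n) m w : strand_word p (idle m ++ w) = strand_word p w.
Proof.
elim: m => //= m IH; rewrite crossing_at_out //= adj_out // mulg1.
exact: IH.
Qed.

Lemma state_idle m : state n (idle m) = 1%g.
Proof. by elim: m => [|m IH]; rewrite /= ?state_nil // state_cons IH adj_out // mulg1. Qed.

Lemma active_idle u m : valid n u -> active (u ++ idle m) = u.
Proof.
move=> vu; rewrite /active filter_cat (all_filterP vu).
have -> : [seq x <- idle m | (x.2.+1 < n)%N] = [::].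
  by elim: m => //= m ->; rewrite ltnNge leqnSn.
by rewrite cats0.
Qed.

Lemma local_move_size w w' : local_move w w' -> (0 < size w)%N.
Proof. by case. Qed.

(** The nonempty [w2] keeps every intermediate word nonempty, hence drawable, even where [weq]
    passes through the empty word. *)
Lemma veq_of_weq u u' : weq n u u' -> forall w1 w2 b b', (0 < size w2)%N ->
  realizes b (w1 ++ u ++ w2) -> realizes b' (w1 ++ u' ++ w2) ->
  virtually_equivalent b b'.
Proof.
elim=> {u u'}.
- by move=> w w1 w2 b b' _ rb rb'; exact: realizes_labels rb rb' erefl.
- by move=> u u' _ IH w1 w2 b b' w20 rb rb'; apply: rst_sym; exact: IH rb' rb.
- move=> u u' u'' _ IH _ IH' w1 w2 b b'' w20 rb rb''.
  have [|b' rb'] := @realizes_exists R n (w1 ++ u' ++ w2).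
    by rewrite !size_cat !addn_gt0 w20 !orbT.
  apply: (rst_trans _ _ _ b'); [exact: IH rb rb' | exact: IH' rb' rb''].
- move=> u u' v v' _ IH _ IH' w1 w2 b b'' w20 rb rb''.
  have [|b' rb'] := @realizes_exists R n (w1 ++ (u' ++ v) ++ w2).
    by rewrite !size_cat !addn_gt0 w20 !orbT.
  rewrite -!catA in rb rb' rb''.
  apply: (rst_trans _ _ _ b').
    by apply: IH rb rb'; rewrite size_cat addn_gt0 w20 orbT.
  by apply: (IH' (w1 ++ u') w2) => //; rewrite -!catA.
- move=> u u' mv vu vu' w1 w2 b b' w20 rb rb'.
  have st : state n u = state n u' by apply: weq_state; apply: weq_move.
  (* Both sides are padded to the length [size u + size u'], as R2 and V2 change the number of
     letters. Idle letters affect neither the crossings nor the permutation. *)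
  pose v := u ++ idle (size u'); pose v' := u' ++ idle (size u).
  have [|c rc] := @realizes_exists R n (w1 ++ v ++ w2).
    by rewrite !size_cat !addn_gt0 w20 !orbT.
  have [|c' rc'] := @realizes_exists R n (w1 ++ v' ++ w2).
    by rewrite !size_cat !addn_gt0 w20 !orbT.
  apply: (rst_trans _ _ _ c).
    apply: realizes_labels rb rc _; rewrite /v -catA.
    by rewrite !(strand_word_cat _ w1) !(strand_word_cat _ u) strand_word_idle.
  apply: (rst_trans _ _ _ c'); last first.
    apply: realizes_labels rc' rb' _; rewrite /v' -catA.
    by rewrite !(strand_word_cat _ w1) !(strand_word_cat _ u') strand_word_idle.
  apply: veq_move; apply: move_realized rc rc'.
  + by rewrite !size_cat !size_nseq addnC.
  + by rewrite size_cat addn_gt0 (local_move_size mv).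
  + by rewrite !state_cat !state_idle st.
  + by rewrite !active_idle.
- by move=> x y fxy vxy w1 w2 b b' _ rb rb'; exact: far_swap fxy vxy rb rb'.
Qed.

End LocalMoves.

(** * Gauss diagrams of braid diagrams *)

Section GaussOfDiagram.
Variables (R : realType) (n : nat).
Implicit Types (b : virtual_braid_diagram R n) (i j k : 'I_n).
Implicit Types (e f : entry R n) (L : seq (entry R n)) (w u : seq letter).

Definition on k e := (k == e.2.1.1) || (k == e.2.1.2).

(** The counterpart of [before] for crossings, virtual ones included; it is likewise vacuous without
    a common strand. *)
Definition compat e f : bool := [forall k, on k e && on k f ==> (e.1 < f.1)].

Lemma compat_lt e f : e.1 < f.1 -> compat e f.
Proof. by move=> lt; apply/forallP => k; apply/implyP. Qed.

Definition arrows_of e : seq (arrow R n) :=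
  match e.2.2 with
  | Positive => [:: ((e.2.1.1, e.1), (e.2.1.2, e.1), true)]
  | Negative => [:: ((e.2.1.2, e.1), (e.2.1.1, e.1), false)]
  | Virtual => [::]
  end.

Lemma arrows_ofP e a : a \in arrows_of e ->
  (forall k, touches k a = on k e) /\ (forall k, time_on k a = e.1).
Proof.
rewrite /arrows_of; case: e.2.2 => //; rewrite inE => /eqP ->;
  split=> k; rewrite /touches /on /time_on /= ?if_same //.
by rewrite orbC.
Qed.

Lemma gauss_extension b L : data b L -> pairwise compat L ->
  linear_extension (gauss_of b) (gauss_letters (map snd L)).
Proof.
move=> d pL; exists (flatten (map arrows_of L)); split.
- apply/seteqP; split=> a /=.
    move=> [p [i [j [ij /(descendsE _ _ ij)[Ep c] H]]]].
    have /mapP[e eL [Et Epair]] := (d.1.2 p.1 i j).2 c.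
    have Ev : cvalue b p = e.2.2.
      by rewrite -(d.2 e eL) -Et -Epair /= -Ep; case: (p).
    apply/flatten_mapP; exists e => //; rewrite /arrows_of -Ev -Epair -Et.
    by case: H => -[-> ->]; rewrite mem_head.
  move=> /flatten_mapP[e eL ae].
  have c := traces_crosses d.1 eL.
  have ij : e.2.1.1 != e.2.1.2.
    by apply/eqP => F; rewrite F in c; exact: crosses_irrefl c.
  exists (e.1, ht b e.2.1.1 e.1), e.2.1.1, e.2.1.2; split=> //.
    by apply/descendsE.
  rewrite d.2 //; move: ae; rewrite /arrows_of; case: e.2.2 => //;
    rewrite inE => /eqP ->; by [left | right].
- elim: L pL {d} => //= e L IH /andP[/allP pe pL].
  rewrite pairwise_cat IH // andbT; apply/andP; split.
    apply/allrelP => a c ae /flatten_mapP[f fL cf].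
    have [ta tta] := arrows_ofP ae; have [tc ttc] := arrows_ofP cf.
    apply/forallP => k; rewrite ta tc tta ttc.
    by move/forallP: (pe f fL); apply.
  by rewrite /arrows_of; case: e.2.2.
- move=> a /flatten_mapP[e eL ae].
  have c := traces_crosses d.1 eL.
  have ij : e.2.1.1 != e.2.1.2.
    by apply/eqP => F; rewrite F in c; exact: crosses_irrefl c.
  move: ae; rewrite /arrows_of; case: e.2.2 => //; rewrite inE => /eqP -> //.
  by rewrite /gauss_valid /= eq_sym.
- rewrite /gauss_letters map_flatten -!map_comp; congr flatten.
  by apply: eq_map => -[t [[i j] []]].
Qed.

(** Ties in time are harmless: two simultaneous crossings on one strand would be at the same point,
    hence the same crossing. *)
Lemma compat_sorted b L : data b L -> sorted (fun e f : entry R n => e.1 <= f.1) L ->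
  pairwise compat L.
Proof.
move=> d; rewrite sorted_pairwise => [pL|]; last by move=> ? ? ?; exact: le_trans.
have : pairwise [rel e f : entry R n | (e != f) && (e.1 <= f.1)] L.
  have := pairwise_relI (fun e f : entry R n => e != f) (fun e f : entry R n => e.1 <= f.1) L.
  by rewrite pL -uniq_pairwise (data_uniq d).
apply: sub_mem_pairwise => e f eL fL /= /andP[ne le].
apply/forallP => k; apply/implyP => /andP[ke kf].
rewrite lt_neqAle le andbT; apply: contra ne => /eqP Et.
have ce := traces_crosses d.1 eL; have cf := traces_crosses d.1 fL.
have Ek g : on k g -> crosses (ht b) g.2.1.1 g.2.1.2 g.1 ->
    ht b g.2.1.1 g.1 = ht b k g.1.
  by move=> /orP[] /eqP -> // /crosses_eq.
apply/eqP/(uniq_map_inj_in d.1.1 eL fL)/(traces_inj (admissible_ht b) d.1) => //.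
by rewrite Ek // Ek // Et.
Qed.

Lemma gauss_of_braid b : braid_gauss (gauss_of b).
Proof.
have [L d sL] := data_exists b.
exact: braid_gauss_of_extension (gauss_extension d (compat_sorted d sL)).
Qed.

(** R2 gives Omega2, and R3 gives Omega3 read from right to left, whence the two directions. The
    virtual and mixed moves leave the Gauss word unchanged. *)
Lemma local_move_gauss (p : 'S_n) w w' : local_move w w' -> valid n w -> valid n w' ->
  gauss_word p w = gauss_word p w' \/ word_move (gauss_word p w) (gauss_word p w') \/
  word_move (gauss_word p w') (gauss_word p w).
Proof.
have pos m : (m < n)%N -> exists a : 'I_n, p a = m :> nat.
  by move=> lt; exists (p^-1 (Ordinal lt))%g; rewrite permKV.
have ne (a c : 'I_n) : p a != p c :> nat -> a != c.
  by apply: contra => /eqP ->.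
have S (q : 'S_n) (e : bool) m (x y : 'I_n) :
    q x = (if e then m.+1 else m) :> nat -> q y = (if e then m else m.+1) :> nat ->
    gauss_word q [:: signed e m] = [:: (x, y, e)].
  exact: gauss_word_signed.
have T3 (q : 'S_n) m : gauss_word q [:: tau m] = [::] by exact: (gauss_word_tau q [:: m]).
case=> m; rewrite /valid /= ?andbT => /andP[v1 v2] v3.
- have [a pa] := pos m.+1 v1; have [c pc] := pos m (ltnW v1).
  right; left; rewrite gauss_word_cons gauss_word_nil.
  rewrite (S p true m a c) // (S _ false m a c) /=; try (rewrite permM; adj_lia).
  by apply: Omega2; apply: ne; rewrite pa pc; lia.
- have [a pa] := pos m.+1 v1; have [c pc] := pos m (ltnW v1).
  right; left; rewrite gauss_word_cons gauss_word_nil.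
  rewrite (S p false m c a) // (S _ true m c a) /=; try (rewrite permM; adj_lia).
  by apply: Omega2; apply: ne; rewrite pa pc; lia.
- have v2' : (m.+2 < n)%N by case/andP: v2.
  have [a pa] := pos m.+2 v2'; have [c pc] := pos m.+1 v1; have [d pd] := pos m (ltnW v1).
  clear v2 v3.
  right; right; rewrite !(gauss_word_cons _ _ (_ :: _)) /=.
  rewrite (S p true m c d) // (S p true m.+1 a c) //.
  rewrite (S (p * adj n m)%g true m.+1 a d); [|by rewrite permM; adj_lia..].
  rewrite (S (p * adj n m.+1)%g true m a d); [|by rewrite permM; adj_lia..].
  rewrite (S (p * adj n m * adj n m.+1)%g true m a c);
    [|by rewrite !permM; adj_lia..].
  rewrite (S (p * adj n m.+1 * adj n m)%g true m.+1 c d);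
    [|by rewrite !permM; adj_lia..].
  by apply: Omega3; apply: ne; rewrite ?pa ?pc ?pd; lia.
- by left; rewrite gauss_word_cons !T3.
- by left; rewrite !(gauss_word_cons _ _ (_ :: _)) !T3.
- have v2' : (m.+2 < n)%N by case/andP: v2.
  have [c pc] := pos m.+1 v1; have [d pd] := pos m (ltnW v1); clear v2 v3.
  left; rewrite !(gauss_word_cons _ _ (_ :: _)) /= !T3.
  rewrite (S p true m c d) // (S _ true m.+1 c d) //=; by rewrite !permM; adj_lia.
- have v2' : (m.+2 < n)%N by case/andP: v2.
  have [c pc] := pos m.+1 v1; have [d pd] := pos m (ltnW v1); clear v2 v3.
  left; rewrite !(gauss_word_cons _ _ (_ :: _)) /= !T3.
  rewrite (S p false m d c) // (S _ false m.+1 d c) //=; by rewrite !permM; adj_lia.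
Qed.

Lemma equivalent_of_extensions (g g' : gauss_diagram R n) W1 U U' W2 :
  linear_extension g (W1 ++ U ++ W2) -> linear_extension g' (W1 ++ U' ++ W2) ->
  U = U' \/ word_move U U' \/ word_move U' U -> gauss_perm g = gauss_perm g' ->
  reidemeister_equivalent g g'.
Proof.
move=> e e' H Ep; case: H => [E|[m|m]].
- by apply: rst_step; left; rewrite -E in e'; exact: gauss_homeo_of_extension e e' Ep.
- apply: rst_step; right; exists W1, U, U', W2.
  by split=> //; exact: represents_of_extension.
- apply: rst_sym; apply: rst_step; right; exists W1, U', U, W2.
  by split=> //; exact: represents_of_extension.
Qed.

End GaussOfDiagram.
Arguments compat {R n} e f.

(** * Invariance under moves *)

Section MoveInvariance.
Variables (R : realType) (n : nat).
Implicit Types (b : virtual_braid_diagram R n) (i j k : 'I_n).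
Implicit Types (e f : entry R n) (L : seq (entry R n)) (w : seq letter).

Lemma crosses_local (y y' : 'I_n -> R -> R) i j (t a c : R) : a < t < c ->
  (forall u, 0 <= u <= 1 -> a < u < c -> y i u = y' i u /\ y j u = y' j u) ->
  crosses y i j t -> crosses y' i j t.
Proof.
move=> /andP[ta tc] E [l [r [[l0 lt tr r1] [e H1 H2]]]].
have m1 : l <= Num.max l a by rewrite le_max lexx.
have m2 : a <= Num.max l a by rewrite le_max lexx orbT.
have m3 : Num.min r c <= r by rewrite ge_min lexx.
have m4 : Num.min r c <= c by rewrite ge_min lexx orbT.
have m5 : Num.max l a < t by rewrite gt_max lt.
have m6 : t < Num.min r c by rewrite lt_min tr.
exists (Num.max l a), (Num.min r c); split; first by split; lra.
split.
- by have [||<- <-] := E t; try (apply/andP; split; lra).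
- move=> u /andP[u1 u2]; have [||<- <-] := E u; try (apply/andP; split; lra).
  by apply: H1; apply/andP; split; lra.
- move=> u /andP[u1 u2]; have [||<- <-] := E u; try (apply/andP; split; lra).
  by apply: H2; apply/andP; split; lra.
Qed.

Definition point b e : R * R := (e.1, ht b e.2.1.1 e.1).

Definition strands_of (V : disc R) (A : {set 'I_n}) b : Prop :=
  (forall k t, k \in A -> dleft V <= t <= dright V ->
     dlow V t < ht b k t < dhigh V t) /\
  (forall k t, k \notin A -> 0 <= t <= 1 -> ~ disc_set V (curve b k t)).

Lemma disc_time (V : disc R) t : dleft V <= t <= dright V -> 0 <= t <= 1.
Proof.
by case: (disc_sides V) => l0 _ r1 /andP[lt tr]; rewrite (le_trans l0 lt) (le_trans tr r1).
Qed.

Lemma strandsE V A b k t : strands_of V A b -> 0 <= t <= 1 ->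
  disc_set V (curve b k t) <-> k \in A /\ dleft V <= t <= dright V.
Proof.
move=> [HA HN] t01; split.
  move=> In; split; last by case: In; rewrite curveE.
  by apply: contrapT => /negP kA; exact: (HN k t kA t01).
move=> [kA lt]; rewrite curveE //; split=> //=.
by have /andP[? ?] := HA k t kA lt; rewrite !ltW.
Qed.

Lemma strands_exist V b : cuts_out b V -> exists A, strands_of V A b.
Proof.
move=> cut; exists [set k | `[< forall t, dleft V <= t <= dright V ->
  dlow V t < (curve b k t).2 < dhigh V t >]]%SET; split.
  move=> k t; rewrite finset.inE => /asboolP H lt.
  by have := H t lt; rewrite curveE //; exact: disc_time lt.
move=> k t; rewrite finset.inE => /asboolP H t01.
by case: (cut k) => // /(_ t); rewrite unitIE => /(_ t01).
Qed.

(** By [cuts_out] the point on the left side of [V] decides whether a strand goes through. If it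
    were inside for one diagram and outside for the other, [agree_outside] would identify the two
    points. *)
Lemma strands_agree V A b b' : strands_of V A b -> cuts_out b' V ->
  agree_outside b b' V -> strands_of V A b'.
Proof.
move=> sA cut [E _].
have lr : dleft V <= dleft V <= dright V.
  by rewrite lexx /=; case: (disc_sides V) => _ /ltW.
have t01 := disc_time lr.
have It : unitI R (dleft V) by rewrite unitIE.
split.
  move=> k t kA lt; have t01' := disc_time lt.
  case: (cut k) => [/(_ t lt)|H]; first by rewrite curveE.
  have out := H _ It; have := E k _ It (or_intror out) => Ek.
  by case: out; rewrite -Ek; apply/(strandsE _ sA).
move=> k t kA t01'; case: (cut k) => [H|/(_ t)]; last by rewrite unitIE; exact.
have out : ~ disc_set V (curve b k (dleft V)).
  by move=> /(strandsE _ sA t01)[]; rewrite (negbTE kA).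
have := E k _ It (or_introl out) => Ek.
case: out; rewrite Ek; split; rewrite curveE //=.
have := H _ lr; rewrite curveE //= => /andP[? ?].
by rewrite !ltW.
Qed.

Lemma agree_sym b b' V : agree_outside b b' V ->
  forall k t, 0 <= t <= 1 -> ~ disc_set V (curve b' k t) -> ht b k t = ht b' k t.
Proof.
move=> [E _] k t t01 out; have := E k t; rewrite unitIE => /(_ t01 (or_intror out)).
by rewrite !curveE // => -[].
Qed.

(** If [t] is in the time window of the disc, strands meeting outside the disc are not in [A] and
    agree at all times; otherwise all strands agree near [t]. The bounds -1 and 2 are mere numbers
    outside [0,1]. *)
Lemma crosses_outside b b' V A i j t : strands_of V A b -> strands_of V A b' ->
  (forall k u, 0 <= u <= 1 -> ~ disc_set V (curve b k u) -> ht b k u = ht b' k u) ->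
  crosses (ht b) i j t -> ~ disc_set V (curve b i t) -> crosses (ht b') i j t.
Proof.
move=> sA sA' E c out; have t01 := crosses_inW c.
have outj : ~ disc_set V (curve b j t).
  by move: out; rewrite !curveE // (crosses_eq c).
have [lt|/negP nlt] := boolP (dleft V <= t <= dright V).
  have N k : ~ disc_set V (curve b k t) -> k \notin A.
    by move=> o; apply/negP => kA; apply: o; apply/(strandsE _ sA).
  have Ek k u : k \notin A -> 0 <= u <= 1 -> ht b k u = ht b' k u.
    move=> kA u01; apply: E => // /(strandsE _ sA u01)[].
    by rewrite (negbTE kA).
  by apply: crosses_order c => u u01; rewrite !Ek ?N.
have loc a d : a < t < d -> (forall u, a < u < d -> ~ (dleft V <= u <= dright V)) ->
    crosses (ht b') i j t.
  move=> atd H; apply: crosses_local atd _ c => u u01 au.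
  by split; apply: E => // /(strandsE _ sA u01)[_ /(H u au)].
have [tl|lt] := ltP t (dleft V).
  apply: (loc (-1) (dleft V)); first by rewrite tl andbT; case/andP: t01 => ? _; lra.
  by move=> u /andP[_ ul] /andP[lu _]; move: ul; rewrite ltNge lu.
have rt : dright V < t by rewrite ltNge; apply/negP => tr; apply: nlt; rewrite lt.
apply: (loc (dright V) 2); first by rewrite rt; case/andP: t01 => _ ?; lra.
by move=> u /andP[ru _] /andP[_ ur]; move: ru; rewrite ltNge ur.
Qed.

Lemma entry_outside b b' V A L L' e : strands_of V A b -> strands_of V A b' ->
  (forall k u, 0 <= u <= 1 -> ~ disc_set V (curve b k u) -> ht b k u = ht b' k u) ->
  (forall p, crossings b p -> crossings b' p -> ~ disc_set V p ->
     cvalue b p = cvalue b' p) ->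
  data b L -> data b' L' -> e \in L -> ~ disc_set V (point b e) ->
  e \in L' /\ ~ disc_set V (point b' e).
Proof.
move=> sA sA' E Ev d d' eL out.
have c := traces_crosses d.1 eL; have t01 := crosses_inW c.
have out' : ~ disc_set V (curve b e.2.1.1 e.1) by rewrite curveE.
have c' := crosses_outside sA sA' E c out'.
have Ep : point b' e = point b e by rewrite /point E.
split; last by rewrite Ep.
have /mapP[f fL' [Et Epair]] := (d'.1.2 _ _ _).2 c'.
suff -> : e = f by [].
have vf := d'.2 f fL'; have ve := d.2 e eL.
have cr : crossings b (point b e) by exact: crossing_of_entry d eL.
have cr' : crossings b' (point b e).
  rewrite -Ep; have := crossing_of_entry d' fL'.
  by rewrite /point -Et -Epair.
have := Ev _ cr cr' out; rewrite ve -Ep /point Et.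
have E1 : e.2.1.1 = f.2.1.1 by rewrite -Epair.
rewrite E1 vf => Eval; move: Et Epair Eval {vf ve eL fL' c out out' c' Ep cr cr' E1 t01}.
by case: e f => t [[i j] v] [t' [[i' j'] v']] /= -> [-> ->] ->.
Qed.

(** Supplies the initial order of [word_of_strands] in a disc: the strands of [A], ranked by height,
    take the first positions. *)
Lemma perm_by_order (A : {set 'I_n}) (h : 'I_n -> R) : {in A &, injective h} ->
  exists p : 'S_n, (forall k, (k \in A) = (p k < #|A|)%N) /\
    {in A &, forall k m, (h k < h m) = (p k < p m)%N}.
Proof.
move=> hi; pose xs := sort (fun k m => h k <= h m) (enum A).
have uxs : uniq xs by rewrite sort_uniq enum_uniq.
have mxs k : (k \in xs) = (k \in A) by rewrite mem_sort mem_enum.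
have sx : size xs = #|A| by rewrite size_sort -cardE.
have sxs : sorted (fun k m => h k < h m) xs.
  apply: sorted_lt_of_le => //; first by move=> k m; rewrite !mxs; exact: hi.
  by apply: sort_sorted => k m; exact: le_total.
have [p Hp] := perm_place uxs; exists p.
have idx k : k \in A -> p k = index k xs :> nat.
  move=> kA; rewrite -{1}(nth_index k (_ : k \in xs)) ?mxs // Hp //.
  by rewrite index_mem mxs.
split.
  move=> k; apply/idP/idP => [kA|lt].
    by rewrite idx // -sx index_mem mxs.
  rewrite -sx in lt; have E := Hp k _ lt.
  by move/val_inj/perm_inj: E => <-; rewrite -mxs mem_nth.
have lt k m : k \in A -> m \in A -> (p k < p m)%N -> h k < h m.
  move=> kA mA; rewrite !idx // => lt.
  rewrite -(nth_index k (_ : k \in xs)) ?mxs // -[X in _ < h X](nth_index k (_ : m \in xs)) ?mxs //.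
  apply: (@pairwise_nth_lt _ (fun k m => h k < h m)).
    by rewrite -sorted_pairwise // => ? ? ?; exact: lt_trans.
  by rewrite lt index_mem mxs.
move=> k m kA mA; apply/idP/idP => [H|]; last exact: lt.
rewrite ltnNge leq_eqVlt; apply/negP => /orP[/eqP/val_inj/perm_inj E|/(lt _ _ mA kA)].
  by move: H; rewrite E ltxx.
by move=> /(lt_trans H); rewrite ltxx.
Qed.

Lemma entries_of_crossings b L (ps : seq (R * R)) : data b L ->
  {in ps, forall p, crossings b p} ->
  exists2 LV, {subset LV <= L} & map (point b) LV = ps.
Proof.
move=> d; elim: ps => [|p ps IH] H; first by exists [::].
have [|LV sub E] := IH; first by move=> q qp; apply: H; rewrite inE qp orbT.
have [e eL Ep] := entry_of_crossing d (H p (mem_head _ _)).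
exists (e :: LV); first by move=> f; rewrite inE => /predU1P[->|/sub].
by rewrite /= E Ep.
Qed.

(** Inside the disc a position counts the strands of [A] below the crossing, so the spelled word is
    the one that [word_of_strands] attaches to these strands. *)
Lemma disc_word b V A L w (p : 'S_n) : strands_of V A b -> spells b V w ->
  data b L -> (forall k, (k \in A) = (p k < #|A|)%N) ->
  {in A &, forall k m, (ht b k (dleft V) < ht b m (dleft V)) = (p k < p m)%N} ->
  exists LV, [/\ forall e, e \in LV <-> e \in L /\ disc_set V (point b e),
    sorted (fun e f : entry R n => e.1 < f.1) LV,
    forall e, e \in LV -> [/\ e.2.1.1 \in A, e.2.1.2 \in A & dleft V < e.1 < dright V],
    valid n w /\ map snd LV = strand_word p w &
    {in A &, forall k m, (ht b k (dright V) < ht b m (dright V)) =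
      ((p * state n w)%g k < (p * state n w)%g m)%N}].
Proof.
move=> sA [ps [Eps tps sps Ew]] d pA Op.
have cps q : q \in ps -> crossings b q /\ disc_set V q.
  by move=> qp; have : [set` ps] q by []; rewrite -Eps.
have [LV sub EV] : exists2 LV, {subset LV <= L} & map (point b) LV = ps.
  by apply: (entries_of_crossings d) => q /cps[].
have LVP e : e \in LV -> point b e \in ps by move=> eV; rewrite -EV map_f.
have mem e : e \in LV <-> e \in L /\ disc_set V (point b e).
  split=> [eV|[eL eV]]; first by split; [exact: sub | have [] := cps _ (LVP e eV)].
  have : point b e \in ps.
    have : (crossings b `&` disc_set V) (point b e).
      by split=> //; exact: crossing_of_entry d eL.
    by rewrite Eps.
  rewrite -EV => /mapP[f fV [Et Ey]].
  have fL := sub f fV.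
  by rewrite (uniq_map_inj_in d.1.1 eL fL (traces_inj (admissible_ht b) d.1 eL fL Et Ey)).
have sV : sorted (fun e f : entry R n => e.1 < f.1) LV.
  by move: sps; rewrite -EV sorted_map.
have inA e : e \in LV -> [/\ e.2.1.1 \in A, e.2.1.2 \in A & dleft V < e.1 < dright V].
  move=> eV; have eL := sub e eV; have c := traces_crosses d.1 eL.
  have t01 := crosses_inW c; have [_ In] := cps _ (LVP e eV).
  have I1 : disc_set V (curve b e.2.1.1 e.1) by rewrite curveE.
  have I2 : disc_set V (curve b e.2.1.2 e.1) by rewrite curveE // -(crosses_eq c).
  split; last exact: tps (LVP e eV).
    by case/(strandsE _ sA t01): I1.
  by case/(strandsE _ sA t01): I2.
have [l0 lr r1] := disc_sides V.
have [|k m u kA mA km lu E|vw Elab Ow] :=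
    @word_of_strands R n b A LV (dleft V) (dright V) #|A| p sV l0 (ltW lr) r1 _ _ pA Op.
- move=> e eV; have [iA jA lt] := inA e eV; split=> //.
  exact: traces_crosses d.1 (sub e eV).
- have u01 := disc_time lu.
  have [e eL [Et Ee]] := traces_meet (admissible_ht b) d.1 km u01 E.
  exists e => //; apply/mem; split=> //.
  have In : disc_set V (curve b k u) by apply/(strandsE _ sA).
  rewrite curveE // in In; rewrite /point Et.
  by case: Ee => ->; rewrite //= -E.
have EwV : map (letter_at b A) LV = w.
  rewrite -Ew -EV -map_comp; apply/eq_in_map => e eV /=.
  have eL := sub e eV; have c := traces_crosses d.1 eL; have t01 := crosses_inW c.
  rewrite /letter_at d.2 //; congr (_, _); rewrite /below /position.
  congr #|pred_of_set _|; apply/setP => k; rewrite !finset.inE /=.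
  have [_ _ /andP[lt tr]] := inA e eV.
  apply/andP/asboolP => [[kA lt']|[/(strandsE _ sA t01)[kA _]]]; rewrite curveE //=.
  by split=> //; rewrite -curveE //; apply/(strandsE _ sA) => //; rewrite !ltW.
rewrite EwV in vw Elab Ow.
by exists LV.
Qed.

(** A crossing outside the disc but over its time window involves no strand of [A], so it is
    unrelated to those inside. All outside crossings up to the right side of the disc may therefore
    be listed first, and the inside ones form a factor. *)
Lemma disc_extension b V A L LO LV : strands_of V A b -> data b L ->
  perm_eq L (LO ++ LV) -> pairwise compat LO ->
  sorted (fun e f : entry R n => e.1 < f.1) LV ->
  (forall e, e \in LO -> ~ disc_set V (point b e)) ->
  (forall e, e \in LV -> [/\ e.2.1.1 \in A, e.2.1.2 \in A & dleft V < e.1 < dright V]) ->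
  linear_extension (gauss_of b)
    (gauss_letters (map snd [seq e <- LO | e.1 <= dright V]) ++
     gauss_letters (map snd LV) ++
     gauss_letters (map snd [seq e <- LO | dright V < e.1])).
Proof.
move=> sA d P pO sV out inA; rewrite -!gauss_letters_cat -!map_cat.
have P' : perm_eq L ([seq e <- LO | e.1 <= dright V] ++ LV ++
    [seq e <- LO | dright V < e.1]).
  apply: (perm_trans P); rewrite perm_sym perm_catCA perm_catC perm_cat2r.
  have -> : [seq e <- LO | dright V < e.1] = [seq e <- LO | ~~ (e.1 <= dright V)].
    by apply: eq_filter => e; rewrite ltNge.
  by rewrite perm_filterC.
apply: gauss_extension; first exact: data_perm P' d.
rewrite !pairwise_cat !(pairwise_filter _ pO) /= andbT.
have -> /= : pairwise compat LV.
  rewrite sorted_pairwise in sV; last by move=> ? ? ?; exact: lt_trans.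
  by apply: sub_pairwise sV => e f; exact: compat_lt.
rewrite allrel_catr -!andbA; apply/and3P; split.
- apply/allrelP => e f; rewrite mem_filter => /andP[er eO] fV.
  apply/forallP => k; apply/implyP => /andP[ke kf].
  have [iA jA /andP[lf fr]] := inA f fV.
  have kA : k \in A by case/orP: kf => /eqP ->.
  have eL : e \in L by rewrite (perm_mem P) mem_cat eO.
  have c := traces_crosses d.1 eL; have t01 := crosses_inW c.
  have [el|le] := ltP e.1 (dleft V); first exact: lt_trans el lf.
  case: (out e eO); have Ep : point b e = curve b k e.1.
    by rewrite curveE // /point; case/orP: ke => /eqP -> //; rewrite (crosses_eq c).
  by rewrite Ep; apply/(strandsE _ sA) => //; rewrite le.
- apply/allrelP => e f; rewrite !mem_filter => /andP[er _] /andP[rf _].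
  by apply: compat_lt; exact: le_lt_trans rf.
- rewrite andbT; apply/allrelP => e f eV; rewrite mem_filter => /andP[rf _].
  by apply: compat_lt; apply: lt_trans rf; have [_ _ /andP[]] := inA e eV.
Qed.

Lemma eq_at_left (f : R -> R) (t : R) : continuous f -> 0 < t ->
  (forall u, 0 <= u < t -> f u = 0) -> f t = 0.
Proof.
move=> fc t0 H; apply: contrapT => /eqP ne.
have Z (e : R) : 0 < e -> exists2 u, t - e < u < t + e & f u = 0.
  move=> e0; pose u := Num.max 0 (t - e / 2).
  have u1 : t - e / 2 <= u by rewrite le_max lexx orbT.
  have u2 : u < t by rewrite gt_max t0 /=; lra.
  exists u; first by apply/andP; split; lra.
  by apply: H; rewrite u2 le_max lexx.
have [lt|lt|E] := ltgtP (f t) 0; last by rewrite E eqxx in ne.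
  have [e e0 He] := continuous_lt (fc t) lt.
  by have [u /He] := Z e e0 => + E; rewrite E ltxx.
have [e e0 He] := continuous_gt (fc t) lt.
by have [u /He] := Z e e0 => + E; rewrite E ltxx.
Qed.

(** The crossings [LO] outside the disc are the same for both diagrams, and the strands enter the
    disc in the same order [p]; so the two linear extensions differ only by the Gauss words of [w]
    and [w'] read from [p]. *)
Lemma diagram_move_gauss b b' : diagram_move b b' ->
  reidemeister_equivalent (gauss_of b) (gauss_of b').
Proof.
move=> [V [w [w' [mv ag [cut cut'] sp sp']]]].
have [A sA] := strands_exist cut; have sA' := strands_agree sA cut' ag.
have [l0 lr r1] := disc_sides V.
have ll : dleft V <= dleft V <= dright V by rewrite lexx ltW.
have rr : dleft V <= dright V <= dright V by rewrite lexx andbT ltW.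
have l01 := disc_time ll.
have [E Ev] := ag.
have Eht k u : 0 <= u <= 1 -> ~ disc_set V (curve b k u) -> ht b k u = ht b' k u.
  move=> u01 out; have := E k u; rewrite unitIE => /(_ u01 (or_introl out)).
  by rewrite !curveE // => -[].
have Eht' k u : 0 <= u <= 1 -> ~ disc_set V (curve b' k u) -> ht b' k u = ht b k u.
  by move=> u01 out; rewrite (agree_sym ag).
have [L d sL] := data_exists b; have [L' d' sL'] := data_exists b'.
(* [spells] keeps the crossings off the vertical sides of the disc, so the strands of [A] have
   distinct heights on entering it. *)
have nomeet : {in A &, injective (fun k => ht b k (dleft V))}.
  move=> k m kA mA Ekm; apply: contrapT => /eqP km.
  have In : disc_set V (dleft V, ht b k (dleft V)).
    by rewrite -curveE //; apply/(strandsE _ sA).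
  have cr : crossings b (dleft V, ht b k (dleft V)).
    by exists k, m; split=> //; apply/passesE.
  have [ps [Eps tps _ _]] := sp.
  have : (crossings b `&` disc_set V) (dleft V, ht b k (dleft V)) by [].
  by rewrite Eps => /tps /=; rewrite ltxx.
(* On the left side itself the strands of [A] are in the disc, where nothing is assumed; agreement
   comes by continuity from earlier times, or from the fixed endpoints if the disc starts at 0. *)
have El k : ht b k (dleft V) = ht b' k (dleft V).
  move: l0; rewrite le_eqVlt => /predU1P[l00|l00].
    have [_ _ he _ _] := admissible_ht b; have [_ _ he' _ _] := admissible_ht b'.
    by rewrite -l00 (he k).1 (he' k).1.
  apply/eqP; rewrite -subr_eq0; apply/eqP.
  apply: (@eq_at_left (fun u => ht b k u - ht b' k u)) => //.
    by apply: subf_continuous; exact: ht_continuous.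
  move=> u /andP[u0 ul]; rewrite Eht ?subrr //.
    by rewrite u0 ltW // (lt_le_trans ul) //; case/andP: l01.
  move=> /(strandsE _ sA) []; last by move=> _ /andP[]; rewrite leNgt ul.
  by rewrite u0 ltW // (lt_le_trans ul) //; case/andP: l01.
have [p [pA Op]] := perm_by_order nomeet.
have Op' : {in A &, forall k m, (ht b' k (dleft V) < ht b' m (dleft V)) = (p k < p m)%N}.
  by move=> k m kA mA; rewrite -!El; exact: Op.
have [LV [mV sV inV [vw labV] Or]] := disc_word sA sp d pA Op.
have [LV' [mV' sV' inV' [vw' labV'] Or']] := disc_word sA' sp' d' pA Op'.
have Est : state n w = state n w' by apply: weq_state; exact: weq_move.
pose LO := [seq e <- L | ~~ `[< disc_set V (point b e) >]].
have LOP e : e \in LO <-> e \in L /\ ~ disc_set V (point b e).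
  rewrite mem_filter; split; first by move=> /andP[/asboolP].
  by move=> [eL out]; rewrite eL andbT; apply/asboolP.
have valE q : crossings b q -> crossings b' q -> ~ disc_set V q -> cvalue b q = cvalue b' q.
  by move=> cq _; exact: Ev.
have LO1 e : e \in LO -> e \in L' /\ ~ disc_set V (point b' e).
  by move=> /LOP[eL out]; exact: (entry_outside sA sA' Eht valE d d').
have LO2 e : e \in L' -> ~ disc_set V (point b' e) -> e \in LO.
  move=> eL' out; apply/LOP; apply: (entry_outside sA' sA Eht' _ d' d) => //.
  by move=> q cq' cq out'; rewrite valE.
have uO : uniq LO by rewrite filter_uniq // (data_uniq d).
have uV (X : seq (entry R n)) : sorted (fun e f : entry R n => e.1 < f.1) X -> uniq X.
  apply: sorted_uniq; first by move=> ? ? ?; exact: lt_trans.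
  by move=> ?; exact: ltxx.
have P : perm_eq L (LO ++ LV).
  apply: uniq_perm; first exact: data_uniq d.
    rewrite cat_uniq uO uV // andbT; apply/hasPn => e /mV[_ In].
    by apply/negP => /LOP[_].
  move=> e; rewrite mem_cat; apply/idP/orP => [eL|[/LOP[]|/mV[]] //].
  by have [In|out] := pselect (disc_set V (point b e)); [right; apply/mV | left; apply/LOP].
have P' : perm_eq L' (LO ++ LV').
  apply: uniq_perm; first exact: data_uniq d'.
    rewrite cat_uniq uO uV // andbT; apply/hasPn => e /mV'[_ In].
    by apply/negP => /LO1[_].
  move=> e; rewrite mem_cat; apply/idP/orP => [eL|[/LO1[]|/mV'[]] //].
  have [In|out] := pselect (disc_set V (point b' e)); first by right; apply/mV'.
  by left; exact: LO2.
have pO : pairwise compat LO by apply: pairwise_filter; exact: compat_sorted d sL.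
have e1 := disc_extension sA d P pO sV (fun e eO => ((LOP e).1 eO).2) inV.
have e2 := disc_extension sA' d' P' pO sV' (fun e eO => (LO1 e eO).2) inV'.
apply: equivalent_of_extensions e1 e2 _ _.
  rewrite labV labV'; exact: local_move_gauss.
(* The permutation is the order at time 1. A disc ending earlier leaves that order alone; otherwise
   the strands of [A] end between [dlow V 1] and [dhigh V 1], in the order given by [state], and the
   others end outside that range. *)
rewrite /=; apply: perm_of_order => i j.
have [_ _ he _ _] := admissible_ht b; have [_ _ he' _ _] := admissible_ht b'.
rewrite -!(height_lt R) -!(he _).2 -!(he' _).2.
have I1 : 0 <= (1 : R) <= 1 by rewrite ler01 lexx.
have [r11|r1'] := ltP (dright V) 1.
  have out k : ~ disc_set V (curve b k 1).
    by move=> /(strandsE _ sA I1)[_ /andP[_]]; rewrite leNgt r11.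
  by rewrite !Eht.
have Er : dright V = 1 by apply/eqP; rewrite eq_le r1.
have lr1 : dleft V <= 1 <= dright V by rewrite Er lexx andbT -Er ltW.
have outA k : k \notin A -> ht b k 1 = ht b' k 1 /\ (ht b k 1 < dlow V 1 \/ dhigh V 1 < ht b k 1).
  move=> kA; have out : ~ disc_set V (curve b k 1).
    by move=> /(strandsE _ sA I1)[]; rewrite (negbTE kA).
  split; first exact: Eht.
  rewrite curveE // in out; have [lt|le] := ltP (ht b k 1) (dlow V 1); first by left.
  by right; rewrite ltNge; apply/negP => le'; apply: out; split=> //=; rewrite le.
have inA k : k \in A -> dlow V 1 < ht b k 1 < dhigh V 1 /\ dlow V 1 < ht b' k 1 < dhigh V 1.
  by move=> kA; split; [exact: sA.1 | exact: sA'.1].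
have cmp (x z u : R) : dlow V 1 < x < dhigh V 1 -> dlow V 1 < z < dhigh V 1 ->
    u < dlow V 1 \/ dhigh V 1 < u -> (x < u) = (z < u) /\ (u < x) = (u < z).
  move=> /andP[x1 x2] /andP[z1 z2] [ul|hu].
    rewrite (lt_trans ul x1) (lt_trans ul z1) !ltNge.
    by rewrite (ltW (lt_trans ul x1)) (ltW (lt_trans ul z1)).
  rewrite (lt_trans x2 hu) (lt_trans z2 hu) !ltNge.
  by rewrite (ltW (lt_trans x2 hu)) (ltW (lt_trans z2 hu)).
case: (boolP (i \in A)) => iA; case: (boolP (j \in A)) => jA.
- have := Or i j iA jA; have := Or' i j iA jA.
  by rewrite Er Est => -> ->.
- have [Ej oj] := outA j jA; have [Ii Ii'] := inA i iA.
  by rewrite -Ej; have [-> _] := cmp _ _ _ Ii Ii' oj.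
- have [Ei oi] := outA i iA; have [Ij Ij'] := inA j jA.
  by rewrite -Ei; have [_ ->] := cmp _ _ _ Ij Ij' oi.
- by have [-> _] := outA i iA; have [-> _] := outA j jA.
Qed.

End MoveInvariance.

(** * Invariance under isotopy *)

Section IsotopyInvariance.
Variables (R : realType) (n : nat).
Implicit Types (b : virtual_braid_diagram R n) (i j k : 'I_n).

Lemma near_lt (f g : R -> R) (s : R) : continuous f -> continuous g -> f s < g s ->
  \forall v \near s, f v < g v.
Proof.
move=> fc gc; rewrite -subr_lt0 => lt.
have [e e0 H] := continuous_lt (@subf_continuous R R f g fc gc s) lt.
exists e => // v /= Hv; rewrite -subr_lt0; apply: H.
by move: Hv; rewrite /ball /= ltr_norml => /andP[? ?]; apply/andP; split; lra.
Qed.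

Lemma near_ne (f g : R -> R) (s : R) : continuous f -> continuous g -> f s != g s ->
  \forall v \near s, f v != g v.
Proof.
move=> fc gc; rewrite neq_lt => /orP[lt|lt].
  by apply: filterS (near_lt fc gc lt) => v; rewrite neq_lt => ->.
by apply: filterS (near_lt gc fc lt) => v; rewrite neq_lt => ->; rewrite orbT.
Qed.

(** Connectedness of the segment from 0 to [s], by induction along the points [u * s]; [s] may be
    negative. *)
Lemma locally_constant (T : Type) (F : R -> T) :
  (forall s, \forall v \near s, F v = F s) -> forall s, F s = F 0.
Proof.
move=> Fc s; have sc : continuous (fun v : R => v * s).
  by apply: mulf_continuous; [exact: id_continuous | move=> ?; exact: cvg_cst].
have C (u : R) : exists2 e, 0 < e & forall v, u - e < v < u + e -> F (v * s) = F (u * s).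
  have [e /= e0 H] := sc u _ (Fc (u * s)); exists e => // v /andP[v1 v2]; apply: H.
  by rewrite /ball /= ltr_norml; apply/andP; split; lra.
suff : forall u, 0 <= u <= 1 -> F (u * s) = F 0.
  by move=> /(_ 1); rewrite ler01 lexx mul1r; exact.
apply: (@real_induction R (fun v => F (v * s) = F 0)); first by rewrite mul0r.
- move=> u /andP[u0 _] H; have [e e0 He] := C u; exists (u + e); first by rewrite ltrDl.
  move=> v /andP[uv ve]; rewrite He; first by apply: H; rewrite u0 lexx.
  by apply/andP; split; lra.
- move=> u /andP[u0 _] H; have [e e0 He] := C u.
  pose v := Num.max 0 (u - e / 2).
  have vu : v < u by rewrite gt_max u0 /=; lra.
  have v0 : 0 <= v by rewrite le_max lexx.
  have v1 : u - e / 2 <= v by rewrite le_max lexx orbT.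
  rewrite -(He v); last by apply/andP; split; lra.
  by apply: H; rewrite v0.
Qed.

(** For [v] near [s]: no third strand reaches track [a] ([N1]), [i] is still below [j] at a later
    time [q] ([N2]), and no other track carries a meeting of [i] and [j] from [T a v] to [q] ([N3]).
    A reversed crossing would force such a meeting. Each condition is open, and there are finitely
    many strands and tracks. *)
Lemma crosses_near m (y : R -> 'I_n -> R -> R) (p : R -> 'S_n) (T Z : 'I_m -> R -> R) :
  (forall k, continuous (fun st : R * R => y st.1 k st.2)) ->
  (forall s, admissible (p s) (y s)) ->
  (forall a, continuous (T a)) -> (forall a, continuous (Z a)) ->
  (forall a s, exists i j, [/\ i != j, y s i (T a s) = Z a s & y s j (T a s) = Z a s]) ->
  (forall a c s, T a s = T c s -> Z a s = Z c s -> a = c) ->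
  (forall a s, 0 <= T a s <= 1) ->
  (forall s i j t, i != j -> 0 <= t <= 1 -> y s i t = y s j t ->
     exists2 a, T a s = t & Z a s = y s i t) ->
  forall a s i j, crosses (y s) i j (T a s) -> y s i (T a s) = Z a s ->
  \forall v \near s, crosses (y v) i j (T a v) /\ y v i (T a v) = Z a v.
Proof.
move=> yc A Tc Zc cr inj T01 surj a s i j cij Ei.
have ij : i != j by apply/eqP => F; rewrite F in cij; exact: crosses_irrefl cij.
have Ej : y s j (T a s) = Z a s by rewrite -(crosses_eq cij).
have yT k c : continuous (fun v => y v k (T c v)).
  exact: (comp_continuous (pair_continuous (@id_continuous R) (Tc c)) (yc k)).
case: (cij) => [l [r [[l0 lt tr r1] [_ _ Hr]]]].
pose q := (T a s + r) / 2.
have [q1 q2] : T a s < q /\ q < r by rewrite /q; split; lra.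
have cq : continuous (fun _ : R => q) by move=> ?; exact: cvg_cst.
have yq k : continuous (fun v => y v k q).
  by apply: (comp_continuous (pair_continuous (@id_continuous R) cq) (yc k)).
have N1 : \forall v \near s, forall k, k != i -> k != j -> y v k (T a v) != Z a v.
  apply: (@filter_forall _ _ _ _ (nbhs_filter s)) => k.
  have [->|ki] := eqVneq k i; first by apply: nearW.
  have [->|kj] := eqVneq k j; first by apply: nearW.
  have [_ _ _ _ G] := A s.
  have [G1 _] := G (T a s) i j ij (T01 a s) (crosses_eq cij).
  have ne : y s k (T a s) != Z a s.
    by apply/eqP; rewrite -Ei => /G1[] E; [rewrite E eqxx in ki | rewrite E eqxx in kj].
  by apply: filterS (near_ne (yT k a) (Zc a) ne).
have N2 : \forall v \near s, y v i q < y v j q.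
  by apply: near_lt => //; apply: Hr; rewrite q1.
(* At [s] itself another track is earlier, later than [q], or off one of the two strands; each of
   these strict conditions persists near [s]. *)
have N3 : \forall v \near s, forall c, c != a ->
    [\/ T c v < T a v, q < T c v, y v i (T c v) != Z c v | y v j (T c v) != Z c v].
  apply: (@filter_forall _ _ _ _ (nbhs_filter s)) => c; have [->|ca] := eqVneq c a; first exact: nearW.
  have [Tl|Tr|Te] := ltgtP (T c s) (T a s).
  - by apply: filterS (near_lt (Tc c) (Tc a) Tl) => v ? _; constructor 1.
  - have [rc|cr'] := ltP q (T c s).
      by apply: filterS (near_lt cq (Tc c) rc) => v ? _; constructor 2.
    have [Ec|Ec] := eqVneq (y s i (T c s)) (Z c s); last first.
      by apply: filterS (near_ne (yT i c) (Zc c) Ec) => v ? _; constructor 3.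
    have ne : y s j (T c s) != Z c s.
      by rewrite -Ec gt_eqF // Hr // Tr (le_lt_trans cr').
    by apply: filterS (near_ne (yT j c) (Zc c) ne) => v ? _; constructor 4.
  - have ne : y s i (T c s) != Z c s.
      apply/eqP; rewrite Te Ei => /esym E.
      by move/eqP: ca; apply; exact: inj Te E.
    by apply: filterS (near_ne (yT i c) (Zc c) ne) => v ? _; constructor 3.
have N4 : \forall v \near s, T a v < q by apply: near_lt (Tc a) cq q1.
apply: filterS (filterI (filterI N1 N2) (filterI N3 N4)) => v [[n1 n2] [n3 n4]].
have [Ei' Ej'] : y v i (T a v) = Z a v /\ y v j (T a v) = Z a v.
  have D k : y v k (T a v) = Z a v -> k = i \/ k = j.
    move=> E; have [->|ki] := eqVneq k i; first by left.
    have [->|kj] := eqVneq k j; first by right.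
    by have := n1 k ki kj; rewrite E eqxx.
  have [i' [j' [ij' E1 E2]]] := cr a v.
  have Di := D i' E1; have Dj := D j' E2.
  by move: ij' E1 E2; case: Di => ->; case: Dj => ->; rewrite ?eqxx.
have [_ _ _ _ G] := A v.
have [_ [//|cji]] := G (T a v) i j ij (T01 a v) (etrans Ei' (esym Ej')).
(* If [j] descended instead, [i] would be above [j] at [u], just after the crossing, and below it at
   [q]; the meeting between them lies on a track excluded by [N3]. *)
case: cji => [l' [r' [[_ _ tr' _] [_ _ Hr']]]].
pose u := (T a v + Num.min q r') / 2.
have m1 : T a v < Num.min q r' by rewrite lt_min n4.
have m2 : Num.min q r' <= q by rewrite ge_min lexx.
have m3 : Num.min q r' <= r' by rewrite ge_min lexx orbT.
have [u1 u2 u3] : [/\ T a v < u, u < r' & u <= q] by rewrite /u; split; lra.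
have cy k : continuous (y v k) by case: (A v).
have [t /andP[ut tq] E] : exists2 t, u <= t <= q & y v i t - y v j t = 0.
  apply: (@IVT_zero R (fun t => y v i t - y v j t)) => //; first exact: subf_continuous.
  rewrite nmulr_lle0; last by rewrite subr_lt0.
  by rewrite subr_ge0 ltW // Hr' // u1.
have Eij : y v i t = y v j t by apply/eqP; rewrite -subr_eq0 E.
have t01 : 0 <= t <= 1 by case/andP: (T01 a v) => ? ?; apply/andP; split; lra.
have [c Tct Zct] := surj v i j t ij t01 Eij.
have ca : c != a by apply/eqP => F; rewrite F in Tct; lra.
by case: (n3 c ca); rewrite Tct ?Zct -?Eij ?eqxx //; lra.
Qed.


Lemma isotopic_gauss b b' : isotopic b b' ->
  reidemeister_equivalent (gauss_of b) (gauss_of b').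
Proof.
move=> [H [H0 H1 Hc [m [x [xc xb xv]]]]].
have I s : unitI R (clamp s) by rewrite unitIE clamp01.
(* Clamping [s] extends the isotopy to the whole line, where [locally_constant] applies. *)
pose B s := H (clamp s); pose y s := ht (B s).
pose T a s := (x a (clamp s)).1; pose Z a s := (x a (clamp s)).2.
have yc k : continuous (fun st : R * R => y st.1 k st.2).
  have cc : continuous (fun st : R * R => (clamp st.1, clamp st.2)).
    apply: pair_continuous.
      exact: (comp_continuous (@fst_continuous R R) (@clamp_continuous R)).
    exact: (comp_continuous (@snd_continuous R R) (@clamp_continuous R)).
  have Hcc := within_comp (Hc k) cc (fun st => conj (I st.1) (I st.2)).
  exact: (comp_continuous Hcc (@snd_continuous R R)).
have A s : admissible (strand_perm (B s)) (y s) by exact: admissible_ht.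
have xcc a : continuous (fun s => x a (clamp s)).
  exact: (within_comp (xc a) (@clamp_continuous R) I).
have Tc a : continuous (T a) by exact: (comp_continuous (xcc a) (@fst_continuous R R)).
have Zc a : continuous (Z a) by exact: (comp_continuous (xcc a) (@snd_continuous R R)).
have cr a s : exists i j, [/\ i != j, y s i (T a s) = Z a s & y s j (T a s) = Z a s].
  have [xf _ _] := xb _ (I s); have [i [j [ij /passesE[_ E1] /passesE[_ E2]]]] := xf a Logic.I.
  by exists i, j.
have T01 a s : 0 <= T a s <= 1.
  by have [xf _ _] := xb _ (I s); have [i [j [ij /passesE[]]]] := xf a Logic.I.
have inj a c s : T a s = T c s -> Z a s = Z c s -> a = c.
  move=> E1 E2; have [_ xi _] := xb _ (I s); apply: xi; rewrite ?inE //=.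
  by rewrite (surjective_pairing (x a _)) (surjective_pairing (x c _)) -/(T a s) -/(Z a s) E1 E2.
have surj s i j t : i != j -> 0 <= t <= 1 -> y s i t = y s j t ->
    exists2 a, T a s = t & Z a s = y s i t.
  move=> ij t01 E; have [_ _ xs] := xb _ (I s).
  have [|a _ Ea] := xs (t, y s i t); last by exists a; rewrite /T /Z Ea.
  by exists i, j; split=> //; apply/passesE.
(* The ordered pair of strands on track [a], descending strand first: unique at each [s], locally
   constant by [crosses_near], hence constant. *)
pose Q a s (l : 'I_n * 'I_n) := crosses (y s) l.1 l.2 (T a s) /\ y s l.1 (T a s) = Z a s.
have Quniq a s l l' : Q a s l -> Q a s l' -> l = l'.
  move=> [c E] [c' E']; rewrite (surjective_pairing l) (surjective_pairing l').
  by apply: crosses_same (A s) c c' _; rewrite E E'.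
have /choice[l0 Hl0] : forall z : 'I_m * R, exists l, Q z.1 z.2 l.
  move=> [a s]; have [i [j [ij E1 E2]]] := cr a s; have [_ _ _ _ G] := A s.
  have [_ [c|c]] := G _ i j ij (T01 a s) (etrans E1 (esym E2)).
    by exists (i, j).
  by exists (j, i).
have lc a s : l0 (a, s) = l0 (a, 0).
  apply: (locally_constant (F := fun s => l0 (a, s))) => {}s.
  have [c E] := Hl0 (a, s).
  apply: filterS (crosses_near yc A Tc Zc cr inj T01 surj c E) => v Hv.
  exact: Quniq (Hl0 (a, v)) Hv.
pose l a := l0 (a, 0).
have Ql a s : Q a s (l a) by have := Hl0 (a, s); rewrite lc.
have onZ a s k : (k == (l a).1) || (k == (l a).2) -> y s k (T a s) = Z a s.
  by have [c <-] := Ql a s; move=> /orP[] /eqP -> //; rewrite (crosses_eq c).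
(* Equal times would put both crossings at the same point of their common strand [k], against the
   injectivity of the tracks; so the order along [k] is locally constant. *)
have Tord a c k s : a != c -> (k == (l a).1) || (k == (l a).2) ->
    (k == (l c).1) || (k == (l c).2) -> (T a s < T c s) = (T a 0 < T c 0).
  move=> ac ka kc; apply: (locally_constant (F := fun s => T a s < T c s)) => {}s.
  have [lt|lt|E] := ltgtP (T a s) (T c s).
  - exact: near_lt (Tc a) (Tc c) lt.
  - by apply: filterS (near_lt (Tc c) (Tc a) lt) => v /ltW; rewrite leNgt => /negbTE.
  - by move/eqP: ac; case; apply: (inj a c s E); rewrite -(onZ a s k ka) -(onZ c s k kc) E.
pose o := sort (fun a c => T a 0 <= T c 0) (enum 'I_m).
have uo : uniq o by rewrite sort_uniq enum_uniq.
have mo a : a \in o by rewrite mem_sort mem_enum.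
pose E s a : entry R n := (T a s, (l a, cvalue b (x a 0))).
have dE s : data (B s) (map (E s) o).
  split; last first.
    move=> e /mapP[a _ ->] /=; have [_ Ez] := Ql a s.
    transitivity (cvalue (B s) (x a (clamp s))); last by rewrite xv // H0.
    by rewrite (surjective_pairing (x a _)); congr (cvalue _ (_, _)).
  split.
    rewrite /pairs -map_comp map_inj_uniq // => a c /= [ET El].
    apply: (inj a c s ET); have [_ <-] := Ql a s; have [_ <-] := Ql c s.
    by rewrite ET El.
  move=> t i j; split.
    rewrite /pairs -map_comp => /mapP[a _ [-> Eij]].
    by have [c _] := Ql a s; rewrite -Eij in c.
  move=> c; have ij : i != j by apply/eqP => F; rewrite F in c; exact: crosses_irrefl c.
  have [a Ta Za] := surj s i j t ij (crosses_inW c) (crosses_eq c).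
  rewrite /pairs -map_comp; apply/mapP; exists a => //=; rewrite Ta; congr (_, _).
  by apply: (Quniq a s) => //; split; rewrite /= Ta.
have B0 : B 0 = b by rewrite /B clamp_id ?lexx ?ler01.
have B1 : B 1 = b' by rewrite /B clamp_id ?lexx ?ler01.
have d0 := dE 0; have d1 := dE 1; rewrite B0 in d0; rewrite B1 in d1.
have p0 : pairwise compat (map (E 0) o).
  apply: compat_sorted d0 _; rewrite sorted_map.
  by apply: sort_sorted => a c; exact: le_total.
(* The list, sorted by the times at stage 0, need not be sorted at stage 1; the order along each
   strand, which is all that [compat] asks, is preserved. *)
have p1 : pairwise compat (map (E 1) o).
  move: p0; rewrite !pairwise_map => p0.
  have : pairwise [rel a c : 'I_m | (a != c) && compat (E 0 a) (E 0 c)] o.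
    rewrite (pairwise_relI (fun a c : 'I_m => a != c) (relpre (E 0) compat)).
    by rewrite -uniq_pairwise uo.
  apply: sub_pairwise => a c /= /andP[ac /forallP Hac].
  apply/forallP => k; apply/implyP => /andP[ka kc].
  by rewrite /= (Tord a c k 1 ac ka kc); move/implyP: (Hac k); apply; apply/andP.
apply: rst_step; left; apply: gauss_homeo_of_extension (gauss_extension d0 p0) _ _.
  by have := gauss_extension d1 p1; rewrite -!map_comp.
rewrite /= -B0 -B1; apply: perm_of_order => i j.
(* Right endpoints of different strands have distinct heights at each stage, so their order cannot
   change. *)
suff S s : (strand_perm (B s) i < strand_perm (B s) j)%N =
    (strand_perm (B 0%R) i < strand_perm (B 0%R) j)%N by rewrite (S 0) (S 1).
have [->|ij] := eqVneq i j; first by rewrite !ltnn.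
have Eo v : (strand_perm (B v) i < strand_perm (B v) j)%N = (y v i 1 < y v j 1).
  by have [_ _ he _ _] := A v; rewrite !(he _).2 height_lt.
rewrite !Eo; apply: (locally_constant (F := fun s => y s i 1 < y s j 1)) => {}s.
have y1 k : continuous (fun v => y v k 1).
  have c1 : continuous (fun _ : R => (1 : R)) by move=> ?; exact: cvg_cst.
  exact: (comp_continuous (pair_continuous (@id_continuous R) c1) (yc k)).
have [lt|lt|E1] := ltgtP (y s i 1) (y s j 1).
- exact: near_lt (y1 i) (y1 j) lt.
- by apply: filterS (near_lt (y1 j) (y1 i) lt) => v /ltW; rewrite leNgt => /negbTE.
- have [_ _ he _ _] := A s; move: E1; rewrite !(he _).2 => /height_inj /perm_inj E1.
  by rewrite E1 eqxx in ij.
Qed.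

End IsotopyInvariance.

(** * The bijection *)

Section Bijection.
Variables (R : realType) (n : nat).
Implicit Types (b : virtual_braid_diagram R n) (g : gauss_diagram R n) (w : seq letter).

Lemma veq_gauss b b' : virtually_equivalent b b' ->
  reidemeister_equivalent (gauss_of b) (gauss_of b').
Proof.
elim=> [c c' []|c|c c' _|c c' c'' _ H _]; first exact: isotopic_gauss.
- exact: diagram_move_gauss.
- exact: rst_refl.
- exact: rst_sym.
- exact: rst_trans H.
Qed.

Lemma realizes_gauss b w : realizes b w ->
  linear_extension (gauss_of b) (gauss_word 1 w).
Proof.
move=> [w0 _ _ d]; rewrite /gauss_word.
have <- : map snd (word_entries R n w) = strand_word 1 w by exact: entries_labels.
apply: (gauss_extension d); apply: compat_sorted d _.
by apply: (sub_sorted (e := fun e f : entry R n => e.1 < f.1)) => [e f /ltW|]; last exact: entries_sorted.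
Qed.

(** The trailing idle letter makes the word nonempty even for a diagram without crossings. *)
Lemma equivalent_realization b :
  exists w c, [/\ valid n w, realizes c (w ++ idle n 1) & virtually_equivalent b c].
Proof.
have [b1 [L [b1b d sL]]] := separate_times b; have [w [vw Ew _]] := word_of_data d sL.
have w0 : (0 < size (w ++ idle n 1))%N by rewrite size_cat addn1.
have [c rc] := realizes_exists R n w0; exists w, c; split=> //.
have [_ _ _ dc] := rc.
have [||z bz zc] := same_labels_isotopic d dc sL; first exact: entries_sorted.
  by rewrite Ew entries_labels strand_word_cat /= crossing_at_out ?cats0.
apply: (rst_trans _ _ _ _ _ b1b).
exact: (rst_trans _ _ _ _ _ (veq_isotopic bz) (veq_isotopic zc)).
Qed.

Lemma realizes_idle_gauss b w : realizes b (w ++ idle n 1) ->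
  linear_extension (gauss_of b) (gauss_word 1 w) /\ gauss_perm (gauss_of b) = state n w.
Proof.
move=> rb; have [_ pb _ _] := rb; split.
  have := realizes_gauss rb.
  by rewrite /gauss_word strand_word_cat /= crossing_at_out // !cats0.
by rewrite /= pb state_cat state_idle mulg1.
Qed.

(** Both diagrams are replaced by drawings of words. Their Gauss words are then related by [gequiv]
    and their permutations agree, so the words are related by [weq], which can be carried out on
    drawings. *)
Lemma gauss_veq b b' : reidemeister_equivalent (gauss_of b) (gauss_of b') ->
  virtually_equivalent b b'.
Proof.
move=> e; have [w [c [vw rc bc]]] := equivalent_realization b.
have [w' [c' [vw' rc' bc']]] := equivalent_realization b'.
have {}e : reidemeister_equivalent (gauss_of c) (gauss_of c').
  apply: (rst_trans _ _ _ _ _ (rst_sym _ _ _ _ (veq_gauss bc))).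
  exact: (rst_trans _ _ _ _ _ e (veq_gauss bc')).
have [x p] := realizes_idle_gauss rc; have [x' p'] := realizes_idle_gauss rc'.
have [_ /(_ _ _ x x')[ge pe]] := reidemeister_geq e.
have we := weq_of_geq vw vw' (etrans (esym p) (etrans pe p')) ge.
apply: (rst_trans _ _ _ _ _ bc); apply: (rst_trans _ _ _ c' _ _ (rst_sym _ _ _ _ bc')).
exact: (@veq_of_weq R n _ _ we [::] (idle n 1)).
Qed.

Lemma braid_gauss_realized g : braid_gauss g -> exists b, gauss_homeo (gauss_of b) g.
Proof.
move=> /braid_gauss_extension[W x].
have [w [vw sw Ew]] := word_realize (gauss_perm g) (extension_valid x).
have w0 : (0 < size (w ++ idle n 1))%N by rewrite size_cat addn1.
have [b rb] := realizes_exists R n w0; exists b.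
have [y p] := realizes_idle_gauss rb; rewrite Ew in y; rewrite sw in p.
exact: gauss_homeo_of_extension y x p.
Qed.

End Bijection.

Theorem proposition2p24 (R : realType) (n : nat) :
  exists Phi : set (virtual_braid_diagram R n) -> set (gauss_diagram R n),
    (forall b : virtual_braid_diagram R n,
       Phi (virtual_braid_of b) = gauss_class (gauss_of b)) /\
    set_bij (VB R n) (bG R n) Phi.
Proof.
(* Collecting everything equivalent to the Gauss diagram of some member of the class avoids choosing
   a representative. *)
pose Phi (X : set (virtual_braid_diagram R n)) : set (gauss_diagram R n) :=
  [set g | exists2 b, X b & reidemeister_equivalent (gauss_of b) g].
have PhiE b : Phi (virtual_braid_of b) = gauss_class (gauss_of b).
  apply/seteqP; split=> g /=; last by move=> H; exists b => //; exact: rst_refl.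
  by move=> [c /veq_gauss bc cg]; exact: rst_trans bc cg.
exists Phi; split=> //; split.
- move=> _ [b _ <-] /=; rewrite PhiE; exists (gauss_of b) => //.
  exact: gauss_of_braid.
- move=> X Y /set_mem[b _ <-] /set_mem[c _ <-]; rewrite !PhiE => E.
  have bc : virtually_equivalent b c.
    apply: gauss_veq; have : gauss_class (gauss_of c) (gauss_of c) by exact: rst_refl.
    by rewrite -E.
  apply/seteqP; split=> d /=; first exact: (rst_trans _ _ _ _ _ (rst_sym _ _ _ _ bc)).
  exact: (rst_trans _ _ _ _ _ bc).
- move=> _ [g bg <-]; have [b bg'] := braid_gauss_realized bg.
  exists (virtual_braid_of b); first by exists b.
  have e : reidemeister_equivalent (gauss_of b) g by apply: rst_step; left.
  rewrite PhiE; apply/seteqP; split=> h /=.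
    exact: (rst_trans _ _ _ _ _ (rst_sym _ _ _ _ e)).
  exact: (rst_trans _ _ _ _ _ e).
Qed.
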